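(* Assume that $$\mu^{(N)}_0=\frac1N\sum_{i=1}^N\delta_{(\rho^{(N)}_i,(x^{(N)}_i-1)/N)}\to\mu_0$$ weakly as $N\to\infty$ for a probability distribution $\mu_0$ on $\mathcal M(\mathbb{R}_+)\times[0,1)$. Put $\Lambda^{(N)}(d\rho)=\mu^{(N)}_0(d\rho\times[0,1))=\frac1N\sum_{i=1}^N\delta_{\rho^{(N)}_i}(d\rho)$ and $\Lambda(d\rho)=\mu_0(d\rho\times[0,1))$. Assume that for each $(s,t)$ with $t\ge s\ge0$, $$\lambda^{(N)}_{s,t}:=\int_{\mathcal M(\mathbb{R}_+)}\delta_{\rho((s,t])}\,\Lambda^{(N)}(d\rho)\ \to\ \lambda_{s,t}:=\int_{\mathcal M(\mathbb{R}_+)}\delta_{\rho((s,t])}\,\Lambda(d\rho)\quad\text{weakly as }N\to\infty.$$ Then for any $t>0$, and for almost all $\omega\in\Omega$, the distribution $$\mu^{(N)}_t(\omega)=\frac1N\sum_{i=1}^N\delta_{(\rho^{(N)}_i,\,Y^{(N)}_i(t)(\omega))}$$ converges weakly as $N\to\infty$ to a non-random probability distribution $\mu_t$ on $\mathcal M(\mathbb{R}_+)\times[0,1)$. The distribution $\mu_t$ has the following expression in terms of $U(d\rho,y,t):=\mu_t(d\rho\times[y,1))$: $$U(d\rho,y,t)=\begin{cases}e^{-\rho((t-t_0(y,t),t])}\,\Lambda(d\rho), & 0\le y\le y_C(t),\\[2pt] e^{-\rho((0,t])}\,U(d\rho,\hat y(y,t),0), & y_C(t)\le y<1,\end{cases}$$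 where $U(d\rho,y,0)=\mu_0(d\rho\times[y,1))$ and $$y_C(t)=1-\int_{\mathcal M(\mathbb{R}_+)}e^{-\rho((0,t])}\,\Lambda(d\rho).$$ Here $t_0(y,t)=\inf\{s\in[0,t]:\ y_A(s,t)\ge y\}$ is the inverse function with respect to $t_0$ of $$y_A(t_0,t)=1-\int_{\mathcal M(\mathbb{R}_+)}e^{-\rho((t-t_0,t])}\,\Lambda(d\rho),\quad 0\le t_0\le t,$$ and $\hat y(y,t)=\inf\{x\in[0,1):\ y_B(x,t)\ge y\}$ is the inverse function with respect to $y$ of $$y_B(y,t)=1-\int_{\mathcal M(\mathbb{R}_+)}e^{-\rho((0,t])}\,\mu_0(d\rho\times[y,1)),\quad t\ge0,\ 0\le y<1.$$
   Context: $\mathbb{R}_+=[0,\infty)$; $\delta_c$ is the unit point mass at $c$ (on any space). $\mathcal M(\mathbb{R}_+)$ is the space of Radon measures on the Borel sets of $\mathbb{R}_+$ with the vague topology: $\rho_n\to\rho$ iff $\int f\,d\rho_n\to\int f\,d\rho$ for all continuous $f$ with compact support; it is a Polish space, as is $\mathcal M(\mathbb{R}_+)\times[0,1)$. For each positive integer $N$, $\nu^{(N)}_1,\dots,\nu^{(N)}_N$ are independent Poisson random measures on $\mathbb{R}_+$, defined on a probability space $(\Omega,\mathcal F,\mathrm P)$, with intensity measures $\rho^{(N)}_i\in\mathcal M(\mathbb{R}_+)$, i.e. $\mathrm E[\nu^{(N)}_i(A)]=\rho^{(N)}_i(A)$; each $\rho^{(N)}_i$ is continuous ($\rho^{(N)}_i(\{t\})=0$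 for all $t\ge0$). As part of the setting, with probability $1$, $\nu^{(N)}_i=\sum_{j=1}^\infty\delta_{\tau^{(N)}_{i,j}}$ with $0<\tau^{(N)}_{i,1}<\tau^{(N)}_{i,2}<\cdots$, and $\tau^{(N)}_{i,j}\ne\tau^{(N)}_{i',j'}$ if $(i,j)\neq(i',j')$. Let $x^{(N)}_1,\dots,x^{(N)}_N$ be a permutation of $1,\dots,N$. The stochastic ranking process $X^{(N)}=(X^{(N)}_1,\dots,X^{(N)}_N)$ is the process determined by $$X^{(N)}_i(t)=x^{(N)}_i+\sum_{k=1}^N\int_0^t\mathbf 1_{\{X^{(N)}_k(s-0)>X^{(N)}_i(s-0)\}}\,\nu^{(N)}_k(ds)+\int_0^t(1-X^{(N)}_i(s-0))\,\nu^{(N)}_i(ds),$$ equivalently, $X^{(N)}_i(t)=x^{(N)}_i+\sum_{i':\,x^{(N)}_{i'}>x^{(N)}_i}\mathbf 1_{\{\tau^{(N)}_{i',1}\le t\}}$ for $0\le t<\tau^{(N)}_{i,1}$, and $X^{(N)}_i(t)=1+\sum_{i'=1}^N\mathbf 1_{\{\exists j':\ \tau^{(N)}_{i,j}<\tau^{(N)}_{i',j'}\le t\}}$ for $\tau^{(N)}_{i,j}\le t<\tau^{(N)}_{i,j+1}$, $j=1,2,\dots$. The scaled positions are $Y^{(N)}_i(t)=\frac1N(X^{(N)}_i(t)-1)$.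
   Formalization: That t_0(·,t) inverts y_A(·,t), i.e. y_A(t_0(y,t),t)=y for 0≤y≤y_C(t), is assumed at the t considered: it can fail if limit measures ρ have atoms, and the formula for U is then false. Since positions are uniform in the limit, the formula itself forces this condition. *)

(* Defs.v *)
From HB Require Import structures.
From mathcomp Require Import all_boot all_order all_algebra all_fingroup.
From mathcomp Require Import all_classical all_reals all_analysis.
From mathcomp Require Import measurable_realfun ring lra.

Set Implicit Arguments.
Unset Strict Implicit.
Unset Printing Implicit Defensive.

Import Order.TTheory GRing.Theory Num.Theory.
Import numFieldNormedType.Exports.

Local Open Scope classical_set_scope.
Local Open Scope ring_scope.

Section borel_weak.

Definition borel (T : ptopologicalType) : Type :=
  g_sigma_algebraType (@open T).

HB.instance Definition _ (T : ptopologicalType) := Measurable.on (borel T).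

Definition weak_cvg (R : realType) (T : ptopologicalType)
    (m_ : nat -> {measure set (borel T) -> \bar R})
    (m : {measure set (borel T) -> \bar R}) : Prop :=
  forall f : T -> R, continuous f -> bounded_fun f ->
    \int[m_ n]_x f x @[n --> \oo] --> \int[m]_x f x.

End borel_weak.

HB.instance Definition _ (S T : ptopologicalType) := Pointed.on (S * T)%type.

Section unit_interval.
Variable R : realType.

Definition I01 : Type := (`[0, 1[%classic : set R).

HB.instance Definition _ := SubType.on I01.
HB.instance Definition _ := Topological.on I01.

Fact I01_0_subproof : (0 : R) \in (`[0, 1[%classic : set R).
Proof. by rewrite inE /= in_itv /= lexx ltr01. Qed.

Definition I01_0 : I01 := exist _ 0 I01_0_subproof.

HB.instance Definition _ := isPointed.Build I01 I01_0.

End unit_interval.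

Section radon_def.
Variable R : realType.

(* A Radon measure on [0, +oo[ is encoded by its extension by 0 to the Borel
   sets of R.  Since the elements of {measure set R -> \bar R} also take
   (unconstrained) values on nonmeasurable sets, these are set to 0, so that
   radon measures agreeing on the Borel sets are equal. *)
Record radon := Radon {
  radon_measure :> {measure set R -> \bar R} ;
  radon_compact : forall K : set R, compact K -> (radon_measure K < +oo)%E ;
  radon_neg : radon_measure `]-oo, 0[%classic = 0%E ;
  radon_nonmeasurable :
    forall A : set R, ~ measurable A -> radon_measure A = 0%E
}.

HB.instance Definition _ := gen_eqMixin radon.
HB.instance Definition _ := gen_choiceMixin radon.

Fact mzero_compact (K : set R) :
  compact K -> ((mzero : {measure set R -> \bar R}) K < +oo)%E.
Proof. by rewrite /mzero ltey. Qed.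

HB.instance Definition _ := isPointed.Build radon
  (@Radon mzero mzero_compact erefl (fun _ _ => erefl)).

(* The restrictions of these functions to [0, +oo[ are exactly the continuous
   functions with compact support on [0, +oo[. *)
Definition test_fun : Type :=
  {f : R -> R | continuous f /\ compact (closure (f @^-1` [set~ 0]))}.

Definition radon_eval (f : test_fun) (rho : radon) : R :=
  \int[rho]_x sval f x.

(* The vague topology: the coarsest one making all radon_eval f continuous. *)
HB.instance Definition _ := Topological.copy radon
  (sup_topology (fun f : test_fun =>
     Topological.class (initial_topology (radon_eval f)))).

End radon_def.

Lemma continuous_borel_measurable (S T : ptopologicalType) (f : S -> T) :
  continuous f -> measurable_fun setT (f : borel S -> borel T).
Proof.
move=> /continuousP cf.
apply: (@measurability _ _ (borel S) (borel T) setT f (@open T) erefl).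
move=> _ [A oA <-].
by rewrite setTI; apply: sub_sigma_algebra; exact: cf.
Qed.

Lemma continuous_measurable_borel (R : realType) (T : ptopologicalType)
    (f : T -> R) : continuous f -> measurable_fun setT (f : borel T -> R).
Proof.
move=> /continuousP cf.
apply: (measurability _ (RGenOpens.measurableE R)) => _ [_ [a [b ->]] <-].
by rewrite setTI; apply: sub_sigma_algebra; apply: cf; exact: interval_open.
Qed.

Section increments.
Variable R : realType.
Implicit Types (rho : radon R) (s t : R).

Definition incr s t rho : R := fine (rho `]s, t]%classic).

Let trapezoid s t (n : nat) (x : R) : R :=
  Num.max 0 (Num.min 1 (Num.min (n.+1%:R * (x - s)) (1 - n.+1%:R * (x - t)))).

Let trapezoid_cont s t n : continuous (trapezoid s t n).
Proof.
move=> x; rewrite /trapezoid.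
have ca (u : R) : (n.+1%:R * (y - u)) @[y --> x] --> n.+1%:R * (x - u).
  by apply: cvgM; [exact: cvg_cst|apply: cvgB; [exact: cvg_id|exact: cvg_cst]].
apply: (@continuous_max _ R (cst 0) _ x); first exact: cst_continuous.
apply: (@continuous_min _ R (cst 1) _ x); first exact: cst_continuous.
apply: (@continuous_min _ R _ _ x); first exact: ca.
by apply: cvgB; [exact: cvg_cst|exact: ca].
Qed.

Let trapezoid_ge0 s t n x : 0 <= trapezoid s t n x.
Proof. by rewrite /trapezoid le_max lexx. Qed.

Let trapezoid_le1 s t n x : trapezoid s t n x <= 1.
Proof. by rewrite /trapezoid ge_max ler01 ge_min lexx. Qed.

Let trapezoid_out s t n x : trapezoid s t n x != 0 -> s <= x <= t + 1.
Proof.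
have n1 : (1 : R) <= n.+1%:R by rewrite ler1n.
rewrite /trapezoid; apply: contraR; rewrite negb_and -!ltNge => /orP[xs|tx].
  rewrite eq_le ge_max lexx /= le_max lexx !ge_min /= andbT.
  by rewrite mulr_ge0_le0 ?orbT// ?subr_le0 ltW.
rewrite eq_le ge_max lexx /= le_max lexx !ge_min /= andbT.
apply/orP; right; apply/orP; right.
by nra.
Qed.

Let trapezoid_compact s t n :
  compact (closure (trapezoid s t n @^-1` [set~ 0])).
Proof.
apply: (subclosed_compact _ (@segment_compact R s (t + 1))).
  exact: closed_closure.
rewrite (closure_id `[s, t + 1]%classic).1; last exact: interval_closed.
apply: closureS => x /= /eqP /trapezoid_out.
by rewrite in_itv.
Qed.

Let trapezoid_test s t n : test_fun R :=
  exist _ (trapezoid s t n)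
    (conj (@trapezoid_cont s t n) (@trapezoid_compact s t n)).

Let trapezoid_cvg s t x :
  (trapezoid s t n x)%:E @[n --> \oo] --> (\1_(`]s, t]%classic) x)%:E.
Proof.
apply: cvg_near_cst.
rewrite indicE mem_setE in_itv/=.
have [sx|xs] := ltP s x; last first.
  apply: nearW => n /=; congr EFin; apply/eqP/negPn/negP => h.
  have := h; rewrite /trapezoid; apply/negP/negPn.
  rewrite eq_le ge_max lexx /= le_max lexx !ge_min /= andbT.
  by rewrite mulr_ge0_le0 ?orbT// subr_le0.
have [xt|tx] := leP x t; last first.
  have d0 : 0 < x - t by rewrite subr_gt0.
  near=> n; congr EFin; apply/eqP.
  rewrite /trapezoid eq_le ge_max lexx /= le_max lexx !ge_min /= andbT.
  apply/orP; right; apply/orP; right.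
  rewrite subr_le0 -ler_pdivrMr// div1r ltW//.
  apply: (@lt_trans _ _ n%:R); last by rewrite ltr_nat.
  by near: n; exact: nbhs_infty_gtr.
have d0 : 0 < x - s by rewrite subr_gt0.
near=> n; congr EFin; apply/eqP.
rewrite eq_le trapezoid_le1 /= /trapezoid le_max le_min lexx /= le_min.
apply/orP; right; apply/andP; split; last first.
  by rewrite lerBrDl gerDr mulr_ge0_le0// subr_le0.
rewrite -ler_pdivrMr// div1r ltW//.
apply: (@lt_trans _ _ n%:R); last by rewrite ltr_nat.
by near: n; exact: nbhs_infty_gtr.
Unshelve. all: by end_near. Qed.

Lemma radon_eval_continuous (f : test_fun R) : continuous (radon_eval f).
Proof.
move=> rho.
have sub := (@cvg_sup _ _
  (fun f : test_fun R => Topological.class (initial_topology (radon_eval f)))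
  (nbhs rho) rho _).1 (fun A h => h) f.
have h := @initial_continuous (radon R) R (radon_eval f) rho.
by move=> A /h B; apply: sub; exact: B.
Qed.

Lemma measurable_radon_eval (f : test_fun R) :
  measurable_fun setT (radon_eval f : borel (radon R) -> R).
Proof.
exact: (@continuous_measurable_borel R (radon R) _ (@radon_eval_continuous f)).
Qed.

Lemma radon_itv_lt rho s t : (rho `]s, t]%classic < +oo)%E.
Proof.
apply: (@le_lt_trans _ _ (rho `[s, t]%classic)).
  by apply: le_measure; rewrite ?inE//; exact: subset_itv_oc_cc.
exact/radon_compact/segment_compact.
Qed.

Lemma measurable_incr s t :
  measurable_fun setT (incr s t : borel (radon R) -> R).
Proof.
apply: (@measurable_fun_cvg _ (borel (radon R)) R setT
  (fun n (rho : borel (radon R)) => radon_eval (trapezoid_test s t n) rho)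
  (incr s t)).
  by move=> n; exact: measurable_radon_eval.
move=> rho _; rewrite /incr /radon_eval /=.
have [] := @dominated_convergence _ _ _ (radon_measure rho) setT measurableT
  (fun n x => (trapezoid s t n x)%:E) (fun x => (\1_(`]s, t]%classic) x)%:E)
  (fun x => (\1_(`[s, t + 1]%classic) x)%:E).
- move=> n; apply/measurable_EFinP; apply: continuous_measurable_fun.
  exact: trapezoid_cont.
- by apply/measurable_EFinP; exact: measurable_indic.
- by apply: nearW => x _; exact: trapezoid_cvg.
- apply/integrableP; split; first exact/measurable_EFinP/measurable_indic.
  under eq_integral do rewrite gee0_abs ?lee_fin//.
  rewrite integral_indic// setIT.
  exact/radon_compact/segment_compact.
- apply: nearW => x n _; rewrite gee0_abs ?lee_fin//.
  rewrite indicE; have [|xo] := boolP (x \in _); first by rewrite trapezoid_le1.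
  rewrite leNgt; apply/negP => h; move: xo; apply/negP.
  rewrite negbK mem_setE in_itv/=.
  by apply: (trapezoid_out (n := n)); rewrite gt_eqF.
- move=> _ _; rewrite integral_indic// setIT => h.
  apply: fine_cvg; rewrite fineK; first exact: h.
  by rewrite ge0_fin_numE// radon_itv_lt.
Qed.

End increments.

Section measures.
Variable R : realType.

Section empirical.
Context (T : ptopologicalType) (N : nat) (z : 'I_N -> T).
Local Open Scope ereal_scope.

Definition empirical (A : set (borel T)) : \bar R :=
  (N%:R^-1)%:E * \sum_(i < N) \d_(z i : borel T) A.

Let empirical0 : empirical set0 = 0.
Proof. by rewrite /empirical big1 ?mule0// => i _; rewrite measure0. Qed.

Let empirical_ge0 A : 0 <= empirical A.
Proof.
by rewrite /empirical mule_ge0 ?lee_fin ?invr_ge0 ?ler0n// sume_ge0.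
Qed.

Let empirical_sigma_additive : semi_sigma_additive empirical.
Proof.
move=> F mF tF mUF.
have -> : (fun n => \sum_(0 <= k < n) empirical (F k)) =
  (fun n => (N%:R^-1)%:E *
    \sum_(i < N) \sum_(0 <= k < n) \d_(z i : borel T) (F k)).
  apply/funext => n; rewrite /empirical exchange_big/= ge0_sume_distrr// => k _.
  by rewrite sume_ge0.
rewrite /empirical; apply: cvgeZl => //; apply: cvg_nnesum => i _.
  by apply: nearW => n; rewrite sume_ge0.
exact: (@measure_semi_sigma_additive _ _ _ (\d_(z i : borel T)) F mF tF mUF).
Qed.

HB.instance Definition _ := isMeasure.Build _ _ _ empirical
  empirical0 empirical_ge0 empirical_sigma_additive.

End empirical.

Lemma borel_setX (S T : ptopologicalType)
    (A : set (borel S)) (B : set (borel T)) :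
  measurable A -> measurable B ->
  measurable (A `*` B : set (borel (S * T)%type)).
Proof.
move=> mA mB.
have -> : A `*` B = (fst @^-1` A `&` snd @^-1` B) by [].
apply: measurableI.
  rewrite -[X in measurable X]setTI.
  apply: (@continuous_borel_measurable (S * T)%type S fst) => //.
  by move=> x; exact: cvg_fst.
rewrite -[X in measurable X]setTI.
apply: (@continuous_borel_measurable (S * T)%type T snd) => //.
by move=> x; exact: cvg_snd.
Qed.

Lemma measurable_I01_ge (y : R) :
  measurable ([set z : I01 R | y <= val z] : set (borel (I01 R))).
Proof.
have -> : [set z : I01 R | y <= val z] = val @^-1` `[y, +oo[%classic.
  by apply/seteqP; split => z /=; rewrite in_itv/= andbT.
rewrite -[X in measurable X]setTI.
apply: (@continuous_measurable_borel R (I01 R) val) => //.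
exact: (@initial_continuous (I01 R) R).
Qed.

Section marginals.
Variable mu : {measure set (borel (radon R * I01 R)%type) -> \bar R}.
Local Open Scope ereal_scope.

Definition Lambda (A : set (borel (radon R))) : \bar R := mu (A `*` setT).

Definition U (y : R) (A : set (borel (radon R))) : \bar R :=
  mu (A `*` [set z | (y <= val z)%R]).

Let setX_sigma_additive (B : set (borel (I01 R))) : measurable B ->
  semi_sigma_additive (fun A : set (borel (radon R)) => mu (A `*` B)).
Proof.
move=> mB F mF tF mUF; rewrite setX_bigcupl.
apply: (@measure_semi_sigma_additive _ _ _ mu (fun n => F n `*` B)).
- by move=> n; exact: borel_setX.
- apply/trivIsetP => i j _ _ ij; rewrite -setXI.
  by move/trivIsetP : tF => /(_ i j I I ij) ->; rewrite set0X.
- by rewrite -setX_bigcupl; exact: borel_setX.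
Qed.

Let Lambda0 : Lambda set0 = 0.
Proof. by rewrite /Lambda set0X measure0. Qed.

Let Lambda_ge0 A : 0 <= Lambda A. Proof. exact: measure_ge0. Qed.

Let Lambda_sigma_additive : semi_sigma_additive Lambda.
Proof. exact: setX_sigma_additive. Qed.

HB.instance Definition _ := isMeasure.Build _ _ _ Lambda
  Lambda0 Lambda_ge0 Lambda_sigma_additive.

Let U0 y : U y set0 = 0.
Proof. by rewrite /U set0X measure0. Qed.

Let U_ge0 y A : 0 <= U y A. Proof. exact: measure_ge0. Qed.

Let U_sigma_additive y : semi_sigma_additive (U y).
Proof. by apply: setX_sigma_additive; exact: measurable_I01_ge. Qed.

HB.instance Definition _ y := isMeasure.Build _ _ _ (U y)
  (U0 y) (U_ge0 y) (@U_sigma_additive y).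

End marginals.

Section increment_law.
Variables (L : {measure set (borel (radon R)) -> \bar R}) (s t : R).
Local Open Scope ereal_scope.

Definition lambda (A : set (borel R)) : \bar R :=
  \int[L]_rho \d_(incr s t rho : borel R) A.

Let borel_measurable (A : set R) :
  measurable (A : set (borel R)) -> measurable (A : set R).
Proof.
apply: smallest_sub; first exact: sigma_algebra_measurable.
by move=> B; exact: open_measurable.
Qed.

Let measurable_dirac_incr (A : set (borel R)) : measurable A ->
  measurable_fun setT (fun rho : borel (radon R) =>
    \d_(incr s t rho : borel R) A : \bar R).
Proof.
move=> mA.
have md := @measurable_fun_dirac _ R R setT A (borel_measurable mA).
exact: (measurableT_comp md (@measurable_incr R s t)).
Qed.

Let lambda0 : lambda set0 = 0.
Proof. by rewrite /lambda integral0_eq. Qed.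

Let lambda_ge0 A : 0 <= lambda A. Proof. exact: integral_ge0. Qed.

Let lambda_sigma_additive : semi_sigma_additive lambda.
Proof.
move=> F mF tF mUF.
rewrite /lambda (eq_integral (fun rho : borel (radon R) =>
    \sum_(n <oo) \d_(incr s t rho : borel R) (F n))); last first.
  move=> rho _; apply/esym/cvg_lim => //.
  exact: (@measure_semi_sigma_additive _ _ _ (\d_(incr s t rho : borel R))).
rewrite integral_nneseries//; last by move=> n; exact: measurable_dirac_incr.
by apply: is_cvg_nneseries => n _ _; exact: integral_ge0.
Qed.

HB.instance Definition _ := isMeasure.Build _ _ _ lambda
  lambda0 lambda_ge0 lambda_sigma_additive.

End increment_law.

End measures.

Section limit_functions.
Variable R : realType.
Variable mu : {measure set (borel (radon R * I01 R)%type) -> \bar R}.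

Definition yA (s t : R) : R :=
  1 - \int[Lambda mu]_rho expR (- incr (t - s) t rho).

Definition yB (y t : R) : R := 1 - \int[U mu y]_rho expR (- incr 0 t rho).

Definition yC (t : R) : R := 1 - \int[Lambda mu]_rho expR (- incr 0 t rho).

Definition t0 (y t : R) : R := inf [set s | 0 <= s <= t /\ y <= yA s t].

Definition yhat (y t : R) : R := inf [set x | 0 <= x < 1 /\ y <= yB x t].

(* yA is left-continuous and nondecreasing in its first argument, so the
   infimum t0 inverts it exactly when yA has no jump, i.e. when Lambda-almost
   no rho has an atom at any given time of (0, t].  It may be constant on some
   interval, so only a right inverse can be expected. *)
Definition t0_inverse (t : R) : Prop :=
  forall y, 0 <= y <= yC t -> yA (t0 y t) t = y.

Definition yhat_inverse (t : R) : Prop :=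
  (forall y, yC t <= y < 1 -> yB (yhat y t) t = y) /\
  (forall x, 0 <= x < 1 -> yhat (yB x t) t = x).

End limit_functions.

Section random_measures.
Context (R : realType) (d : measure_display) (Omega : measurableType d)
  (P : probability Omega R).

(* Mutual independence of sigma-algebras; each F i contains setT, so the
   product rule for proper subfamilies is included. *)
Definition independent (I : finType) (F : I -> set (set Omega)) : Prop :=
  forall E : I -> set Omega, (forall i, F i (E i)) ->
    P (\bigcap_i E i) = (\prod_i fine (P (E i)))%:E.

Definition sigma_rv d' (T : measurableType d') (X : Omega -> T) :
    set (set Omega) :=
  preimage_set_system setT X measurable.

Definition sigma_rm (nu : Omega -> {measure set R -> \bar R}) :
    set (set Omega) :=
  <<s \bigcup_(A in measurable) sigma_rv (fun w => nu w A) >>.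

Record poisson_random_measure (rho : radon R)
    (nu : Omega -> {measure set R -> \bar R}) : Prop := {
  prm_measurable : forall A, measurable A ->
    measurable_fun setT (fun w => nu w A) ;
  prm_intensity : forall A, measurable A ->
    (\int[P]_w nu w A = rho A)%E ;
  prm_poisson : forall A, measurable A -> (rho A < +oo)%E -> forall k : nat,
    P [set w | nu w A = k%:R%:E] =
    (fine (rho A) ^+ k / k`!%:R * expR (- fine (rho A)))%:E ;
  prm_independent : forall (n : nat) (A : 'I_n -> set R),
    (forall i, measurable (A i)) -> trivIset setT A ->
    independent (fun i => sigma_rv (fun w => nu w (A i)))
}.

End random_measures.

Section ranking_process.
Variable R : realType.

(* tau i j is the (j+1)-st point of the i-th measure. *)
Definition jump_times (N : nat) (nu : 'I_N -> {measure set R -> \bar R})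
    (tau : 'I_N -> nat -> R) : Prop :=
  [/\ forall i (A : set R), measurable A ->
        nu i A = (\sum_(j <oo) \d_(tau i j) A)%E,
      forall i, 0 < tau i 0%N,
      forall i j, tau i j < tau i j.+1
    & forall i i' j j', (i, j) <> (i', j') -> tau i j <> tau i' j'].

Definition ranking_path (N : nat) (x : 'I_N -> nat) (tau : 'I_N -> nat -> R)
    (X : 'I_N -> R -> nat) : Prop :=
  forall i,
    (forall t, 0 <= t < tau i 0%N ->
       X i t = (x i + \sum_(k < N | x i < x k) (tau k 0%N <= t)%R)%N) /\
    (forall j t, tau i j <= t < tau i j.+1 ->
       X i t =
         (1 + \sum_(k < N) `[< exists j', (tau i j < tau k j' <= t)%R >])%N).

(* Positions range over 1..N, so the default value of insubd is never used. *)
Definition scaled (N k : nat) : I01 R :=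
  insubd (I01_0 R) ((k%:R - 1) / N%:R).

Definition configuration (N : nat) (rho : 'I_N -> radon R) (k : 'I_N -> nat) :
    {measure set (borel (radon R * I01 R)%type) -> \bar R} :=
  empirical R (fun i => (rho i, scaled N (k i)) : (radon R * I01 R)%type).

End ranking_process.

(* Main.v *)
Require Import Defs.
From HB Require Import structures.
From mathcomp Require Import all_boot all_order all_algebra all_fingroup.
From mathcomp Require Import all_classical all_reals all_analysis.
From mathcomp Require Import measurable_realfun ring lra.

Set Implicit Arguments.
Unset Strict Implicit.
Unset Printing Implicit Defensive.

Import Order.TTheory GRing.Theory Num.Theory.
Import numFieldNormedType.Exports.

Local Open Scope classical_set_scope.
Local Open Scope ring_scope.

(* At time [t] the particles are ordered by the ranking itself: those that have
   not jumped since [s], and, within the particles that have never jumped,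
   those that started at or behind a given position, form a tail set of the
   ranking.  The relative size of a tail set therefore determines its position:
   if it tends to [1 - y], the set is asymptotically the set of particles with
   scaled position at least [y].  Tail sets are counted by sums of independent
   Bernoulli variables, so a strong law (exponential moments and
   Borel-Cantelli) reduces their empirical measures to deterministic averages
   of [exp (- rho_i(]s, t]))], which converge by the two weak convergence
   assumptions.  A single null set suffices because the topology of
   M(R_+) x [0, 1) is generated by countably many functions, so that weak
   convergence can be tested on a countable class of continuous functions. *)

(** * Integrals of bounded functions *)

(** The delicate point is the limit of averages of exp(- rho_i(]s, t])) weighted by a function of
    the initial data. The increment [incr s t] is not vaguely continuous, so the convergence of the
    initial configurations does not pass to it; the second assumption gives its limit, but only in
    law and apart from the position. A squeeze combines the two. Continuous functions vanishing
    outside ]s, t[ bound the increment from below, hence the weighted averages from above in the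
    limit, for a weight [h] as well as for [C - h]. The two averages add up to the unweighted one,
    whose limit is known, so both upper bounds are attained. They are sharp because the limit puts
    no mass at time [t], which is extracted from the invertibility of [yA]. The other difficulty is
    that the formulas for [U] prescribe a tail for each level [y] separately. One auxiliary uniform
    variable realises these tails as nested events of a single probability space; the position is
    the supremum of the levels attained, and its joint law with the measure is the limit. *)

Section bounded_integrands.
Context d (T : measurableType d) (R : realType).
Variable m : {measure set T -> \bar R}.
Hypothesis m_fin : (m setT < +oo)%E.

Lemma integrable_bounded (f : T -> R) (C : R) : measurable_fun setT f ->
  (forall x, `|f x| <= C) -> m.-integrable setT (EFin \o f).
Proof.
move=> mf fC; apply: (@le_integrable _ _ _ m setT _ _ (EFin \o cst C)) => //.
- exact/measurable_EFinP.
- by move=> x _ /=; rewrite lee_fin (le_trans (fC x))// ler_norm.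
- apply/integrableP; split; first exact/measurable_EFinP/measurable_cst.
  under eq_integral do rewrite /=.
  by rewrite integral_cst// lte_mul_pinfty.
Qed.

Lemma Rintegral_bounded_cvg (f_ : nat -> T -> R) (f : T -> R) (C : R) :
  (forall n, measurable_fun setT (f_ n)) -> measurable_fun setT f ->
  (forall n x, `|f_ n x| <= C) ->
  {ae m, forall x, f_ n x @[n --> \oo] --> f x} ->
  \int[m]_x f_ n x @[n --> \oo] --> \int[m]_x f x.
Proof.
move=> mf_ mf fC ff; rewrite /Rintegral.
have [] := @dominated_convergence _ _ _ m setT measurableT
  (fun n x => (f_ n x)%:E) (EFin \o f) (EFin \o cst C).
- by move=> n; apply/measurable_EFinP.
- exact/measurable_EFinP.
- by apply: filterS ff => x h _; apply/cvg_EFin => //; exact: nearW.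
- by apply: (@integrable_bounded _ `|C|) => //; exact: measurable_cst.
- by apply: nearW => x n _; rewrite lee_fin.
- move=> iF _ h; apply: fine_cvg; rewrite fineK; first exact: h.
  exact: integrable_fin_num iF.
Qed.

Lemma Rintegral_le_bounded (f g : T -> R) (C D : R) :
  measurable_fun setT f -> measurable_fun setT g ->
  (forall x, `|f x| <= C) -> (forall x, `|g x| <= D) ->
  (forall x, f x <= g x) -> \int[m]_x f x <= \int[m]_x g x.
Proof.
move=> mf mg fC gD fg; apply: le_Rintegral => //.
  exact: integrable_bounded fC.
exact: integrable_bounded gD.
Qed.

End bounded_integrands.

(** * Integrals against empirical measures *)

Section empirical_integral.
Context (R : realType) (T : ptopologicalType) (N : nat) (z : 'I_N -> T).

Lemma empirical_setT_lty : (empirical R z setT < +oo)%E.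
Proof.
rewrite /empirical/= lte_mul_pinfty// lte_sum_pinfty// => i _.
by rewrite diracT ltry.
Qed.

Lemma integral_empirical (f : T -> R) :
  measurable_fun setT (f : borel T -> R) -> (forall x, 0 <= f x) ->
  (\int[empirical R z]_x (f x)%:E = (N%:R^-1 * \sum_(i < N) f (z i))%:E)%E.
Proof.
move=> mf f0.
(* [msum] takes a sequence of measures indexed by [nat]; the zero measure from [N] on is never
   reached by the sum. *)
pose m_ (i : nat) : {measure set (borel T) -> \bar R} :=
  if insub i is Some j then \d_(z (j : 'I_N) : borel T) else mzero.
have m_E (i : 'I_N) : m_ i = \d_(z i : borel T).
  rewrite /m_; case: insubP => [j _ ij|]; last by rewrite ltn_ord.
  by rewrite (val_inj ij : j = i).
have Ni0 : 0 <= N%:R^-1 :> R by rewrite invr_ge0.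
pose m2 := mscale (NngNum Ni0) (msum m_ N).
rewrite (eq_measure_integral m2); last first.
  move=> A mA _; rewrite /m2 /empirical /mscale /msum/=; congr (_ * _)%E.
  by apply: eq_bigr => i _; rewrite m_E.
have mEf : measurable_fun setT (EFin \o f : borel T -> \bar R).
  exact/measurable_EFinP.
rewrite ge0_integral_mscale//; last by move=> x _; rewrite lee_fin.
rewrite ge0_integral_measure_sum//; last by move=> x _; rewrite lee_fin.
rewrite EFinM -sumEFin; congr (_ * _)%E; apply: eq_bigr => i _.
by rewrite m_E integral_dirac// diracT mul1e.
Qed.

Lemma Rintegral_empirical (f : T -> R) (C : R) :
  measurable_fun setT (f : borel T -> R) -> (forall x, `|f x| <= C) ->
  \int[empirical R z]_x f x = N%:R^-1 * \sum_(i < N) f (z i).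
Proof.
move=> mf fC.
have mfin := empirical_setT_lty.
have icst : (empirical R z).-integrable setT (EFin \o cst C).
  by apply: (@integrable_bounded _ _ _ _ mfin _ `|C|) => //; exact: measurable_cst.
have intf := @integrable_bounded _ _ _ _ mfin _ _ mf fC.
(* The nonnegative case is applied to [f + C] and to the constant [C], and the results are
   subtracted. *)
have h : \int[empirical R z]_x (f x + C) =
    N%:R^-1 * \sum_(i < N) (f (z i) + C).
  rewrite /Rintegral (@integral_empirical (fun x => f x + C))//.
    by apply: measurable_funD => //; exact: measurable_cst.
  by move=> x; move: (fC x); rewrite ler_norml => /andP[+ _]; rewrite -lerBlDr sub0r.
have hC : \int[empirical R z]_x C = N%:R^-1 * \sum_(i < N) C.
  rewrite /Rintegral (@integral_empirical (cst C))//.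
  by move=> x /=; apply: le_trans (fC x).
have -> : \int[empirical R z]_x f x = \int[empirical R z]_x (f x + C) - \int[empirical R z]_x C.
  by rewrite RintegralD// addrK.
by rewrite h hC -mulrBr -sumrB; congr (_ * _); apply: eq_bigr => i _; rewrite addrK.
Qed.

End empirical_integral.

(** * A countable criterion for weak convergence *)

Lemma cvg_seq_near (R : realType) (u : nat -> R) (l e : R) :
  u n @[n --> \oo] --> l -> 0 < e -> \forall n \near \oo, `|l - u n| < e.
Proof. by move=> /cvgrPdist_lt h e0; exact: h. Qed.

Lemma dist_lt_two_sided (R : realFieldType) (a b c d e : R) :
  a + c - e / 2 < b + d -> c - a - e / 2 < d - b -> `|c - d| < e / 2 ->
  `|a - b| < e.
Proof.
by rewrite !ltr_norml => ? ? /andP[? ?]; apply/andP; split; lra.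
Qed.

Section lattice_approximation.
Context (R : realType) (T : Type) (I : countType) (b : I -> T -> R).

(** Finite maxima form the test class because a nonnegative function is an increasing limit of them;
    the base value 0 keeps them nonnegative. *)
Definition max_of (l : seq I) (x : T) : R := \big[Num.max/0]_(c <- l) b c x.

Lemma max_of_cons c l x : max_of (c :: l) x = Num.max (b c x) (max_of l x).
Proof. by rewrite /max_of big_cons. Qed.

Lemma max_of_ge0 l x : 0 <= max_of l x.
Proof.
by elim: l => [|c l ih]; rewrite ?max_of_cons ?le_max ?ih ?orbT// /max_of big_nil.
Qed.

Lemma max_of_ge l c x : c \in l -> b c x <= max_of l x.
Proof.
elim: l => // a l ih; rewrite inE max_of_cons le_max => /orP[/eqP->|/ih ->].
  by rewrite lexx.
by rewrite orbT.
Qed.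

Lemma max_of_le l x (y : R) : 0 <= y -> (forall c, c \in l -> b c x <= y) ->
  max_of l x <= y.
Proof.
move=> y0; elim: l => [|a l ih] h; first by rewrite /max_of big_nil.
rewrite max_of_cons ge_max h ?inE ?eqxx//= ih// => c cl.
by rewrite h// inE cl orbT.
Qed.

(** Cutting the enumeration at the code [n] gives finite lists that grow to the set of all members
    of the family below [f]. *)
Definition minorants (f : T -> R) (n : nat) : seq I :=
  [seq c <- pmap unpickle (iota 0 n) | `[< forall x, b c x <= f x >]].

Lemma mem_minorants f n c :
  (c \in minorants f n) -> forall x, b c x <= f x.
Proof. by rewrite mem_filter => /andP[/asboolP]. Qed.

Lemma minorants_mem f n c : (forall x, b c x <= f x) -> (pickle c < n)%N ->
  c \in minorants f n.
Proof.
move=> h cn; rewrite mem_filter; apply/andP; split; first exact/asboolP.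
rewrite mem_pmap; apply/mapP; exists (pickle c); last by rewrite pickleK.
by rewrite mem_iota.
Qed.

Lemma max_of_minorants_le f n x : (forall x, 0 <= f x) ->
  max_of (minorants f n) x <= f x.
Proof. by move=> f0; apply: max_of_le => // c /mem_minorants. Qed.

(** Each value of [f] is a supremum of values of members of the family that lie below [f]
    everywhere; no uniformity in [x] is asked for. *)
Definition minorant_dense (f : T -> R) := forall x (e : R), 0 < e ->
  exists c, (forall y, b c y <= f y) /\ f x - e < b c x.

Lemma max_of_minorants_cvg f x : (forall x, 0 <= f x) -> minorant_dense f ->
  max_of (minorants f n) x @[n --> \oo] --> f x.
Proof.
move=> f0 fd; apply/cvgrPdist_lt => e e0.
have [c [cf fc]] := fd x e e0.
near=> n.
rewrite ger0_norm ?subr_ge0 ?max_of_minorants_le// ltrBlDr -ltrBlDl.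
apply: (lt_le_trans fc); apply: max_of_ge; apply: minorants_mem => //.
by near: n; exact: nbhs_infty_gt.
Unshelve. all: by end_near. Qed.

End lattice_approximation.

Lemma max_of_continuous (R : realType) (T : topologicalType) (I : countType)
    (b : I -> T -> R) l :
  (forall c, continuous (b c)) -> continuous (max_of b l).
Proof.
move=> bc; elim: l => [|c l ih] x.
  have -> : max_of b [::] = cst 0 by apply/funext => y; rewrite /max_of big_nil.
  exact: cst_continuous.
have -> : max_of b (c :: l) = (fun y => Num.max (b c y) (max_of b l y)).
  by apply/funext => y; rewrite max_of_cons.
by apply: (@continuous_max _ _ _ _ x); [exact: bc|exact: ih].
Qed.

Section weak_convergence_criterion.
Context (R : realType) (T : ptopologicalType) (I : countType) (b : I -> T -> R).
Hypothesis b_continuous : forall c, continuous (b c).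
Hypothesis b_dense : forall f : T -> R, continuous f -> (forall x, 0 <= f x) ->
  minorant_dense b f.
Variables (m_ : nat -> {measure set (borel T) -> \bar R})
  (m : {measure set (borel T) -> \bar R}).
Hypothesis m_fin : (m setT < +oo)%E.
Hypothesis m__fin : forall n, (m_ n setT < +oo)%E.
Hypothesis m_cvg1 : \int[m_ n]_x 1 @[n --> \oo] --> \int[m]_x (1 : R).
Hypothesis m_cvg : forall l,
  \int[m_ n]_x max_of b l x @[n --> \oo] --> \int[m]_x max_of b l x.

Let mb l : measurable_fun setT (max_of b l : borel T -> R).
Proof. by apply: (@continuous_measurable_borel R T); exact: max_of_continuous. Qed.

(** Dominated convergence under the limit [m] provides one maximum of minorants whose integral is
    nearly that of [f]; being below [f], it bounds the integrals under every [m_ n] from below. *)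
Let lower (f : T -> R) (C : R) : continuous f -> (forall x, 0 <= f x) ->
  (forall x, f x <= C) ->
  forall e, 0 < e -> \forall n \near \oo, \int[m]_x f x - e < \int[m_ n]_x f x.
Proof.
move=> cf f0 fC e e0.
have mf : measurable_fun setT (f : borel T -> R).
  exact: continuous_measurable_borel.
have nf x : `|f x| <= C by rewrite ger0_norm.
have nh k x : `|max_of b (minorants b f k) x| <= C.
  by rewrite ger0_norm ?max_of_ge0// (le_trans (max_of_minorants_le _ _ _ f0)).
have h : \int[m]_x max_of b (minorants b f k) x @[k --> \oo] --> \int[m]_x f x.
  apply: (Rintegral_bounded_cvg m_fin (C := C)) => //.
  by apply: aeW => x; apply: max_of_minorants_cvg => //; exact: b_dense.
have e20 : 0 < e / 2 by rewrite divr_gt0.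
have [k _ hk] := cvg_seq_near h e20.
have {hk} := hk k (leqnn k); rewrite ltr_norml => /andP[_ hk].
have := cvg_seq_near (@m_cvg (minorants b f k)) e20.
apply: filterS => n; rewrite ltr_norml => /andP[_ hn].
apply: (@lt_le_trans _ _ (\int[m_ n]_x max_of b (minorants b f k) x)).
  by rewrite /= in hk hn *; lra.
apply: (Rintegral_le_bounded (m__fin n) _ _ (nh k) nf) => // x.
exact: max_of_minorants_le.
Qed.

(** The one-sided bound is applied to [f + C] and [C - f]; convergence of the total masses turns the
    second into an upper bound for [f]. *)
Lemma weak_cvg_max_of : weak_cvg m_ m.
Proof.
move=> f cf [M [_ hM]].
(* [bounded_fun] provides bounds strictly above [M] only; the absolute value also makes [C]
   positive. *)
pose C := `|M| + 1.
have fC x : `|f x| <= C.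
  by apply: hM => //; rewrite /C (le_lt_trans (ler_norm _))// ltrDl.
have mf : measurable_fun setT (f : borel T -> R).
  exact: continuous_measurable_borel.
have m1 (mm : {measure set (borel T) -> \bar R}) : (mm setT < +oo)%E ->
    [/\ \int[mm]_x (f x + C) = \int[mm]_x f x + C * \int[mm]_x 1 &
        \int[mm]_x (C - f x) = C * \int[mm]_x 1 - \int[mm]_x f x ].
  move=> mmfin.
  have i1 : mm.-integrable setT (EFin \o cst (1 : R)).
    apply: (@integrable_bounded _ _ _ _ mmfin _ 1) => //.
    by move=> x; rewrite normr1.
  have iC : mm.-integrable setT (EFin \o cst C).
    apply: (@integrable_bounded _ _ _ _ mmfin _ `|C|) => //.
  have if_ := @integrable_bounded _ _ _ _ mmfin _ _ mf fC.
  have -> : C * \int[mm]_x 1 = \int[mm]_x (cst C x).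
    by rewrite -RintegralZl//; apply: eq_Rintegral => x _; rewrite mulr1.
  by split; [rewrite -RintegralD|rewrite -RintegralB].
have m1m := m1 _ m_fin; have {}m1 n := m1 _ (m__fin n).
apply/cvgrPdist_lt => e e0.
have e20 : 0 < e / 2 by rewrite divr_gt0.
have C0 : 0 < C by rewrite /C ltr_wpDl.
have cC : continuous (cst C : T -> R) by exact: cst_continuous.
have bnd x : - C <= f x <= C by rewrite -ler_norml.
have h1 := @lower (fun x => f x + C) (C + C)
   (fun x => cvgD (cf x) (cC x)) _ _ _ e20.
have h2 := @lower (fun x => C - f x) (C + C)
   (fun x => cvgB (cC x) (cf x)) _ _ _ e20.
have e3 : 0 < e / 2 / C by rewrite divr_gt0.
have h3 := cvg_seq_near m_cvg1 e3.
near=> n.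
have a1 : \int[m]_x (f x + C) - e / 2 < \int[m_ n]_x (f x + C).
  by near: n; apply: h1 => x; move: (bnd x) => /andP[]; lra.
have a2 : \int[m]_x (C - f x) - e / 2 < \int[m_ n]_x (C - f x).
  by near: n; apply: h2 => x; move: (bnd x) => /andP[]; lra.
have a3 : `|\int[m]_x 1 - \int[m_ n]_x (1 : R)| < e / 2 / C.
  by near: n; exact: h3.
have {}a3 : `|C * \int[m]_x 1 - C * \int[m_ n]_x (1 : R)| < e / 2.
  by rewrite -mulrBr normrM (gtr0_norm C0) mulrC -ltr_pdivlMr.
move: a1 a2 a3; rewrite (m1m).1 (m1m).2 (m1 n).1 (m1 n).2.
exact: dist_lt_two_sided.
Unshelve. all: by end_near. Qed.

End weak_convergence_criterion.

(** * The vague topology is generated by countably many evaluations *)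

Section hats.
Context (R : realType) (T : topologicalType) (e : nat -> T -> R).

(** A code [(c, M, n, q)] stands for a cone of height [c] and slope [M + 1] over the l1 distance to
    the rational point [q] in the coordinates 0 to [n]. All parameters are rational or integer, so
    there are countably many. *)
Definition hat_index : Type := (rat * nat * nat * seq rat)%type.

HB.instance Definition _ := Countable.on hat_index.

Definition hat_dist (n : nat) (q : seq rat) (x : T) : R :=
  \sum_(j < n.+1) `|e j x - ratr q`_j|.

Definition hat (i : hat_index) (x : T) : R :=
  let: (c, M, n, q) := i in Num.max 0 (ratr c - M.+1%:R * hat_dist n q x).

Lemma hat_le i x : hat i x <= `|ratr i.1.1.1|.
Proof.
case: i => [[[c M] n] q]; rewrite /hat ge_max normr_ge0/=.
by rewrite (le_trans _ (ler_norm _))// gerBl mulr_ge0// sumr_ge0.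
Qed.

Lemma hat_dist_ge n q x j : (j < n.+1)%N ->
  `|e j x - ratr q`_j| <= hat_dist n q x.
Proof.
by move=> jn; rewrite /hat_dist (bigD1 (Ordinal jn))//= lerDl sumr_ge0.
Qed.

Hypothesis e_continuous : forall j, continuous (e j).

Lemma hat_continuous i : continuous (hat i).
Proof.
case: i => [[[c M] n] q] x; rewrite /hat.
apply: (@continuous_max _ _ (cst 0) _ x); first exact: cst_continuous.
apply: cvgB; first exact: cvg_cst.
apply: cvgM; first exact: cvg_cst.
suff h k : {for x, continuous
    (fun y => \sum_(j < k) `|e j y - ratr q`_j|)} by exact: h.
elim: k => [|k ih].
  rewrite (_ : (fun _ => _) = cst 0); first exact: cst_continuous.
  by apply/funext => y; rewrite big_ord0.
rewrite (_ : (fun _ => _) = (fun y =>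
    (\sum_(j < k) `|e j y - ratr q`_j|) + `|e k y - ratr q`_k|)).
  apply: cvgD; first exact: ih.
  by apply: cvg_norm; apply: cvgB; [exact: e_continuous|exact: cvg_cst].
by apply/funext => y; rewrite big_ord_recr.
Qed.

Hypothesis e_nbhs : forall x A, nbhs x A -> exists n (d : R), 0 < d /\
  forall y, (forall j, (j < n.+1)%N -> `|e j y - e j x| < d) -> A y.

(** Around [x] there is a neighbourhood where [f] exceeds [f x - eps / 3]. A hat of smaller height,
    steep enough to vanish outside it, lies below [f]; a rational centre close to [x] costs little
    at [x]. *)
Lemma hat_dense (f : T -> R) : continuous f -> (forall x, 0 <= f x) ->
  minorant_dense hat f.
Proof.
move=> cf f0 x eps eps0.
have e3 : 0 < eps / 3 by rewrite divr_gt0.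
have /e_nbhs [n [d [d0 hd]]] : nbhs x [set y | f x - eps / 3 < f y].
  have /cvgrPdist_lt /(_ _ e3) := cf x.
  by apply: filterS => y /=; rewrite ltr_norml => /andP[_]; lra.
have /rat_in_itvoo [c] : f x - 2 * (eps / 3) < f x - eps / 3 by lra.
rewrite in_itv/= => /andP[c1 c2].
(* Slope for which the hat is zero at distance [d / 2] or more from its centre. *)
pose M := Num.truncn (`|ratr c| / (d / 2) : R).
have hM : ratr c <= M.+1%:R * (d / 2).
  rewrite (le_trans (ler_norm _))// -ler_pdivrMr ?divr_gt0// ltW//.
  by rewrite truncnS_gt.
(* The first bound keeps the points within [d / 2] of the centre inside the [d]-neighbourhood of
   [x]; the second limits the drop of the hat at [x], over [n + 1] coordinates, to [eps / 3]. *)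
pose r := Num.min (d / 2) (eps / 3 / M.+1%:R / n.+1%:R).
have r0 : 0 < r by rewrite lt_min !divr_gt0.
have [q hq] : exists q : seq rat, forall j, (j < n.+1)%N ->
    `|e j x - ratr q`_j| < r.
  have /choice [g hg] j : exists a : rat, `|e j x - ratr a| < r.
    have /rat_in_itvoo [a] : e j x - r < e j x + r by lra.
    by rewrite in_itv/= => ?; exists a; rewrite ltr_norml; lra.
  by exists (mkseq g n.+1) => j jn; rewrite nth_mkseq.
have hr : M.+1%:R * (r * n.+1%:R) <= eps / 3.
  by rewrite mulrC -ler_pdivlMr// -ler_pdivlMr// ge_min lexx orbT.
exists (c, M, n, q); split => [y|].
  rewrite /hat ge_max f0/=.
  have [h|h] := ltP (hat_dist n q y) (d / 2).
    have : f x - eps / 3 < f y.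
      apply: hd => j jn.
      rewrite (@le_lt_trans _ _ (`|e j y - ratr q`_j| + `|e j x - ratr q`_j|))//.
        by rewrite (distrC (e j x)) (le_trans _ (ler_normD _ _))// addrA subrK.
      have : `|e j y - ratr q`_j| < d / 2.
        by apply: le_lt_trans h; exact: hat_dist_ge.
      have := hq j jn; rewrite /r lt_min => /andP[]; lra.
    have : 0 <= M.+1%:R * hat_dist n q y.
      by rewrite mulr_ge0// sumr_ge0.
    lra.
  rewrite (le_trans _ (f0 y))// subr_le0 (le_trans hM)// ler_pM2l//.
rewrite /hat lt_max; apply/orP; right.
have : hat_dist n q x <= r * n.+1%:R.
  rewrite mulr_natr -[X in _ *+ X]card_ord -sumr_const.
  by apply: ler_sum => j _; exact/ltW/hq.
rewrite -(ler_pM2l (ltr0Sn R M)); lra.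
Qed.

End hats.

Section radon_topology.
Context (R : realType).
Implicit Types (rho : radon R) (f : R -> R).

Definition compactly_supported f := exists n : nat, forall x, f x != 0 -> `|x| <= n%:R.

Lemma test_fun_supported (f : test_fun R) : compactly_supported (sval f).
Proof.
case: f => f [cf /= kf].
have [M [_ hM]] := compact_bounded kf.
exists (Num.truncn (`|M| + 1)).+1 => x fx.
apply: le_trans (ltW (truncnS_gt _)).
apply: hM; first by rewrite (le_lt_trans (ler_norm _))// ltrDl.
by apply: subset_closure => /=; exact/eqP.
Qed.

Lemma supported_compact f : compactly_supported f ->
  compact (closure (f @^-1` [set~ 0])).
Proof.
move=> [n hn]; apply: (subclosed_compact _ (@segment_compact R (- n%:R) n%:R)).
  exact: closed_closure.
rewrite (closure_id (`[- n%:R, n%:R]%classic : set R)).1; last exact: interval_closed.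
by apply: closureS => x /= /eqP /hn; rewrite in_itv/= ler_norml.
Qed.

Lemma supported_bounded f : continuous f -> compactly_supported f ->
  exists C, forall x, `|f x| <= C.
Proof.
move=> cf [n hn].
have : compact (f @` `[- n%:R, n%:R]).
  by apply: continuous_compact; [exact: continuous_subspaceT|exact: segment_compact].
move=> /compact_bounded [M [_ hM]].
exists (`|M| + 1) => x.
have [->|fx] := eqVneq (f x) 0; first by rewrite normr0 addr_ge0.
apply: hM; first by rewrite (le_lt_trans (ler_norm _))// ltrDl.
by exists x => //=; rewrite in_itv/= -ler_norml; exact: hn.
Qed.

Lemma supported_integrable rho f : continuous f -> compactly_supported f ->
  (radon_measure rho).-integrable setT (EFin \o f).
Proof.
move=> cf sf; have [C hC] := supported_bounded cf sf; have [n hn] := sf.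
apply: (@le_integrable _ _ _ (radon_measure rho) setT _ _
  (fun x => (C * \1_(`[- n%:R, n%:R]%classic : set R) x)%:E)) => //.
- by apply/measurable_EFinP; exact: continuous_measurable_fun.
- move=> x _ /=; rewrite lee_fin.
  rewrite indicE mem_setE in_itv/= -ler_norml.
  case: (leP `|x| n%:R) => xn.
    by rewrite mulr1 (le_trans (hC x))// ler_norm.
  rewrite mulr0 normr0; have [->|/hn] := eqVneq (f x) 0; first by rewrite normr0.
  by rewrite leNgt xn.
- apply: (@integrableZl _ _ _ (radon_measure rho) setT measurableT C
    (EFin \o (\1_(`[- n%:R, n%:R]%classic : set R) : R -> R))).
  apply/integrableP; split; first exact/measurable_EFinP/measurable_indic.
  under eq_integral do rewrite /= ger0_norm//.
  by rewrite integral_indic// setIT; exact/radon_compact/segment_compact.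
Qed.

Let id_nbhs (x : R) A : nbhs x A -> exists n (d : R), 0 < d /\
  forall y, (forall j, (j < n.+1)%N -> `|y - x| < d) -> A y.
Proof.
move=> /nbhs_ballP[d d0 dA]; exists 0%N, d; split => // y /(_ 0%N isT) h.
by apply: dA; rewrite /ball/= distrC.
Qed.

(** The hats of the real line: with every coordinate equal to the identity, the general construction
    applies. *)
Let tent : hat_index -> R -> R := hat (fun=> id).

Let tent_supported c : compactly_supported (tent c).
Proof.
case: c => [[[c M] n] q].
exists (Num.truncn (`|ratr c| + `|ratr q`_0| : R)).+1 => x.
apply: contraR; rewrite -ltNge => hx.
have {}hx := lt_trans (truncnS_gt _) hx.
apply/eqP/max_idPl; rewrite subr_le0.
apply: (@le_trans _ _ (hat_dist (fun=> id) n q x)); last first.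
  by rewrite ler_peMl ?ler1n// sumr_ge0.
apply: le_trans (@hat_dist_ge _ _ (fun=> id) n q x 0%N isT).
rewrite (le_trans (ler_norm _))// (le_trans _ (lerB_normD _ _))//.
by rewrite normrN lerBrDr ltW.
Qed.

Let tents := max_of tent.

Let tents_supported l : compactly_supported (tents l).
Proof.
elim: l => [|c l [n hn]].
  by exists 0%N => x; rewrite /tents /max_of big_nil eqxx.
have [m hm] := tent_supported c.
exists (maxn m n) => x; rewrite /tents max_of_cons.
have [->|/hm h _] := eqVneq (tent c x) 0.
  have [->|/hn h _] := eqVneq (max_of tent l x) 0; first by rewrite maxxx eqxx.
  by rewrite (le_trans h)// ler_nat leq_maxr.
by rewrite (le_trans h)// ler_nat leq_maxl.
Qed.

Let tents_continuous l : continuous (tents l).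
Proof.
by apply: max_of_continuous => c; apply: hat_continuous => _ x; exact: cvg_id.
Qed.

Let tents_test l : test_fun R :=
  exist _ (tents l) (conj (@tents_continuous l) (supported_compact (tents_supported l))).

(** The tents are enumerated through their codes; a number that codes no list gets the empty list,
    hence the zero function. *)
Definition radon_coord (n : nat) rho : R :=
  radon_eval (tents_test (odflt [::] (unpickle n))) rho.

Lemma radon_coord_continuous n : continuous (radon_coord n).
Proof. exact: radon_eval_continuous. Qed.

Let radon_coordE l rho : radon_coord (pickle l) rho = \int[rho]_x tents l x.
Proof. by rewrite /radon_coord pickleK. Qed.

(** A single maximum of tents below [f] nearly exhausts the integral of [f] under [rho]. It stays
    below [f] under any [rho'], so controlling this one coordinate is enough. *)
Let radon_lower rho f : continuous f -> compactly_supported f ->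
  (forall x, 0 <= f x) -> forall e, 0 < e -> exists k d, 0 < d /\
    forall rho', `|radon_coord k rho' - radon_coord k rho| < d ->
      \int[rho]_x f x - e < \int[rho']_x f x.
Proof.
move=> cf sf f0 e e0.
have cvgf : \int[rho]_x tents (minorants tent f k) x @[k --> \oo] -->
    \int[rho]_x f x.
  rewrite /Rintegral.
  have [] := @dominated_convergence _ _ _ (radon_measure rho) setT measurableT
    (fun n x => (tents (minorants tent f n) x)%:E) (EFin \o f) (EFin \o f).
  - by move=> n; apply/measurable_EFinP; exact: continuous_measurable_fun.
  - by apply/measurable_EFinP; exact: continuous_measurable_fun.
  - apply: aeW => x _; apply/cvg_EFin; first exact: nearW.
    apply: max_of_minorants_cvg => //; apply: hat_dense => //.
  - exact: (supported_integrable rho cf sf).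
  - apply: aeW => x n _; rewrite lee_fin ger0_norm ?max_of_ge0//.
    exact: max_of_minorants_le.
  - move=> iF _ h; apply: fine_cvg; rewrite fineK; first exact: h.
    exact: integrable_fin_num iF.
have e20 : 0 < e / 2 by rewrite divr_gt0.
have [k _ hk] := cvg_seq_near cvgf e20.
have {hk} := hk k (leqnn k); rewrite ltr_norml => /andP[_ hk].
exists (pickle (minorants tent f k)), (e / 2); split => // rho'.
rewrite !radon_coordE ltr_norml => /andP[h _].
apply: (@lt_le_trans _ _ (\int[rho']_x tents (minorants tent f k) x)).
  by rewrite /= in hk h *; lra.
apply: le_Rintegral => //; last by move=> x _; exact: max_of_minorants_le.
  exact: (supported_integrable rho' (@tents_continuous _) (tents_supported _)).
exact: (supported_integrable rho' cf sf).
Qed.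

Definition radon_basic rho : set_system (radon R) :=
  [set A | exists n d, 0 < d /\ forall rho', (forall j, (j < n.+1)%N ->
     `|radon_coord j rho' - radon_coord j rho| < d) -> A rho'].

Let radon_basic_filter rho : Filter (radon_basic rho).
Proof.
split.
- by exists 0%N, 1; split.
- move=> A B [n [d [d0 hA]]] [m [d' [d'0 hB]]].
  exists (maxn n m), (Num.min d d'); split; first by rewrite lt_min d0.
  move=> rho' h; split; [apply: hA|apply: hB] => j jn.
    have := h j; rewrite ltnS (leq_trans (_ : j <= n)%N) ?leq_maxl//.
    by move=> /(_ isT); rewrite lt_min => /andP[].
  have := h j; rewrite ltnS (leq_trans (_ : j <= m)%N) ?leq_maxr//.
  by move=> /(_ isT); rewrite lt_min => /andP[].
- move=> A B AB [n [d [d0 hA]]]; exists n, d; split => // rho' h.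
  by apply: AB; exact: hA.
Qed.

Let radon_basic_coord rho k d : 0 < d -> radon_basic rho
  [set rho' | `|radon_coord k rho' - radon_coord k rho| < d].
Proof. by move=> d0; exists k, d; split => // rho' /(_ k (ltnSn k)). Qed.

(* Increasing approximation by maxima of the countable family only bounds the
   integral of a nonnegative function from below.  Used for [C h + f] and
   [C h - f], which are nonnegative, it controls that of [f] on both sides. *)
Let radon_basic_eval rho (f : test_fun R) e : 0 < e ->
  radon_basic rho [set rho' | `|radon_eval f rho - radon_eval f rho'| < e].
Proof.
move=> e0; have sf := test_fun_supported f.
have cf : continuous (sval f) := (svalP f).1.
have [C hC] := supported_bounded cf sf; have [n hn] := sf.
have C0 : 0 <= C by rewrite (le_trans _ (hC 0)).
(* A tent of height [n + 1] and slope 1, centred at 0, the default entry of the empty list. It is at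
   least 1 on [-n, n], so [C] times it dominates the absolute value of [f]. *)
pose l := [:: ((n.+1%:R, 0%N, 0%N, [::]) : hat_index)].
have l1 x : `|x| <= n%:R -> 1 <= tents l x.
  move=> xn; rewrite /tents max_of_cons le_max /= le_max; apply/orP; left; apply/orP; right.
  rewrite ratr_nat mul1r /hat_dist big_ord_recl big_ord0 addr0/= rmorph0 subr0.
  by rewrite -natr1; lra.
have fl x : `|sval f x| <= C * tents l x.
  have [->|/hn/l1 h] := eqVneq (sval f x) 0.
    by rewrite normr0 mulr_ge0// max_of_ge0.
  by rewrite (le_trans (hC x))// ler_peMr.
have fl1 x : 0 <= C * tents l x + sval f x.
  by move: (fl x); rewrite ler_norml => /andP[]; lra.
have fl2 x : 0 <= C * tents l x - sval f x.
  by move: (fl x); rewrite ler_norml => /andP[]; lra.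
have cl : continuous (fun x => C * tents l x).
  by move=> x; apply: cvgM; [exact: cvg_cst|exact: tents_continuous].
have sl (s : R) : compactly_supported (fun x => C * tents l x + s * sval f x).
  have [m hm] := tents_supported l.
  exists (maxn m n) => x.
  have [->|/hm h _] := eqVneq (tents l x) 0.
    have [->|/hn h _] := eqVneq (sval f x) 0; first by rewrite !mulr0 addr0 eqxx.
    by rewrite (le_trans h)// ler_nat leq_maxr.
  by rewrite (le_trans h)// ler_nat leq_maxl.
have il rho' := @supported_integrable rho' _ (@tents_continuous l) (tents_supported l).
have if_ rho' := @supported_integrable rho' _ cf sf.
have ilC rho' : (radon_measure rho').-integrable setT (EFin \o (fun x => C * tents l x)).
  exact: (@integrableZl _ _ _ (radon_measure rho') setT measurableT C _ (il rho')).
have i1 rho' : \int[rho']_x (C * tents l x + sval f x) =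
    C * radon_coord (pickle l) rho' + radon_eval f rho'.
  by rewrite RintegralD// RintegralZl// radon_coordE.
have i2 rho' : \int[rho']_x (C * tents l x - sval f x) =
    C * radon_coord (pickle l) rho' - radon_eval f rho'.
  by rewrite RintegralB// RintegralZl// radon_coordE.
have sl1 : compactly_supported (fun x => C * tents l x + sval f x).
  by have := sl 1; under eq_fun do rewrite mul1r.
have sl2 : compactly_supported (fun x => C * tents l x - sval f x).
  by have := sl (- 1); under eq_fun do rewrite mulN1r.
have e20 : 0 < e / 2 by rewrite divr_gt0.
have [k1 [d1 [d10 h1]]] := @radon_lower rho _
  (fun x => cvgD (cl x) (cf x)) sl1 fl1 _ e20.
have [k2 [d2 [d20 h2]]] := @radon_lower rho _
  (fun x => cvgB (cl x) (cf x)) sl2 fl2 _ e20.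
have d30 : 0 < e / 2 / (C + 1) by rewrite divr_gt0// ltr_wpDl.
have FF := radon_basic_filter rho.
near=> rho'.
have /h1 : `|radon_coord k1 rho' - radon_coord k1 rho| < d1.
  by near: rho'; exact: radon_basic_coord.
have /h2 : `|radon_coord k2 rho' - radon_coord k2 rho| < d2.
  by near: rho'; exact: radon_basic_coord.
have : `|radon_coord (pickle l) rho' - radon_coord (pickle l) rho| < e / 2 / (C + 1).
  by near: rho'; exact: radon_basic_coord.
rewrite !i1 !i2 => /ltW h3.
have {h3} : C * `|radon_coord (pickle l) rho' - radon_coord (pickle l) rho| <= e / 2.
  apply: (@le_trans _ _ (C * (e / 2 / (C + 1)))); first exact: ler_wpM2l.
  by rewrite mulrA ler_pdivrMr ?ltr_wpDl// mulrC ler_wpM2l// ?ltW// ltrDl.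
rewrite -{1}(ger0_norm C0) -normrM mulrBr ler_norml => /andP[? ?] ? ?.
by rewrite /= ltr_norml; apply/andP; split; lra.
Unshelve. all: by end_near. Qed.

(** Convergence of a filter in a supremum of topologies is tested in each of them, here on each
    evaluation, where [radon_basic_eval] applies. *)
Lemma radon_nbhs rho A : nbhs rho A -> radon_basic rho A.
Proof.
move: A; suff : radon_basic rho --> rho by [].
have FF := radon_basic_filter rho.
apply/(@cvg_sup _ _
  (fun f : test_fun R => Topological.class (initial_topology (radon_eval f)))).
move=> f A /=; rewrite (@nbhsE (initial_topology (radon_eval f))).
move=> -[_ [[B Bop <-] Bf] BA]; apply: filterS BA _.
have /nbhs_ballP[e e0 eB] := open_nbhs_nbhs (conj Bop Bf).
by apply: filterS (radon_basic_eval rho f e0) => rho' h; exact: eB.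
Qed.

End radon_topology.

(** * The product space and its countable test class *)

Section configuration_space.
Context (R : realType).
Local Notation T := (radon R * I01 R)%type.

Definition coord (n : nat) (p : T) : R :=
  if n is m.+1 then radon_coord m p.1 else val p.2.

Lemma I01_val_continuous : continuous (val : I01 R -> R).
Proof. exact: (@initial_continuous (I01 R) R). Qed.

Lemma fst_continuous : continuous (fst : T -> radon R).
Proof. by move=> p; exact: cvg_fst. Qed.

Lemma snd_continuous : continuous (snd : T -> I01 R).
Proof. by move=> p; exact: cvg_snd. Qed.

Lemma coord_continuous n : continuous (coord n).
Proof.
case: n => [|n] p /=.
  by apply: (@continuous_comp T (I01 R) R snd val);
    [exact: snd_continuous|exact: I01_val_continuous].
by apply: (@continuous_comp T (radon R) R fst (radon_coord n));
  [exact: fst_continuous|exact: radon_coord_continuous].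
Qed.

Lemma coord_nbhs (p : T) A : nbhs p A -> exists n (d : R), 0 < d /\
  forall q, (forall j, (j < n.+1)%N -> `|coord j q - coord j p| < d) -> A q.
Proof.
move=> [[B C] /= [Bp Cp] BCA].
have [n [d [d0 hB]]] := radon_nbhs Bp.
have [d' d'0 hC] : exists2 d', 0 < d' &
    forall z : I01 R, `|val z - val p.2| < d' -> C z.
  move: Cp; rewrite nbhsE => -[_ [[V oV <-] Vp] VC].
  have /nbhs_ballP[e e0 eV] := open_nbhs_nbhs (conj oV Vp).
  exists e => // z h; apply: VC; apply: eV.
  by rewrite /ball/= distrC.
exists n.+1, (Num.min d d'); split; first by rewrite lt_min d0.
move=> q h; apply: (BCA q); split => /=.
  apply: hB => j jn; have := h j.+1 jn.
  by rewrite lt_min => /andP[].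
by apply: hC; have := h 0%N isT; rewrite lt_min => /andP[].
Qed.

Definition class_fun (l : seq hat_index) : T -> R := max_of (hat coord) l.

Lemma class_fun_continuous l : continuous (class_fun l).
Proof.
by apply: max_of_continuous => c; apply: hat_continuous; exact: coord_continuous.
Qed.

Lemma class_fun_ge0 l p : 0 <= class_fun l p.
Proof. exact: max_of_ge0. Qed.

Lemma class_fun_bounded l : exists C, forall p, class_fun l p <= C.
Proof.
elim: l => [|c l [C hC]].
  by exists 0 => p; rewrite /class_fun /max_of big_nil.
exists (Num.max `|ratr c.1.1.1| C) => p; rewrite /class_fun max_of_cons.
by rewrite ge_max !le_max hat_le hC orbT.
Qed.

Let max_dist (a b c d L : R) : `|a - b| <= L -> `|c - d| <= L ->
  `|Num.max a c - Num.max b d| <= L.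
Proof.
rewrite !ler_norml => /andP[? ?] /andP[? ?].
by case: (leP a c) => ?; case: (leP b d) => ?; apply/andP; split; lra.
Qed.

(** The constant is uniform in the measure [r]; this is what later allows the position to be rounded
    to a grid. *)
Lemma class_fun_lipschitz l : exists L, forall r (y z : I01 R),
  `|class_fun l (r, y) - class_fun l (r, z)| <= L * `|val y - val z|.
Proof.
elim: l => [|[[[c M] n] q] l [L hL]].
  by exists 0 => r y z; rewrite /class_fun /max_of !big_nil subrr normr0 mul0r.
exists (Num.max M.+1%:R L) => r y z; rewrite /class_fun !max_of_cons.
have mono K : K <= Num.max M.+1%:R L ->
    K * `|val y - val z| <= Num.max M.+1%:R L * `|val y - val z|.
  by move=> h; rewrite ler_wpM2r.
apply: max_dist; last first.
  by apply: le_trans (hL r y z) _; apply: mono; rewrite le_max lexx orbT.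
apply: le_trans (mono M.+1%:R _); last by rewrite le_max lexx.
rewrite /hat; apply: max_dist; first by rewrite subrr normr0 mulr_ge0.
rewrite [X in `|X|](_ : _ =
  M.+1%:R * (hat_dist coord n q (r, z) - hat_dist coord n q (r, y))).
  (* Only coordinate 0 depends on the position, so all other terms of the two distances cancel. *)
  rewrite normrM ger0_norm// ler_wpM2l// /hat_dist !big_ord_recl/=.
  rewrite opprD addrACA subrr addr0.
  by rewrite (le_trans (ler_dist_dist _ _))// opprB addrA subrK distrC.
by rewrite mulrBr; ring.
Qed.

Lemma weak_cvg_class (m_ : nat -> {measure set (borel T) -> \bar R})
    (m : {measure set (borel T) -> \bar R}) :
  (m setT < +oo)%E -> (forall n, (m_ n setT < +oo)%E) ->
  \int[m_ n]_x 1 @[n --> \oo] --> \int[m]_x (1 : R) ->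
  (forall l, \int[m_ n]_x class_fun l x @[n --> \oo] --> \int[m]_x class_fun l x) ->
  weak_cvg m_ m.
Proof.
move=> mfin m_fin m1 ml.
have bc c : continuous (hat coord c).
  by apply: hat_continuous; exact: coord_continuous.
apply: (weak_cvg_max_of (T := T) bc) => //.
move=> f cf f0; apply: hat_dense => //.
exact: coord_nbhs.
Qed.

End configuration_space.

(** * A strong law for arrays of independent events *)

Section bernoulli_strong_law.
Context (R : realType) d (Omega : measurableType d) (P : probability Omega R).

(** Replacing some of the events by [setT] encodes the product rule for every subfamily. *)
Definition independent_events (I : finType) (F : I -> set Omega) :=
  forall E : I -> set Omega, (forall i, E i = F i \/ E i = setT) ->
    P (\bigcap_i E i) = (\prod_i fine (P (E i)))%:E.

Section fixed_size.
Context (K : finType) (F : K -> set Omega).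
Hypothesis mF : forall i, measurable (F i).
Hypothesis iF : independent_events F.
Let p i := fine (P (F i)).

Let p_ge0 i : 0 <= p i. Proof. exact: fine_ge0. Qed.

Let p_le1 i : p i <= 1.
Proof.
by rewrite /p -lee_fin fineK ?probability_le1// fin_num_measure.
Qed.

Let expect_prod_indic (J : {set K}) :
  (\int[P]_w (\prod_(i in J) \1_(F i) w : R)%:E = (\prod_(i in J) p i)%:E)%E.
Proof.
pose E i := if i \in J then F i else setT.
have EE w : \prod_(i in J) \1_(F i) w = \1_(\bigcap_i E i) w :> R.
  rewrite [RHS]indicE; case: (boolP (w \in _)) => [|/negP] h.
    rewrite big1// => i iJ; rewrite indicE mem_set//.
    by move: h; rewrite inE => /(_ i I); rewrite /E iJ.
  have [i iJ iF'] : exists2 i, i \in J & ~ F i w.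
    apply: contrapT => h'; apply: h; rewrite inE => i _; rewrite /E.
    by case: ifPn => // iJ; apply: contrapT => ?; apply: h'; exists i.
  by rewrite (bigD1 i)//= indicE memNset// mul0r.
under eq_integral do rewrite EE.
rewrite integral_indic ?setIT//; last first.
  by apply: fin_bigcap_measurable => // i _; rewrite /E; case: ifP.
transitivity ((\prod_i fine (P (E i)))%:E).
  by apply: iF => i; rewrite /E; case: ifP; [left|right].
congr EFin; rewrite [RHS]big_mkcond/=; apply: eq_bigr => i _.
by rewrite /E; case: ifP => // _; rewrite probability_setT.
Qed.

(** Expanding the product over the subsets [J] leaves only probabilities of intersections, which is
    exactly what [independent_events] provides. *)
Lemma expect_prod_affine (a b : K -> R) :
  (\int[P]_w (\prod_i (a i * \1_(F i) w + b i))%:E =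
   (\prod_i (a i * p i + b i))%:E)%E.
Proof.
pose k (J : {set K}) := \prod_i (if i \in J then a i else b i).
have split_prod (u : K -> R) : \prod_i (a i * u i + b i) =
    \sum_(J in {set K}) k J * \prod_(i in J) u i.
  rewrite bigA_distr; apply: eq_bigr => J _.
  rewrite /k [X in _ * X]big_mkcond -big_split/=.
  by apply: eq_bigr => i _; case: ifP; rewrite ?mulr1.
have Pfin : (P setT < +oo)%E by rewrite probability_setT ltry.
rewrite split_prod.
under eq_integral do rewrite split_prod -sumEFin.
rewrite integral_sum//=; last first.
  move=> J; apply: (integrable_bounded Pfin (C := `|k J|)).
    apply: measurable_funM => //.
    under eq_fun do rewrite big_mkcond/=.
    by apply: measurable_prod => i _; case: (i \in J) => //; exact: measurable_indic.
  move=> w; rewrite normrM ler_piMr// normr_prod prodr_ile1// => i _.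
  by rewrite normr_ge0 indicE; case: (w \in F i); rewrite ?normr1 ?normr0 ?lexx ?ler01.
rewrite -sumEFin; apply: eq_bigr => J _.
under eq_integral do rewrite EFinM.
rewrite integralZl//; first by rewrite expect_prod_indic.
apply: (integrable_bounded Pfin (C := 1)).
  under eq_fun do rewrite big_mkcond/=.
  by apply: measurable_prod => i _; case: (i \in J) => //; exact: measurable_indic.
move=> w; rewrite normr_prod prodr_ile1// => i _.
by rewrite normr_ge0 indicE; case: (w \in F i); rewrite ?normr1 ?normr0 ?lexx ?ler01.
Qed.

(** The left side is the mean of exp(v (B - q)) for a Bernoulli variable B of parameter [q], in the
    affine form of [expect_prod_affine]. *)
Lemma exp_moment_bound (v q : R) : `|v| <= 2^-1 -> 0 <= q <= 1 ->
  (expR (v * (1 - q)) - expR (- (v * q))) * q + expR (- (v * q)) <=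
  expR (2 * v ^+ 2).
Proof.
move=> v2 /andP[q0 q1].
have -> : v * (1 - q) = - (v * q) + v by ring.
rewrite expRD.
have -> : (expR (- (v * q)) * expR v - expR (- (v * q))) * q + expR (- (v * q))
  = expR (- (v * q)) * (1 + q * (expR v - 1)) by ring.
apply: (@le_trans _ _ (expR (- (v * q)) * expR (q * (expR v - 1)))).
  by rewrite ler_wpM2l ?expR_ge0// expR_ge1Dx.
rewrite -expRD ler_expR.
(* From exp(-v) >= 1 - v one gets exp(v) (1 - v) <= 1, while (1 + v + 2 v^2)(1 - v) = 1 + v^2 (1 - 2
   v) >= 1. *)
have ev : expR v <= 1 + v + 2 * v ^+ 2.
  have vv : v <= 2^-1 by rewrite (le_trans (ler_norm v)).
  have h : 1 - v <= (expR v)^-1 by rewrite -expRN; exact: expR_ge1Dx.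
  have h0 := expR_gt0 v.
  have {}h : expR v * (1 - v) <= 1.
    by rewrite mulrC -ler_pdivlMr// mul1r.
  have v1 : 0 < 1 - v by lra.
  rewrite -(ler_pM2r v1) (le_trans h)//.
  have : 0 <= v ^+ 2 * (1 - 2 * v) by rewrite mulr_ge0 ?sqr_ge0//; lra.
  nra.
have : 0 <= q * (1 + v + 2 * v ^+ 2 - expR v) by rewrite mulr_ge0//; lra.
have : 0 <= (1 - q) * (2 * v ^+ 2) by apply: mulr_ge0; [lra|rewrite mulr_ge0 ?sqr_ge0].
lra.
Qed.

Variables (c : K -> R) (C : R).
Hypothesis cC : forall i, `|c i| <= C.

Let S (w : Omega) := \sum_i c i * (\1_(F i) w - p i).

Lemma measurable_centered_sum : measurable_fun setT S.
Proof.
apply: measurable_sum => i; apply: measurable_funM => //.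
by apply: measurable_funB => //; exact: measurable_indic.
Qed.

(** Chernoff's bound: Markov's inequality for exp(th S), whose mean factorises by independence. *)
Lemma centered_sum_tail (th x : R) : 0 <= th -> th * C <= 2^-1 ->
  (P [set w | (x <= S w)%R] <=
   (expR (#|K|%:R * (2 * (th * C) ^+ 2) - th * x))%:E)%E.
Proof.
move=> th0 thC.
have mS := measurable_centered_sum.
have mA : measurable [set w | x <= S w].
  rewrite (_ : mkset _ = S @^-1` `[x, +oo[); last first.
    by apply/seteqP; split => w /=; rewrite in_itv/= andbT.
  by rewrite -[X in measurable X]setTI; exact: mS.
have mE : measurable_fun setT (fun w => expR (th * S w)).
  apply: (measurableT_comp (@measurable_expR R)).
  by apply: measurable_funM => //.
apply: (@le_trans _ _ (\int[P]_w (expR (th * S w - th * x))%:E)%E).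
  rewrite -[X in (P X <= _)%E]setIT -integral_indic//.
  apply: ge0_le_integral => //.
  - by apply/measurable_EFinP; exact: measurable_indic.
  - apply/measurable_EFinP; apply: (measurableT_comp (@measurable_expR R)).
    apply: measurable_funB => //; apply: measurable_funM => //.
  - move=> w _; rewrite lee_fin indicE.
    case: (boolP (w \in _)); last by rewrite expR_ge0.
    rewrite inE/= => h; rewrite -expR0 ler_expR subr_ge0 ler_wpM2l//.
under eq_integral do rewrite expRD EFinM.
rewrite ge0_integralZr//; last exact/measurable_EFinP.
rewrite expRD EFinM lee_wpmul2r ?lee_fin ?expR_ge0//.
pose v i := th * c i.
(* [b] is the value of exp(v (1_F - p)) off the event and [a + b] its value on it, so the
   exponential is affine in the indicator. *)
pose b i := expR (- (v i * p i)).
pose a i := expR (v i * (1 - p i)) - b i.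
have -> : (\int[P]_w (expR (th * S w))%:E =
    \int[P]_w (\prod_i (a i * \1_(F i) w + b i))%:E)%E.
  apply: eq_integral => w _; congr EFin.
  rewrite /S mulr_sumr expR_sum; apply: eq_bigr => i _.
  rewrite mulrA -/(v i) /a /b indicE; case: (w \in _); rewrite ?mulr1 ?mulr0.
    by rewrite subrK.
  by rewrite sub0r mulrN add0r.
rewrite expect_prod_affine lee_fin expRM_natl.
rewrite -prodr_const.
apply: ler_prod => i _; apply/andP; split.
  have -> : a i * p i + b i = expR (v i * (1 - p i)) * p i + b i * (1 - p i).
    by rewrite /a; ring.
  by rewrite addr_ge0// mulr_ge0 ?expR_ge0 ?p_ge0// subr_ge0.
have vC : `|v i| <= th * C by rewrite normrM (ger0_norm th0) ler_wpM2l.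
apply: le_trans (exp_moment_bound (le_trans vC thC) _) _; first by rewrite p_ge0 p_le1.
rewrite ler_expR ler_pM2l// -(real_normK (num_real (v i))).
by rewrite lerXn2r// nnegrE (le_trans _ vC).
Qed.

End fixed_size.

Lemma bernoulli_upper_law (F : forall N, 'I_N -> set Omega)
    (c : forall N, 'I_N -> R) (C : R) :
  (forall N i, measurable (F N i)) -> (forall N, independent_events (F N)) ->
  (forall N i, `|c N i| <= C) -> forall e, 0 < e ->
  {ae P, forall w, \forall N \near \oo,
    N%:R^-1 * \sum_(i < N) c N i * (\1_(F N i) w - fine (P (F N i))) < e}.
Proof.
move=> mF iF cC e e0.
pose D := `|C| + 1.
have D0 : 0 < D by rewrite /D ltr_wpDl.
have cD N i : `|c N i| <= D.
  by rewrite (le_trans (cC N i))// /D (le_trans (ler_norm C))// lerDl.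
(* The first bound meets the condition of [centered_sum_tail]. The second makes the quadratic term
   at most half of [th * e] per item, so that the tail is at most [q ^+ N], which is summable. *)
pose th := Num.min (2^-1 / D) (e / (4 * D ^+ 2)).
have D2 : 0 < 4 * D ^+ 2 by rewrite mulr_gt0// exprn_gt0.
have th0 : 0 < th by rewrite lt_min !divr_gt0.
have thD : th * D <= 2^-1 by rewrite -ler_pdivlMr// /th ge_min lexx.
have the : th * (4 * D ^+ 2) <= e by rewrite -ler_pdivlMr// /th ge_min lexx orbT.
pose S N w := \sum_(i < N) c N i * (\1_(F N i) w - fine (P (F N i))) : R.
pose A N := [set w | N%:R * e <= S N w].
pose q := expR (- (th * e / 2)).
have q0 : 0 <= q by exact: expR_ge0.
have q1 : q < 1 by rewrite expR_lt1 oppr_lt0 divr_gt0// mulr_gt0.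
have mA N : measurable (A N).
  rewrite (_ : A N = S N @^-1` `[N%:R * e, +oo[); last first.
    by apply/seteqP; split => w /=; rewrite in_itv/= andbT.
  by rewrite -[X in measurable X]setTI; exact: measurable_centered_sum.
have PA N : (P (A N) <= (geometric 1 q N)%:E)%E.
  apply: le_trans (centered_sum_tail (mF N) (iF N) (cD N) _ (ltW th0) thD) _.
  rewrite lee_fin card_ord /geometric/= mul1r /q -expRM_natl ler_expR.
  have N0 : 0 <= N%:R :> R by [].
  have : 0 <= th * (e - th * (4 * D ^+ 2)).
    by rewrite mulr_ge0 ?subr_ge0// ltW.
  nra.
have sumA : (\sum_(n <oo) P (A n) < +oo)%E.
  apply: (@le_lt_trans _ _ (\sum_(n <oo) (geometric 1 q n)%:E)%E).
    by apply: lee_nneseries => // n _ _; exact: measure_ge0.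
  have /cvg_lim h : (fun n => \sum_(0 <= k < n) (geometric 1 q k)%:E)%E @ \oo --> (1 * (1 - q)^-1)%:E.
    under eq_fun do rewrite sumEFin.
    apply/cvg_EFin; first exact: nearW.
    by apply: cvg_geometric_series; rewrite ger0_norm.
  by rewrite h// ltry.
have h0 := lim_sup_set_cvg0 mA sumA.
exists (lim_sup_set A); split => //.
  apply: bigcap_measurable => // k _.
  by apply: bigcup_measurable => j _; exact: mA.
move=> w /= nw n _; apply: contrapT => h; apply: nw.
(* Starting from [n.+1] makes [N] positive, as the division by [N] requires. *)
exists n.+1 => // N /= nN.
rewrite mulrC ltr_pdivrMr; last by rewrite ltr0n (leq_trans _ nN).
by rewrite ltNge mulrC; apply/negP => h'; apply: h; exists N => //=; exact: ltnW.
Qed.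

(** The one-sided law is used for [c] and for its opposite, at the levels 1/(k+1) only, so that
    countably many null sets are discarded. *)
Lemma bernoulli_strong_law (F : forall N, 'I_N -> set Omega)
    (c : forall N, 'I_N -> R) (C : R) :
  (forall N i, measurable (F N i)) -> (forall N, independent_events (F N)) ->
  (forall N i, `|c N i| <= C) ->
  {ae P, forall w,
    N%:R^-1 * \sum_(i < N) c N i * (\1_(F N i) w - fine (P (F N i)))
      @[N --> \oo] --> (0 : R)}.
Proof.
move=> mF iF cC.
have k0 k : 0 < k.+1%:R^-1 :> R by rewrite invr_gt0.
have cC' N i : `|- c N i| <= C by rewrite normrN.
have h1 := ae_foralln (fun k => bernoulli_upper_law mF iF cC (k0 k)).
have h2 := ae_foralln (fun k => bernoulli_upper_law mF iF cC' (k0 k)).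
apply: filterS2 h1 h2 => w h1 h2; apply/cvgrPdist_lt => e e0.
pose k := Num.truncn e^-1.
have ke : k.+1%:R^-1 < e.
  by rewrite -[ltRHS]invrK ltf_pV2 ?posrE ?invr_gt0// truncnS_gt.
apply: filterS2 (h1 k) (h2 k) => N lt1 lt2.
rewrite sub0r normrN ltr_norml (lt_trans lt1 ke) andbT ltrNl.
apply: lt_trans ke; apply: le_lt_trans lt2.
rewrite -mulrN ler_wpM2l ?invr_ge0// -sumrN ler_sum// => i _.
by rewrite mulNr.
Qed.

End bernoulli_strong_law.

(** * Ranks at a fixed time *)

Lemma card_ord_lt N m : (m <= N)%N -> #|[set j : 'I_N | (j < m)%N]%SET| = m.
Proof.
move=> mN; rewrite -sum1_card (eq_bigl (fun j : 'I_N => (j < m)%N)).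
  by rewrite -(big_ord_widen N (fun=> 1%N) mN) sum1_card card_ord.
by move=> j; rewrite inE.
Qed.

Section ranks.
Context (R : realType) (N : nat) (x : {perm 'I_N})
  (nu : 'I_N -> {measure set R -> \bar R}) (tau : 'I_N -> nat -> R)
  (X : 'I_N -> R -> nat) (t : R).
Hypothesis jt : jump_times nu tau.
Hypothesis rp : ranking_path (fun i => (x i).+1) tau X.
Hypothesis nu_fin : forall i, (nu i `]0%R, t]%classic < +oo)%E.
Hypothesis t_ge0 : 0 <= t.

Let tau0 i : 0 < tau i 0%N. Proof. by case: jt. Qed.

Let tau_inc i j j' : (j <= j')%N -> tau i j <= tau i j'.
Proof.
case: jt => _ _ h _; elim: j' => [|j' ih]; first by rewrite leqn0 => /eqP->.
rewrite leq_eqVlt => /predU1P[->//|]; rewrite ltnS => /ih/le_trans; apply.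
exact/ltW/h.
Qed.

Let tau_gt0 i j : 0 < tau i j.
Proof. exact: lt_le_trans (tau0 i) (tau_inc i (leq0n j)). Qed.

Lemma no_jumpP i s : nu i `]s, t]%classic = 0%E <->
  forall j, ~~ (s < tau i j <= t).
Proof.
have -> : nu i `]s, t]%classic =
    (\sum_(j <oo) \d_(tau i j) (`]s, t]%classic : set R))%E by case: jt => + _ _ _; apply.
split => [h j|h].
  apply/negP => jst; move: h; apply/eqP; rewrite gt_eqF//.
  apply: (@lt_le_trans _ _ 1%E); first exact: lte01.
  apply: (@le_trans _ _ (\sum_(0 <= k < j.+1) \d_(tau i k) (`]s, t]%classic : set R))%E).
    rewrite big_nat_recr//= [X in (_ <= _ + X)%E]diracE mem_set//=.
    by rewrite leeDr// sume_ge0.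
  by apply: nneseries_lim_ge => k _ _; exact: measure_ge0.
apply: eseries0 => j _ _; rewrite diracE memNset//= in_itv/=.
exact/negP.
Qed.

Lemma no_jump0P i : nu i `]0%R, t]%classic = 0%E <-> t < tau i 0%N.
Proof.
rewrite no_jumpP; split => [/(_ 0%N)|h j]; first by rewrite tau_gt0/= -ltNge.
by rewrite tau_gt0/= -ltNge (lt_le_trans h)// tau_inc.
Qed.

(** If every jump time were at most [t], the interval ]0, t] would carry infinitely many unit
    masses, against its finite measure. *)
Lemma last_jump i : tau i 0%N <= t -> exists j, tau i j <= t < tau i j.+1.
Proof.
move=> i0; apply: contrapT => h.
have {}h j : tau i j <= t.
  elim: j => // j ih; rewrite leNgt; apply/negP => h'; apply: h.
  by exists j; rewrite ih.
have [M hM] : exists M : nat, (nu i `]0%R, t]%classic < M%:R%:E)%E.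
  have f : nu i `]0%R, t]%classic \is a fin_num by rewrite ge0_fin_numE.
  rewrite -(fineK f); exists (Num.truncn (fine (nu i `]0%R, t]%classic))).+1.
  by rewrite lte_fin truncnS_gt.
have : (nu i `]0%R, t]%classic < M%:R%:E)%E by [].
have -> : nu i `]0%R, t]%classic =
    (\sum_(j <oo) \d_(tau i j) (`]0%R, t]%classic : set R))%E by case: jt => + _ _ _; apply.
apply/negP; rewrite -leNgt.
apply: (@le_trans _ _ (\sum_(0 <= k < M) \d_(tau i k) (`]0%R, t]%classic : set R))%E).
  rewrite (eq_bigr (fun=> 1%:E)).
    by rewrite sumEFin big_mkord sumr_const card_ord.
  by move=> j _; rewrite diracE mem_set//= in_itv/= tau_gt0 h.
by apply: nneseries_lim_ge => k _ _; exact: measure_ge0.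
Qed.

(** The items ranked before [i] at time [t]. Before its first jump [i] is preceded by those that
    started ahead or have jumped; afterwards by those that jumped since its last jump. *)
Let ahead i : {set 'I_N} := [set k : 'I_N |
  if (t < tau i 0%N) then (x k < x i)%N || (tau k 0%N <= t)
  else `[< exists j, tau i j <= t < tau i j.+1 /\
           exists j', tau i j < tau k j' <= t >]]%SET.

Let last_jump_uniq i j j' : tau i j <= t < tau i j.+1 ->
  tau i j' <= t < tau i j'.+1 -> j = j'.
Proof.
move=> /andP[a b] /andP[c d]; apply/eqP; rewrite eqn_leq; apply/andP; split.
  rewrite leqNgt; apply/negP => /(tau_inc i) /(lt_le_trans d).
  by rewrite ltNge a.
rewrite leqNgt; apply/negP => /(tau_inc i) /(lt_le_trans b).
by rewrite ltNge c.
Qed.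

Let rankE i : X i t = #|ahead i|.+1.
Proof.
have [r1 r2] := rp i.
have [h|h] := ltP t (tau i 0%N).
  rewrite r1 ?t_ge0// addSn; congr _.+1.
  (* The initial position is itself a count, of the items that started ahead of [i]; both counts
     then become sums over the items. *)
  rewrite -{1}(card_ord_lt (ltnW (ltn_ord (x i)))).
  rewrite -(card_preimset [set j : 'I_N | (j < x i)%N]%SET (@perm_inj _ x)).
  rewrite -sum1_card big_mkcond/= [X in (_ + X)%N]big_mkcond/= -big_split/=.
  rewrite -sum1_card [RHS]big_mkcond/=; apply: eq_bigr => k _.
  rewrite !inE h ltnS.
  case: ltngtP => [_|_|xki] /=.
  - by [].
  - by case: (tau k 0%N <= t).
  - by rewrite (perm_inj (ord_inj xki)) leNgt h.
have [j hj] := last_jump h.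
rewrite (r2 j)// add1n; congr _.+1.
rewrite -sum1_card [RHS]big_mkcond/=; apply: eq_bigr => k _.
rewrite inE ltNge h/=.
rewrite (_ : `[< exists j0, _ >] = `[< exists j', tau i j < tau k j' <= t >]).
  by case: asbool.
apply/asbool_equiv_eq; split => [[j0 [hj0]]|[j' hj']].
  by rewrite (last_jump_uniq hj0 hj).
by exists j; split => //; exists j'.
Qed.

Definition behind (s : R) (m : nat) : {set 'I_N} :=
  [set i | `[< nu i `]s, t]%classic = 0%E >] && (m <= x i)%N]%SET.

Let behindP s m i : reflect (nu i `]s, t]%classic = 0%E /\ (m <= x i)%N) (i \in behind s m).
Proof. by rewrite inE; apply: (iffP andP) => -[/asboolP]. Qed.

Let jumpP s i : nu i `]s, t]%classic <> 0%E -> exists j, s < tau i j <= t.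
Proof.
rewrite no_jumpP => h; apply: contrapT => h'; apply: h => j.
by apply/negP => h; apply: h'; exists j.
Qed.

(** If [m = 0], no member has jumped after [s] and every non-member has, which put it ahead. If
    [s = 0], members have never jumped, and among such items the initial order decides. *)
Let ahead_behind s m i : 0 <= s -> s = 0 \/ m = 0%N ->
  i \in behind s m -> ~: behind s m \subset ahead i.
Proof.
move=> s0 sm /behindP[/no_jumpP iS mi]; apply/fintype.subsetP => k.
rewrite finset.in_setC => /behindP/not_andP kS; rewrite inE.
have [h|h] := ltP t (tau i 0%N).
  case: kS => [/jumpP[j /andP[_ jt']]|/negP].
    by rewrite (le_trans _ jt') ?orbT// tau_inc.
  by rewrite -ltnNge => /leq_trans -> .
have [j hj] := last_jump h; have /andP[hj1 hj2] := hj.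
have := iS j; rewrite hj1 andbT -leNgt => js.
apply/asboolP; exists j; split => //.
case: kS => [/jumpP[j' /andP[sj' j't]]|/negP].
  by exists j'; rewrite (le_lt_trans js).
case: sm => [z|->//]; move: js; rewrite z => /(lt_le_trans (tau_gt0 i j)).
by rewrite ltxx.
Qed.

(** Removing [i] itself gains the unit that makes the threshold of [rank_gt_behind] exact for
    non-members. *)
Let behind_ahead s m i : 0 <= s -> s = 0 \/ m = 0%N ->
  i \notin behind s m -> ahead i \subset ~: behind s m :\ i.
Proof.
move=> s0 sm /behindP/not_andP iS; apply/fintype.subsetP => k.
rewrite finset.in_setD1 finset.in_setC inE.
have [h|h] := ltP t (tau i 0%N).
  have s00 : s = 0.
    case: sm => // m0; case: iS; last by rewrite m0.
    move=> /jumpP[j /andP[_]].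
    by rewrite leNgt (lt_le_trans h)// tau_inc.
  have xm : (x i < m)%N.
    case: iS => [|/negP]; last by rewrite -ltnNge.
    by rewrite s00 no_jump0P h.
  move=> hk; apply/andP; split.
    by apply: contraTneq hk => ->; rewrite ltnn/= -ltNge.
  apply/behindP => -[]; rewrite s00 no_jump0P => kt mk.
  by move: hk; rewrite leNgt kt orbF ltnNge (leq_trans _ mk)// ltnW.
move=> /asboolP[j [hj [j' /andP[jj' j't]]]].
apply/andP; split.
  apply/eqP => ki; move: jj' j't; rewrite ki => jj' j't.
  have /andP[_ h2] := hj.
  have : (j < j')%N.
    by rewrite ltnNge; apply/negP => /(tau_inc i) /(lt_le_trans jj'); rewrite ltxx.
  by move=> /(tau_inc i) /(lt_le_trans h2); rewrite ltNge j't.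
apply/behindP => -[/no_jumpP/(_ j')]; rewrite j't andbT -leNgt => j's mk.
have [s00|m0] := sm.
  by move: j's; rewrite leNgt s00 tau_gt0.
case: iS => [/jumpP[j0 /andP[sj0 j0t]]|]; last by rewrite m0.
have : tau i j0 <= tau i j.
  apply: tau_inc; rewrite leqNgt; apply/negP => /(tau_inc i).
  by have /andP[_ h2] := hj; move=> /(lt_le_trans h2); rewrite ltNge j0t.
move=> h1; have := lt_le_trans (lt_trans (lt_le_trans sj0 h1) jj') j's.
by rewrite ltxx.
Qed.

(* [behind s m] is a tail set of the ranking only if one of its two cut-offs
   is trivial. *)
Lemma rank_gt_behind s m i : 0 <= s -> s = 0 \/ m = 0%N ->
  (N - #|behind s m| < X i t)%N = (i \in behind s m).
Proof.
move=> s0 sm; rewrite rankE.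
have -> : (N - #|behind s m|)%N = #|~: behind s m|.
  by have := cardsC (behind s m); rewrite card_ord => {1}<-; rewrite addKn.
case: (boolP (i \in _)) => h.
  by rewrite ltnS subset_leq_card// ahead_behind.
apply/negbTE; rewrite -leqNgt.
have /subset_leq_card := behind_ahead s0 sm h.
rewrite -ltnS => /leq_trans; apply.
by rewrite [leqRHS](cardsD1 i) finset.in_setC h.
Qed.

End ranks.

(** * Deterministic limits *)

Section survival.
Context (R : realType).
Implicit Types (r : radon R) (s t : R).

(** The probability that a Poisson measure of intensity [r] has no point in ]s, t]. *)
Definition survival s t r : R := expR (- incr s t r).

Lemma incr_ge0 s t r : 0 <= incr s t r.
Proof. exact: fine_ge0. Qed.

Lemma incrE s t r : r `]s, t]%classic = (incr s t r)%:E.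
Proof. by rewrite /incr fineK// ge0_fin_numE// radon_itv_lt. Qed.

Lemma incr_nincr s s' t r : s <= s' -> incr s' t r <= incr s t r.
Proof.
move=> ss'; rewrite -lee_fin -!incrE; apply: le_measure; rewrite ?inE//.
by apply: subset_itvr; rewrite bnd_simp.
Qed.

Lemma incr_id t r : incr t t r = 0.
Proof. by rewrite /incr set_itvoc0// measure0. Qed.

Lemma survival_gt0 s t r : 0 < survival s t r.
Proof. exact: expR_gt0. Qed.

Lemma survival_ge0 s t r : 0 <= survival s t r.
Proof. exact: expR_ge0. Qed.

Lemma survival_le1 s t r : survival s t r <= 1.
Proof. by rewrite /survival expR_le1 oppr_le0 incr_ge0. Qed.

Lemma survival_id t r : survival t t r = 1.
Proof. by rewrite /survival incr_id oppr0 expR0. Qed.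

Lemma survival_nd s s' t r : s <= s' -> survival s t r <= survival s' t r.
Proof. by move=> ss'; rewrite ler_expR lerN2 incr_nincr. Qed.

Lemma measurable_survival s t :
  measurable_fun setT (survival s t : borel (radon R) -> R).
Proof.
apply: (measurableT_comp (@measurable_expR R)).
apply: (measurableT_comp (@oppr_measurable R _)).
exact: measurable_incr.
Qed.

End survival.

(** * Change of variables for the marginals *)

Section marginal_integrals.
Context (R : realType).
Local Notation T := (radon R * I01 R)%type.
Variable mu : {measure set (borel T) -> \bar R}.

Lemma borel_fst_measurable : measurable_fun setT (fst : borel T -> borel (radon R)).
Proof. exact: (@continuous_borel_measurable T (radon R) fst (@fst_continuous R)). Qed.

Lemma measurable_val_snd : measurable_fun setT ((fun p : T => val p.2) : borel T -> R).
Proof.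
exact: (@continuous_measurable_borel R T _ (@coord_continuous R 0)).
Qed.

Lemma measurable_level (y : R) : measurable ([set p : T | y <= val p.2] : set (borel T)).
Proof.
have -> : [set p : T | y <= val p.2] = (fun p : T => val p.2) @^-1` `[y, +oo[%classic.
  by apply/seteqP; split => z /=; rewrite in_itv/= andbT.
by rewrite -[X in measurable X]setTI; exact: measurable_val_snd.
Qed.

Lemma integral_U (y : R) (A : set (borel (radon R))) (f : borel (radon R) -> \bar R) :
  measurable A -> measurable_fun setT f -> (forall r, 0 <= f r)%E ->
  (\int[U mu y]_(r in A) f r =
   \int[mu]_(p in (fst @^-1` A) `&` [set p : T | (y <= val p.2)%R]) f p.1)%E.
Proof.
move=> mA mf f0.
pose Z : set (borel T) := [set p : T | y <= val p.2].
have mZ : measurable Z := measurable_level y.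
have mfst := borel_fst_measurable.
have mfA : measurable (fst @^-1` A : set (borel T)).
  by rewrite -[X in measurable X]setTI; exact: mfst.
pose m := mrestr mu mZ.
rewrite (eq_measure_integral (pushforward m (fst : borel T -> borel (radon R)))); last first.
  move=> B mB _; rewrite /pushforward /m /mrestr.
  apply: (congr1 (mu : set (borel T) -> \bar R)).
  by apply/seteqP; split => -[].
rewrite (ge0_integral_pushforward mfst)//; last exact: measurable_funTS.
have mff : measurable_fun setT (f \o fst : borel T -> \bar R) by exact: measurableT_comp.
have m0 : (m (~` Z) = 0)%E.
  rewrite -[RHS](measure0 mu).
  by apply: (congr1 (mu : set (borel T) -> \bar R)); exact: setICl.
rewrite (@ge0_negligible_integral _ _ _ m _ (~` Z))//; [|exact: measurableC|exact: measurable_funTS|by move=> p _; exact: f0].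
rewrite setDE setCK; apply: eq_measure_integral => B mB BZ.
apply: (congr1 (mu : set (borel T) -> \bar R)).
by apply: setIidl => p /BZ[].
Qed.

Lemma integral_Lambda (A : set (borel (radon R))) (f : borel (radon R) -> \bar R) :
  measurable A -> measurable_fun setT f -> (forall r, 0 <= f r)%E ->
  (\int[Lambda mu]_(r in A) f r = \int[mu]_(p in fst @^-1` A) f p.1)%E.
Proof.
move=> mA mf f0; have mfst := borel_fst_measurable.
rewrite (eq_measure_integral (pushforward mu (fst : borel T -> borel (radon R)))); last first.
  move=> B mB _; rewrite /pushforward.
  apply: (congr1 (mu : set (borel T) -> \bar R)).
  by apply/seteqP; split => p /=; [case|move=> h; split].
by rewrite (ge0_integral_pushforward mfst)//; exact: measurable_funTS.
Qed.

Lemma Rintegral_Lambda (f : radon R -> R) :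
  measurable_fun setT (f : borel (radon R) -> R) -> (forall r, 0 <= f r) ->
  \int[Lambda mu]_r f r = \int[mu]_p f p.1.
Proof.
move=> mf f0; rewrite /Rintegral integral_Lambda//.
exact/measurable_EFinP.
Qed.

Lemma Rintegral_U (y : R) (f : radon R -> R) :
  measurable_fun setT (f : borel (radon R) -> R) -> (forall r, 0 <= f r) ->
  \int[U mu y]_r f r = \int[mu]_p ((y <= val p.2)%R%:R * f p.1).
Proof.
move=> mf f0; rewrite /Rintegral integral_U//; last exact/measurable_EFinP.
rewrite preimage_setT setTI [X in fine X = _]integral_mkcond.
apply: (congr1 (fun g : borel T -> \bar R => fine (integral mu setT g))).
apply/funext => p; rewrite /patch.
case: ifPn => [|/negP]; rewrite inE/= => h; first by rewrite h mul1r.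
by rewrite (negbTE (introN idP h)) mul0r.
Qed.

End marginal_integrals.

Section lambda_integral.
Context (R : realType) (L : {measure set (borel (radon R)) -> \bar R}) (s t : R).

Lemma measurable_incr_borel :
  measurable_fun setT (incr s t : borel (radon R) -> borel R).
Proof.
move=> _ B mB; apply: measurable_incr => //.
move: mB; apply: smallest_sub; first exact: sigma_algebra_measurable.
by move=> A; exact: open_measurable.
Qed.

(** The mixture of Dirac masses defining [lambda] is the image of [L] under [incr s t]. *)
Lemma Rintegral_lambda (f : R -> R) : continuous f -> (forall v, 0 <= f v) ->
  \int[lambda L s t]_v f v = \int[L]_r f (incr s t r).
Proof.
move=> cf f0; have mi := measurable_incr_borel.
have mf : measurable_fun setT (f : borel R -> R).
  exact: (@continuous_measurable_borel R R).
rewrite /Rintegral.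
rewrite (eq_measure_integral (pushforward L (incr s t : borel (radon R) -> borel R))).
  rewrite (ge0_integral_pushforward mi)//; first exact/measurable_EFinP.
  by move=> v _; rewrite lee_fin.
move=> A mA _; rewrite /lambda /pushforward.
rewrite -[X in _ = L X]setIT -integral_indic//.
by rewrite -[X in measurable X]setTI; exact: mi.
Qed.

End lambda_integral.

Section inner_trapezoid.
Context (R : realType) (s t : R).

(** Test functions below the indicator of ]s, t[. Their integrals are vaguely continuous lower
    bounds of the increment, and tend to the mass of the open interval only. *)
Definition inner_trapezoid (m : nat) (v : R) : R :=
  Num.max 0 (Num.min 1 (Num.min (m.+1%:R * (v - s)) (m.+1%:R * (t - v)))).

Let inner_trapezoid_continuous m : continuous (inner_trapezoid m).
Proof.
move=> v; rewrite /inner_trapezoid.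
apply: (@continuous_max _ R (cst 0) _ v); first exact: cst_continuous.
apply: (@continuous_min _ R (cst 1) _ v); first exact: cst_continuous.
apply: (@continuous_min _ R _ _ v).
  by apply: cvgM; [exact: cvg_cst|apply: cvgB; [exact: cvg_id|exact: cvg_cst]].
by apply: cvgM; [exact: cvg_cst|apply: cvgB; [exact: cvg_cst|exact: cvg_id]].
Qed.

Let inner_trapezoid_ge0 m v : 0 <= inner_trapezoid m v.
Proof. by rewrite /inner_trapezoid le_max lexx. Qed.

Let inner_trapezoid_le1 m v : inner_trapezoid m v <= 1.
Proof. by rewrite /inner_trapezoid ge_max ler01 ge_min lexx. Qed.

Let inner_trapezoid_out m v : ~~ (s < v < t) -> inner_trapezoid m v = 0.
Proof.
rewrite negb_and -!leNgt => h; apply/max_idPl; rewrite !ge_min; apply/orP; right.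
by case/orP: h => h; apply/orP; [left|right];
  rewrite mulr_ge0_le0// subr_le0.
Qed.

Let inner_trapezoid_supported m : compactly_supported (inner_trapezoid m).
Proof.
exists (Num.truncn (`|s| + `|t|)).+1 => v.
apply: contraR; rewrite -ltNge => hx; apply/eqP/inner_trapezoid_out.
have {}hx := lt_trans (truncnS_gt _) hx.
apply/negP => /andP[sv vt]; move: hx; apply/negP; rewrite -leNgt.
rewrite ler_norml; have := ler_norm t; have := ler_norm (- s).
have := normr_ge0 t; have := normr_ge0 s.
by rewrite normrN => *; apply/andP; split; lra.
Qed.

Let inner_trapezoid_cvg v :
  (inner_trapezoid m v)%:E @[m --> \oo] --> (\1_(`]s, t[%classic : set R) v)%:E.
Proof.
apply: cvg_near_cst.
rewrite indicE mem_setE in_itv/=.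
case: (boolP (s < v < t)) => [/andP[sv vt]|h]; last first.
  by apply: nearW => m; rewrite inner_trapezoid_out.
have d1 : 0 < v - s by rewrite subr_gt0.
have d2 : 0 < t - v by rewrite subr_gt0.
near=> m; congr EFin; apply/eqP; rewrite eq_le inner_trapezoid_le1/=.
rewrite /inner_trapezoid le_max; apply/orP; right; rewrite !le_min lexx/=.
apply/andP; split; rewrite -ler_pdivrMr// div1r ltW//;
  (apply: (@lt_trans _ _ m%:R); last by rewrite ltr_nat);
  near: m; exact: nbhs_infty_gtr.
Unshelve. all: by end_near. Qed.

Definition inner_test m : test_fun R :=
  exist _ (inner_trapezoid m) (conj (@inner_trapezoid_continuous m)
    (supported_compact (inner_trapezoid_supported m))).

Definition open_incr (r : radon R) : R := fine (r `]s, t[%classic).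

Let ropen_fin (r : radon R) : (r `]s, t[%classic) \is a fin_num.
Proof.
rewrite ge0_fin_numE//; apply: le_lt_trans (radon_itv_lt r s t).
apply: le_measure; rewrite ?inE//.
by apply: subset_itvl; rewrite bnd_simp.
Qed.

Let itv_integrable (r : radon R) : (radon_measure r).-integrable setT
  (EFin \o (\1_(`]s, t[%classic : set R) : R -> R)).
Proof.
apply/integrableP; split; first exact/measurable_EFinP/measurable_indic.
under eq_integral do rewrite /= ger0_norm//.
by rewrite integral_indic// setIT -ge0_fin_numE// ropen_fin.
Qed.

Lemma inner_test_ge0 m r : 0 <= radon_eval (inner_test m) r.
Proof. by apply: Rintegral_ge0 => v _; exact: inner_trapezoid_ge0. Qed.

Lemma inner_test_cvg r : radon_eval (inner_test m) r @[m --> \oo] --> open_incr r.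
Proof.
rewrite /open_incr /radon_eval /=.
have [] := @dominated_convergence _ _ _ (radon_measure r) setT measurableT
  (fun m x => (inner_trapezoid m x)%:E) (fun x => (\1_(`]s, t[%classic : set R) x)%:E)
  (fun x => (\1_(`]s, t[%classic : set R) x)%:E).
- by move=> m; apply/measurable_EFinP; exact: continuous_measurable_fun.
- by apply/measurable_EFinP; exact: measurable_indic.
- by apply: aeW => v _; exact: inner_trapezoid_cvg.
- exact: itv_integrable.
- apply: aeW => v m _; rewrite lee_fin ger0_norm// indicE mem_setE in_itv/=.
  by case: (boolP (s < v < t)) => [_|/inner_trapezoid_out ->].
- move=> _ _; rewrite integral_indic// setIT => h.
  by apply: fine_cvg; rewrite fineK.
Qed.

Lemma inner_test_le m r : radon_eval (inner_test m) r <= incr s t r.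
Proof.
apply: (@le_trans _ _ (\int[radon_measure r]_v \1_(`]s, t[%classic : set R) v)).
  apply: le_Rintegral => //.
  - exact: (supported_integrable r (@inner_trapezoid_continuous m)
      (@inner_trapezoid_supported m)).
  - move=> v _; rewrite indicE mem_setE in_itv/=.
    by case: (boolP (s < v < t)) => [_|/inner_trapezoid_out ->].
rewrite /Rintegral integral_indic// setIT -lee_fin fineK// -incrE.
apply: le_measure; rewrite ?inE//.
by apply: subset_itvl; rewrite bnd_simp.
Qed.

(** The open interval misses only an atom at [t], whose mass is at most that of ]q, t]. *)
Lemma incr_le_open (q : R) r : s <= t -> q < t -> incr s t r <= open_incr r + incr q t r.
Proof.
move=> st qt; rewrite -lee_fin EFinD -!incrE /open_incr fineK//.
apply: le_trans (measureU2 _ _ _) => //.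
apply: le_measure; rewrite ?inE//; first exact: measurableU.
move=> v /=; rewrite !in_itv/= => /andP[sv]; rewrite le_eqVlt => /predU1P[->|vt].
  by right; rewrite qt eqxx.
by left; rewrite sv.
Qed.

End inner_trapezoid.

Lemma scaledE (R : realType) N k : (0 < k <= N)%N ->
  val (scaled R N k) = (k%:R - 1) / N%:R.
Proof.
move=> /andP[k0 kN]; rewrite /scaled insubdK// inE /= in_itv/=.
have N0 : 0 < N%:R :> R by rewrite ltr0n (leq_trans k0).
rewrite divr_ge0 ?subr_ge0 ?ler1n//= ltr_pdivrMr// mul1r ltrBlDr.
by rewrite natr1 ltr_nat ltnS.
Qed.

Lemma val_I01 (R : realType) (z : I01 R) : 0 <= val z < 1.
Proof. by have := valP z; rewrite inE/= in_itv. Qed.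

Lemma lt_add3 (R : realFieldType) (a b c d i k e : R) : a <= b ->
  - (e / 3) < c - b -> - (e / 3) < d - c -> d <= i + k -> k <= e / 3 ->
  a < i + e.
Proof. by move=> *; lra. Qed.

Lemma dist_lt_complement (R : realFieldType) (i a c d e : R) :
  a < i + e / 2 -> d - a < c - i + e / 2 -> `|c - d| <= e / 2 -> `|i - a| < e.
Proof.
by rewrite ler_norml ltr_norml => ? ? /andP[? ?]; apply/andP; split; lra.
Qed.

(** * Averages over the initial configuration *)

Section deterministic_limits.
Context (R : realType).
Local Notation T := (radon R * I01 R)%type.
Variables (rho : forall N : nat, 'I_N -> radon R) (x : forall N, {perm 'I_N})
  (mu0 : probability (borel T) R).
Arguments rho : clear implicits.
Arguments x : clear implicits.

Local Notation config N := (configuration (rho N) (fun i => (x N i).+1)).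
Let z0 N i : T := (rho N i, scaled R N (x N i).+1).

Hypothesis mu0_cvg : weak_cvg (fun N => config N) mu0.

Let mu0_fin : (mu0 setT < +oo)%E.
Proof. by rewrite probability_setT ltry. Qed.

Lemma start_val N (i : 'I_N) : val (z0 i).2 = (x N i)%:R / N%:R.
Proof. by rewrite scaledE ?ltn_ord// -addn1 natrD addrK. Qed.

Definition average N (h : T -> R) : R := N%:R^-1 * \sum_(i < N) h (z0 i).

Lemma le_average N (h g : T -> R) : (forall p, h p <= g p) ->
  average N h <= average N g.
Proof. by move=> hg; rewrite ler_wpM2l ?invr_ge0// ler_sum. Qed.

Lemma averageB N (h g : T -> R) :
  average N (fun p => h p - g p) = average N h - average N g.
Proof. by rewrite /average sumrB mulrBr. Qed.

Lemma averageZ N (h : T -> R) (c : R) :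
  average N (fun p => c * h p) = c * average N h.
Proof. by rewrite /average -mulr_sumr mulrCA. Qed.

Lemma average_cvg (h : T -> R) (C : R) : continuous h -> (forall p, `|h p| <= C) ->
  average N h @[N --> \oo] --> \int[mu0]_p h p.
Proof.
move=> ch hC; have bh : bounded_fun h.
  by exists C; split; [exact: num_real|move=> y Cy p _; exact: le_trans (hC p) (ltW Cy)].
have := mu0_cvg ch bh.
by under eq_fun do rewrite (Rintegral_empirical _ (continuous_measurable_borel ch) hC).
Qed.

(** The initial positions are 0, 1/N, ..., (N-1)/N in some order, so the count is explicit up to one
    item whatever the permutation. *)
Let count_bounds N (z : R) : (0 < N)%N -> 0 <= z <= 1 ->
  `|average N (fun p => (z <= val p.2)%R%:R) - (1 - z)| <= N%:R^-1.
Proof.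
move=> N0 /andP[z0' z1].
have NR : 0 < N%:R :> R by rewrite ltr0n.
pose u := Num.truncn (z * N%:R).
have uz : u%:R <= z * N%:R by have /andP[] := truncn_itv (mulr_ge0 z0' (ltW NR)).
have zu : z * N%:R < u.+1%:R by rewrite truncnS_gt.
have uN : (u <= N)%N.
  by rewrite -(ler_nat R) (le_trans uz)// ler_piMl// ltW.
have cardge m : (m <= N)%N -> \sum_(i < N) (m <= x N i)%N%:R = N%:R - m%:R :> R.
  move=> mN; rewrite -[X in _ - X%:R](card_ord_lt mN).
  have -> : N%:R = \sum_(i < N) 1 :> R by rewrite sumr_const card_ord.
  rewrite -(card_preimset [set j : 'I_N | (j < m)%N]%SET (@perm_inj _ (x N))).
  rewrite -sum1_card natr_sum [X in _ = _ - X]big_mkcond/= -sumrB.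
  apply: eq_bigr => i _; rewrite !inE ltnNge.
  by case: (m <= _)%N; rewrite /= ?subr0 ?subrr.
have le1 : N%:R - u.+1%:R <= \sum_(i < N) (z <= val (z0 i).2)%R%:R :> R.
  have [uN'|Nu] := leqP u.+1 N; last first.
    by rewrite (@le_trans _ _ 0)// ?sumr_ge0// subr_le0 ler_nat ltnW.
  rewrite -cardge//; apply: ler_sum => i _; rewrite ler_nat.
  case: (boolP (u.+1 <= _)%N) => //= ui; rewrite start_val ler_pdivlMr//.
  by rewrite (_ : (z * _ <= _) = true)// ltW// (lt_le_trans zu)// ler_nat.
have le2 : \sum_(i < N) (z <= val (z0 i).2)%R%:R <= N%:R - u%:R :> R.
  rewrite -cardge//; apply: ler_sum => i _; rewrite ler_nat.
  rewrite start_val ler_pdivlMr//.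
  case: (boolP (z * _ <= _)) => //= zi.
  by rewrite (_ : (u <= _)%N = true)// -ltnS -(ltr_nat R) -natr1; lra.
rewrite /average -(ler_pM2l NR) divff ?gt_eqF// -{1}(gtr0_norm NR) -normrM.
rewrite mulrBr mulrA divff ?gt_eqF// mul1r.
by rewrite ler_norml -natr1 in le1 *; apply/andP; split; nra.
Qed.

Lemma count_cvg (z : R) : 0 <= z <= 1 ->
  average N (fun p => (z <= val p.2)%R%:R) @[N --> \oo] --> 1 - z.
Proof.
move=> z01; apply/cvgrPdist_le => e e0.
near=> N; rewrite distrC; apply: le_trans (count_bounds _ z01) _.
  by near: N; exact: nbhs_infty_gt.
rewrite -[leRHS]invrK lef_pV2 ?posrE ?invr_gt0 ?ltr0n.
- by near: N; exact: nbhs_infty_ger.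
- by near: N; exact: nbhs_infty_gt.
- by [].
Unshelve. all: by end_near. Qed.

Variable t : R.
Hypothesis t_gt0 : 0 < t.
Hypothesis lambda_cvg : forall s : R, 0 <= s <= t -> weak_cvg
  (fun N => lambda (Lambda (config N)) s t) (lambda (Lambda mu0) s t).

Let msurv s : measurable_fun setT ((fun p : T => survival s t p.1) : borel T -> R).
Proof.
exact: (measurableT_comp (@measurable_survival R s t) (@borel_fst_measurable R)).
Qed.

Let surv_norm s r : `|survival s t r| <= 1.
Proof. by rewrite ger0_norm ?survival_ge0// survival_le1. Qed.

Lemma survival_average_cvg1 s : 0 <= s <= t ->
  average N (fun p => survival s t p.1) @[N --> \oo] -->
  \int[mu0]_p survival s t p.1.
Proof.
move=> st.
(* Truncating at 0 makes the exponential bounded on the whole line and changes nothing at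
   increments, which are nonnegative. *)
pose f (v : R) := expR (- Num.max 0 v).
have cf : continuous f.
  move=> v; apply: (@continuous_comp R R R (fun v => - Num.max 0 v) expR v);
    last exact: continuous_expR.
  apply: cvgN; apply: (@continuous_max _ R (cst 0) id v).
    exact: cst_continuous.
  exact: cvg_id.
have f0 v : 0 <= f v by exact: expR_ge0.
have f1 v : f v <= 1 by rewrite expR_le1 oppr_le0 le_max lexx.
have fs r : f (incr s t r) = survival s t r.
  by rewrite /f max_r// incr_ge0.
have bf : bounded_fun f.
  exists 1; split; [exact: num_real|move=> y y1 v _ /=].
  by rewrite ger0_norm// (le_trans (f1 v))// ltW.
have := lambda_cvg st cf bf.
rewrite Rintegral_lambda//.
under eq_fun do rewrite Rintegral_lambda//.
under [X in _ --> X -> _]eq_Rintegral do rewrite fs.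
rewrite Rintegral_Lambda; [|exact: measurable_survival|by move=> r; exact: survival_ge0].
under eq_fun => N.
  under eq_Rintegral do rewrite fs.
  rewrite Rintegral_Lambda; [|exact: measurable_survival|by move=> r; exact: survival_ge0].
  rewrite (Rintegral_empirical _ (msurv s) (fun p => surv_norm s p.1)).
  over.
by [].
Qed.

(* Mass accumulating at the endpoint [t] is excluded by this hypothesis. *)
Hypothesis no_atom : forall e, 0 < e -> exists q, q < t /\
  1 - \int[mu0]_p survival q t p.1 <= e.

(** Inner test functions underestimate the increments, so they overestimate the averages, and they
    are covered by the convergence of the configurations. In the limit they exceed the target only
    through the mass at [t]. *)
Let survival_upper s (h : T -> R) (C : R) : 0 <= s <= t -> continuous h ->
  (forall p, 0 <= h p <= C) -> forall e, 0 < e ->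
  \forall N \near \oo, average N (fun p => h p * survival s t p.1) <
    \int[mu0]_p (h p * survival s t p.1) + e.
Proof.
move=> /andP[s0 st] ch hC e e0.
have h0 p : 0 <= h p by case/andP: (hC p).
have hC' p : `|h p| <= C by rewrite ger0_norm//; case/andP: (hC p).
have mh : measurable_fun setT (h : borel T -> R) by exact: continuous_measurable_borel.
have C0 : 0 <= C by rewrite (le_trans _ (hC' (point, point))).
have C1 : 0 < C + 1 by rewrite ltr_wpDl.
have e3 : 0 < e / 3 by rewrite divr_gt0.
(* Passing from ]s, t[ to ]s, t] will cost at most [C] times the loss on ]q, t], hence at most
   [e / 3]; [C + 1] avoids a division by zero. *)
have [q [qt hq]] := no_atom (divr_gt0 e3 C1).
pose L m (p : T) := h p * expR (- radon_eval (inner_test s t m) p.1).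
pose Lim (p : T) := h p * expR (- open_incr s t p.1).
have Lb m p : `|L m p| <= C.
  rewrite /L normrM (ger0_norm (expR_ge0 _)).
  apply: le_trans (hC' p); rewrite ler_piMr// expR_le1 oppr_le0.
  exact: inner_test_ge0.
have cL m : continuous (L m).
  move=> p; apply: cvgM; first exact: ch.
  apply: (@continuous_comp T R R (fun p => - radon_eval (inner_test s t m) p.1) expR).
    apply: cvgN.
    apply: (@continuous_comp T (radon R) R fst (radon_eval (inner_test s t m))).
      exact: fst_continuous.
    exact: radon_eval_continuous.
  exact: continuous_expR.
have mL m : measurable_fun setT (L m : borel T -> R) by exact: continuous_measurable_borel.
have Lcvg p : L m p @[m --> \oo] --> Lim p.
  apply: cvgM; first exact: cvg_cst.
  apply: continuous_cvg; first exact: continuous_expR.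
  by apply: cvgN; exact: inner_test_cvg.
have mLim : measurable_fun setT (Lim : borel T -> R).
  by apply: (measurable_fun_cvg mL) => p _; exact: Lcvg.
have Limb p : `|Lim p| <= C.
  rewrite /Lim normrM (ger0_norm (expR_ge0 _)).
  by apply: le_trans (hC' p); rewrite ler_piMr// expR_le1 oppr_le0 fine_ge0.
have intL : \int[mu0]_p L m p @[m --> \oo] --> \int[mu0]_p Lim p.
  by apply: (Rintegral_bounded_cvg mu0_fin (C := C)) => //; exact: aeW.
have [m _ hm] := cvg_seq_near intL e3.
have {hm} := hm m (leqnn m); rewrite ltr_norml => /andP[hm _].
have := cvg_seq_near (average_cvg (cL m) (Lb m)) e3.
apply: filterS => N; rewrite ltr_norml => /andP[hN _].
have h1 : average N (fun p => h p * survival s t p.1) <= average N (L m).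
  apply: le_average => p; rewrite ler_wpM2l// ler_expR lerN2.
  exact: inner_test_le.
have h2 : \int[mu0]_p Lim p <=
    \int[mu0]_p (h p * survival s t p.1 + C * (1 - survival q t p.1)).
  apply: (Rintegral_le_bounded mu0_fin mLim _ Limb (D := C + C)) => //.
  - apply: measurable_funD; first by apply: measurable_funM => //; exact: msurv.
    apply: measurable_funM => //; apply: measurable_funB => //; exact: msurv.
  - move=> p; rewrite (le_trans (ler_normD _ _))// lerD//.
      by rewrite normrM (le_trans _ (hC' p))// ler_piMr// surv_norm.
    rewrite normrM (ger0_norm C0) ler_piMr// ger0_norm ?subr_ge0 ?survival_le1//.
    by rewrite gerBl survival_ge0.
  - move=> p; rewrite -lerBlDl /Lim -mulrBr.
    (* With b the mass of ]q, t], exp(-a) - exp(-(a + b)) = exp(-a) (1 - exp(-b)) <= 1 - exp(-b). *)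
    have E : expR (- open_incr s t p.1) - survival s t p.1 <= 1 - survival q t p.1.
      set a := open_incr s t p.1.
      have a0 : 0 <= a by exact: fine_ge0.
      have := incr_le_open p.1 st qt; rewrite -/a => ia.
      apply: (@le_trans _ _ (expR (- a) - expR (- (a + incr q t p.1)))).
        by rewrite lerB// ler_expR lerN2.
      rewrite opprD expRD -[X in X - _]mulr1 -mulrBr ler_piMl//.
        by rewrite subr_ge0 survival_le1.
      by rewrite expR_le1 oppr_le0.
    apply: (@le_trans _ _ (h p * (1 - survival q t p.1))); first exact: ler_wpM2l.
    by rewrite ler_wpM2r ?subr_ge0 ?survival_le1//; case/andP: (hC p).
have i1 : mu0.-integrable setT (EFin \o (fun p : borel T => h p * survival s t p.1)).
  apply: (integrable_bounded mu0_fin (C := C)).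
    by apply: measurable_funM => //; exact: msurv.
  by move=> p; rewrite normrM (le_trans _ (hC' p))// ler_piMr// surv_norm.
have i2 : mu0.-integrable setT (EFin \o (fun p : borel T => survival q t p.1)).
  by apply: (integrable_bounded mu0_fin (C := 1)); [exact: msurv|move=> p; exact: surv_norm].
have i3 : mu0.-integrable setT (EFin \o (cst 1 : borel T -> R)).
  by apply: (integrable_bounded mu0_fin (C := 1)) => // p; rewrite normr1.
have i4 : mu0.-integrable setT (EFin \o (fun p : borel T => 1 - survival q t p.1)).
  exact: (@integrableB _ _ _ mu0 setT measurableT _ _ i3 i2).
have int1 : \int[mu0]_(p in setT) (1 : R) = 1.
  have := Rintegral_cst mu0 measurableT 1; rewrite mul1r => ->.
  exact: (congr1 fine (@probability_setT _ _ _ mu0)).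
move: h2; rewrite RintegralD//; last exact: (integrableZl measurableT C i4).
rewrite RintegralZl// RintegralB// int1 => h2.
have h3 : C * (1 - \int[mu0]_p survival q t p.1) <= e / 3.
  apply: (@le_trans _ _ (C * (e / 3 / (C + 1)))); first exact: ler_wpM2l.
  rewrite mulrA ler_pdivrMr// mulrC ler_wpM2l// ?ltW//.
  by rewrite ltrDl.
exact: lt_add3 h1 hN hm h2 h3.
Qed.

(** The averages weighted by [h] and [C - h] sum to [C] times the unweighted one, which converges;
    an upper bound on the second is therefore a lower bound on the first. *)
Lemma survival_average_cvg s (h : T -> R) (C : R) : 0 <= s <= t ->
  continuous h -> (forall p, 0 <= h p <= C) ->
  average N (fun p => h p * survival s t p.1) @[N --> \oo] -->
  \int[mu0]_p (h p * survival s t p.1).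
Proof.
move=> st ch hC.
have hC' p : `|h p| <= C by have /andP[h0 ?] := hC p; rewrite ger0_norm.
have C0 : 0 <= C by rewrite (le_trans _ (hC' (point, point))).
have mh : measurable_fun setT (h : borel T -> R) by exact: continuous_measurable_borel.
have i1 : mu0.-integrable setT (EFin \o (fun p : borel T => h p * survival s t p.1)).
  apply: (integrable_bounded mu0_fin (C := C)).
    by apply: measurable_funM => //; exact: msurv.
  by move=> p; rewrite normrM (le_trans _ (hC' p))// ler_piMr// surv_norm.
have i2 : mu0.-integrable setT (EFin \o (fun p : borel T => survival s t p.1)).
  by apply: (integrable_bounded mu0_fin (C := 1)); [exact: msurv|move=> p; exact: surv_norm].
have E : \int[mu0]_p ((C - h p) * survival s t p.1) =
    C * \int[mu0]_p survival s t p.1 - \int[mu0]_p (h p * survival s t p.1).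
  rewrite -RintegralZl// -RintegralB//; last exact: (integrableZl measurableT C i2).
  by apply: eq_Rintegral => p _; rewrite mulrBl.
apply/cvgrPdist_lt => e e0.
have e20 : 0 < e / 2 by rewrite divr_gt0.
have e3 : 0 < e / 2 / (C + 1) by rewrite divr_gt0// ltr_wpDl.
have cC : continuous (fun p => C - h p).
  by move=> p; apply: cvgB; [exact: cvg_cst|exact: ch].
have hCC p : 0 <= C - h p <= C by have := hC p; lra.
near=> N.
have a1 : average N (fun p => h p * survival s t p.1) <
    \int[mu0]_p (h p * survival s t p.1) + e / 2.
  by near: N; exact: (survival_upper st ch hC e20).
have a2 : average N (fun p => (C - h p) * survival s t p.1) <
    \int[mu0]_p ((C - h p) * survival s t p.1) + e / 2.
  by near: N; exact: (survival_upper st cC hCC e20).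
have a3 : `|\int[mu0]_p survival s t p.1 - average N (fun p => survival s t p.1)|
    < e / 2 / (C + 1).
  by near: N; exact: (cvg_seq_near (survival_average_cvg1 st) e3).
have {}a3 : `|C * (\int[mu0]_p survival s t p.1 - average N (fun p => survival s t p.1))|
    <= e / 2.
  rewrite normrM (ger0_norm C0).
  apply: (@le_trans _ _ (C * (e / 2 / (C + 1)))); first by rewrite ler_wpM2l// ltW.
  by rewrite mulrA ler_pdivrMr ?ltr_wpDl// mulrC ler_wpM2l ?ltW// ltrDl.
move: a2 a3; rewrite E.
have -> : average N (fun p => (C - h p) * survival s t p.1) =
    C * average N (fun p => survival s t p.1) - average N (fun p => h p * survival s t p.1).
  rewrite -averageZ -averageB; congr (_ * _); apply: eq_bigr => i _.
  by rewrite mulrBl.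
by rewrite mulrBr => a2 a3; exact: dist_lt_complement a1 a2 a3.
Unshelve. all: by end_near. Qed.

End deterministic_limits.

Lemma dist_lt3 (R : realFieldType) (a b c d e : R) : `|a - b| < e / 3 ->
  `|b - c| < e / 3 -> `|c - d| <= e / 3 -> `|a - d| < e.
Proof.
rewrite !ltr_norml ler_norml => /andP[? ?] /andP[? ?] /andP[? ?].
by apply/andP; split; lra.
Qed.

(** * Discontinuous cut-offs in the position *)

Section level_limits.
Context (R : realType).
Local Notation T := (radon R * I01 R)%type.
Variables (rho : forall N : nat, 'I_N -> radon R) (x : forall N, {perm 'I_N})
  (mu0 : probability (borel T) R).
Arguments rho : clear implicits.
Arguments x : clear implicits.
Local Notation config N := (configuration (rho N) (fun i => (x N i).+1)).
Local Notation average := (average rho x).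
Variable t : R.
Hypothesis mu0_cvg : weak_cvg (fun N => config N) mu0.
Hypothesis lambda_cvg : forall s : R, 0 <= s <= t -> weak_cvg
  (fun N => lambda (Lambda (config N)) s t) (lambda (Lambda mu0) s t).
Hypothesis no_atom : forall e, 0 < e -> exists q, q < t /\
  1 - \int[mu0]_p survival q t p.1 <= e.
Hypothesis t_gt0 : 0 < t.

Let mu0_fin : (mu0 setT < +oo)%E.
Proof. by rewrite probability_setT ltry. Qed.

Let ramp (z : R) (m : nat) (v : R) : R :=
  Num.max 0 (Num.min 1 (1 + m.+1%:R * (v - z))).

Let ramp_continuous z m : continuous (ramp z m).
Proof.
move=> v; apply: (@continuous_max _ R (cst 0) _ v); first exact: cst_continuous.
apply: (@continuous_min _ R (cst 1) _ v); first exact: cst_continuous.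
apply: cvgD; first exact: cvg_cst.
by apply: cvgM; [exact: cvg_cst|apply: cvgB; [exact: cvg_id|exact: cvg_cst]].
Qed.

Let ramp_ge0 z m v : 0 <= ramp z m v.
Proof. by rewrite /ramp le_max lexx. Qed.

Let ramp_le1 z m v : ramp z m v <= 1.
Proof. by rewrite /ramp ge_max ler01 ge_min lexx. Qed.

Let ramp_ge z m v : (z <= v)%R%:R <= ramp z m v.
Proof.
case: (leP z v) => //= zv; rewrite /ramp le_max; apply/orP; right.
by rewrite le_min lexx lerDl mulr_ge0// subr_ge0.
Qed.

Let ramp_le z m v : ramp z m v <= (z - m.+1%:R^-1 <= v)%R%:R.
Proof.
case: (leP _ v) => //= zv; rewrite /ramp ge_max lexx/= ge_min; apply/orP; right.
have m0 : 0 < m.+1%:R :> R by [].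
have : m.+1%:R * (v - z) <= -1 by rewrite mulrC -ler_pdivlMr// mulN1r lerBlDr addrC ltW.
by lra.
Qed.

Let ramp_cvg z v : ramp z m v @[m --> \oo] --> ((z <= v)%R%:R : R).
Proof.
apply: cvg_near_cst; case: (leP z v) => zv.
  by apply: nearW => m; apply/eqP; rewrite eq_le ramp_le1/= (le_trans _ (ramp_ge z m v))// zv.
have d : 0 < z - v by rewrite subr_gt0.
near=> m; apply/eqP; rewrite eq_le ramp_ge0 andbT.
apply: le_trans (ramp_le z m v) _.
rewrite lerBlDr -lerBlDl.
rewrite (_ : (z - v <= m.+1%:R^-1) = false)//.
apply/negbTE; rewrite -ltNge -[ltRHS]invrK ltf_pV2 ?posrE ?invr_gt0//.
apply: (@lt_trans _ _ m%:R); last by rewrite ltr_nat.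
by near: m; exact: nbhs_infty_gtr.
Unshelve. all: by end_near. Qed.

Lemma measurable_indicator_level z :
  measurable_fun setT ((fun p : T => (z <= val p.2)%R%:R) : borel T -> R).
Proof.
apply: (@measurable_fun_cvg _ (borel T) R setT
  (fun m (p : borel T) => ramp z m (val p.2))) => [m|p _]; last exact: ramp_cvg.
apply: (@continuous_measurable_borel R T) => p.
apply: (@continuous_comp T R R (fun p => val p.2) (ramp z m)).
  exact: (@coord_continuous R 0).
exact: ramp_continuous.
Qed.

(** A ramp differs from the indicator only on positions in a slab of width 1/(m+1) below [z], and
    the share of items in such a slab is known from [count_cvg]. *)
Lemma level_average_cvg s z (h : T -> R) (C : R) : 0 <= s <= t -> 0 <= z <= 1 ->
  continuous h -> (forall p, 0 <= h p <= C) ->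
  average N (fun p => (z <= val p.2)%R%:R * (h p * survival s t p.1))
    @[N --> \oo] -->
  \int[mu0]_p ((z <= val p.2)%R%:R * (h p * survival s t p.1)).
Proof.
move=> st /andP[z0 z1] ch hC.
have h0 p : 0 <= h p by case/andP: (hC p).
have C0 : 0 <= C by have /andP[a b] := hC (point, point); exact: le_trans b.
have C1 : 0 < C + 1 by rewrite ltr_wpDl.
have mh : measurable_fun setT (h : borel T -> R) by exact: continuous_measurable_borel.
have ms : measurable_fun setT ((fun p : T => survival s t p.1) : borel T -> R).
  exact: (measurableT_comp (@measurable_survival R s t) (@borel_fst_measurable R)).
pose g p := h p * survival s t p.1.
have g0 p : 0 <= g p by rewrite mulr_ge0// survival_ge0.
have gC p : g p <= C.
  by apply: (@le_trans _ _ (h p)); [rewrite ler_piMr// survival_le1|case/andP: (hC p)].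
have crp m : continuous (fun p : T => ramp z m (val p.2)).
  move=> p; apply: (@continuous_comp T R R (fun p => val p.2) (ramp z m)).
    exact: (@coord_continuous R 0).
  exact: ramp_continuous.
have mr m : measurable_fun setT ((fun p : T => ramp z m (val p.2)) : borel T -> R).
  exact: (@continuous_measurable_borel R T _ (crp m)).
have mg : measurable_fun setT (g : borel T -> R) by exact: measurable_funM.
have lim_int : \int[mu0]_p (ramp z m (val p.2) * g p) @[m --> \oo] -->
    \int[mu0]_p ((z <= val p.2)%R%:R * g p).
  apply: (Rintegral_bounded_cvg mu0_fin (C := C)).
  - by move=> m; exact: measurable_funM.
  - by apply: measurable_funM => //; exact: measurable_indicator_level.
  - move=> m p; rewrite (ger0_norm (mulr_ge0 (ramp_ge0 z m _) (g0 p))).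
    by apply: le_trans (gC p); rewrite ler_piMl ?ramp_le1.
  - by apply: aeW => p; apply: cvgM; [exact: ramp_cvg|exact: cvg_cst].
have lim_ramp m : average N (fun p => ramp z m (val p.2) * g p) @[N --> \oo] -->
    \int[mu0]_p (ramp z m (val p.2) * g p).
  have := @survival_average_cvg _ rho x mu0 mu0_cvg t lambda_cvg no_atom s
    (fun p => ramp z m (val p.2) * h p) C st.
  have -> : \int[mu0]_p (ramp z m (val p.2) * h p * survival s t p.1) =
      \int[mu0]_p (ramp z m (val p.2) * g p).
    by apply: eq_Rintegral => p _; rewrite /g mulrA.
  have Ea N : average N (fun p => ramp z m (val p.2) * h p * survival s t p.1) =
      average N (fun p => ramp z m (val p.2) * g p).
    by congr (_ * _); apply: eq_bigr => i _; rewrite /g mulrA.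
  rewrite (funext Ea).
  apply; first by move=> p; apply: cvgM; [exact: crp|exact: ch].
  move=> p; rewrite mulr_ge0 ?ramp_ge0//=; apply: (@le_trans _ _ (h p)).
    by rewrite ler_piMl ?ramp_le1.
  by case/andP: (hC p).
apply/cvgrPdist_lt => e e0.
have e3 : 0 < e / 3 by rewrite divr_gt0.
have e4 : 0 < e / 3 / (C + 1) by rewrite divr_gt0.
have [m [hm1 hm2]] : exists m,
   `|\int[mu0]_p ((z <= val p.2)%R%:R * g p) - \int[mu0]_p (ramp z m (val p.2) * g p)| < e / 3
   /\ m.+1%:R^-1 < e / 3 / (C + 1).
  have [a _ ha] := cvg_seq_near lim_int e3.
  pose b := Num.truncn (e / 3 / (C + 1))^-1.
  exists (maxn a b); split; first by apply: ha => /=; exact: leq_maxl.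
  rewrite -[ltRHS]invrK ltf_pV2 ?posrE ?invr_gt0//.
  apply: (@lt_le_trans _ _ b.+1%:R); first exact: truncnS_gt.
  by rewrite ler_nat ltnS leq_maxr.
(* [count_cvg] requires a level in [0, 1]; since positions are nonnegative, the truncation does not
   change the slab. *)
pose z' := Num.max 0 (z - m.+1%:R^-1).
have m0 : 0 < m.+1%:R^-1 :> R by rewrite invr_gt0.
have z'01 : 0 <= z' <= 1.
  by rewrite le_max lexx/= ge_max ler01/= lerBlDr (le_trans z1)// lerDl ltW.
have z01 : 0 <= z <= 1 by rewrite z0.
have zz' : z - z' <= m.+1%:R^-1.
  by rewrite lerBlDr -lerBlDl le_max lexx orbT.
have cnt : average N (fun p => (z' <= val p.2)%R%:R) - average N (fun p => (z <= val p.2)%R%:R)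
   @[N --> \oo] --> (1 - z') - (1 - z).
  by apply: cvgB; [exact: (@count_cvg _ rho x)|exact: (@count_cvg _ rho x)].
near=> N.
have a1 : `|\int[mu0]_p (ramp z m (val p.2) * g p) -
   average N (fun p => ramp z m (val p.2) * g p)| < e / 3.
  by near: N; exact: (cvg_seq_near (lim_ramp m) e3).
have a2 : average N (fun p => (z' <= val p.2)%R%:R) -
    average N (fun p => (z <= val p.2)%R%:R) <= e / 3 / (C + 1).
  near: N.
  have d : 0 < e / 3 / (C + 1) - (z - z') by rewrite subr_gt0 (le_lt_trans zz').
  apply: filterS (cvg_seq_near cnt d) => N.
  have -> : 1 - z' - (1 - z) = z - z' by ring.
  by rewrite distrC => /ltr_normlW; rewrite ltrD2r => /ltW.
have a3 : average N (fun p => (z <= val p.2)%R%:R * g p) <=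
    average N (fun p => ramp z m (val p.2) * g p).
  by apply: le_average => p; rewrite ler_wpM2r.
have a4 : average N (fun p => ramp z m (val p.2) * g p) -
    average N (fun p => (z <= val p.2)%R%:R * g p) <= e / 3.
  rewrite -averageB.
  apply: (@le_trans _ _ (average N (fun p => C * ((z' <= val p.2)%R%:R - (z <= val p.2)%R%:R)))).
    apply: le_average => p; rewrite -mulrBl mulrC.
    have rz : ramp z m (val p.2) <= (z' <= val p.2)%R%:R.
      apply: le_trans (ramp_le z m _) _; rewrite ler_nat.
      have /andP[v0 _] := val_I01 p.2.
      by case: (boolP (_ <= _)) => //= hz; rewrite /z' ge_max v0 hz.
    apply: (@le_trans _ _ (g p * ((z' <= val p.2)%R%:R - (z <= val p.2)%R%:R))).
      by rewrite ler_wpM2l// lerB.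
    by rewrite ler_wpM2r// subr_ge0 (le_trans (ramp_ge z m _)).
  rewrite averageZ averageB.
  apply: (@le_trans _ _ (C * (e / 3 / (C + 1)))); first by rewrite ler_wpM2l.
  by rewrite mulrA ler_pdivrMr// mulrC ler_wpM2l ?ltW// ltrDl.
apply: dist_lt3 hm1 a1 _; rewrite ger0_norm ?subr_ge0//.
Unshelve. all: by end_near. Qed.

(** The limit inherits a uniform second marginal from the equally spaced initial positions. At
    [s = t] the survival factor is 1, so the weighted limit reduces to the count. *)
Lemma level_mass z : 0 <= z <= 1 -> \int[mu0]_p (z <= val p.2)%R%:R = 1 - z.
Proof.
move=> z01.
have tt : 0 <= t <= t by rewrite lexx ltW.
have h1 : forall p : T, 0 <= (cst 1 : T -> R) p <= 1 by move=> p; rewrite /= ler01 lexx.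
have := @level_average_cvg t z (cst 1) 1 tt z01 (@cst_continuous _ _ _) h1.
have -> : \int[mu0]_p ((z <= val p.2)%R%:R * (cst 1 p * survival t t p.1)) =
    \int[mu0]_p (z <= val p.2)%R%:R.
  by apply: eq_Rintegral => p _; rewrite survival_id !mulr1.
have Ea N : average N (fun p => (z <= val p.2)%R%:R * (cst 1 p * survival t t p.1)) =
    average N (fun p => (z <= val p.2)%R%:R).
  by congr (_ * _); apply: eq_bigr => i _; rewrite survival_id !mulr1.
rewrite (funext Ea).
move=> h2; have h3 := @count_cvg _ rho x z z01.
exact: cvg_unique h2 h3.
Qed.

End level_limits.

(** * The limit curves and their inverses *)

Section limit_curves.
Context (R : realType).
Local Notation T := (radon R * I01 R)%type.
Variables (mu0 : probability (borel T) R) (t : R).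
Hypothesis t_gt0 : 0 < t.

Let mu0_fin : (mu0 setT < +oo)%E.
Proof. by rewrite probability_setT ltry. Qed.

(** Limiting share of the items that start at or after [z] and do not jump in ]s, t]; the curves
    [yA], [yB] and [yC] all have the form [1 - weight]. *)
Definition weight (s z : R) : R :=
  \int[mu0]_p ((z <= val p.2)%R%:R * survival s t p.1).

Let surv_norm s r : `|survival s t r| <= 1.
Proof. by rewrite ger0_norm ?survival_ge0// survival_le1. Qed.

Lemma measurable_survival_fst s :
  measurable_fun setT ((fun p : T => survival s t p.1) : borel T -> R).
Proof.
exact: (measurableT_comp (@measurable_survival R s t) (@borel_fst_measurable R)).
Qed.

Lemma measurable_weight s z : measurable_fun setT
  ((fun p : T => (z <= val p.2)%R%:R * survival s t p.1) : borel T -> R).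
Proof.
apply: measurable_funM; first exact: measurable_indicator_level.
exact: measurable_survival_fst.
Qed.

Let weight_norm s z (p : T) : `|(z <= val p.2)%R%:R * survival s t p.1| <= 1.
Proof.
rewrite normrM (le_trans _ (surv_norm s p.1))// ler_piMl//.
by case: (z <= _); rewrite ?normr1 ?normr0.
Qed.

Let weight_integrable s z : mu0.-integrable setT
  (EFin \o (fun p : borel T => (z <= val p.2)%R%:R * survival s t p.1)).
Proof.
exact: (integrable_bounded mu0_fin (@measurable_weight s z) (@weight_norm s z)).
Qed.

Lemma weight0 s : weight s 0 = \int[mu0]_p survival s t p.1.
Proof.
apply: eq_Rintegral => p _.
by have /andP[-> _] := val_I01 p.2; rewrite mul1r.
Qed.

Lemma yAE u : yA mu0 u t = 1 - weight (t - u) 0.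
Proof.
rewrite weight0 /yA Rintegral_Lambda//; exact: measurable_survival.
Qed.

Lemma yBE y : yB mu0 y t = 1 - weight 0 y.
Proof.
rewrite /yB Rintegral_U//; exact: measurable_survival.
Qed.

Lemma yCE : yC mu0 t = 1 - weight 0 0.
Proof.
rewrite weight0 /yC Rintegral_Lambda//; exact: measurable_survival.
Qed.

Lemma weight_ge0 s z : 0 <= weight s z.
Proof. by apply: Rintegral_ge0 => p _; rewrite mulr_ge0// survival_ge0. Qed.

Lemma weight_id : weight t 0 = 1.
Proof.
rewrite weight0.
transitivity (\int[mu0]_(p in setT) (1 : R)).
  by apply: eq_Rintegral => p _; rewrite survival_id.
have := Rintegral_cst mu0 measurableT 1; rewrite mul1r => ->.
exact: (congr1 fine (@probability_setT _ _ _ mu0)).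
Qed.

Lemma weight_mono s s' z z' : s <= s' -> z' <= z -> weight s z <= weight s' z'.
Proof.
move=> ss' zz'; apply: le_Rintegral => // p _.
apply: ler_pM => //; first exact: survival_ge0.
  by rewrite ler_nat; case: (boolP (z <= _)) => // /(le_trans zz') ->.
exact: survival_nd.
Qed.

Lemma yC_ge0 : 0 <= yC mu0 t.
Proof. by rewrite yCE subr_ge0 -weight_id weight_mono// ltW. Qed.

Section t0_facts.
Hypothesis t0_inv : t0_inverse mu0 t.
Implicit Type y : R.

Let t0_mem y : y <= yC mu0 t -> [set s | 0 <= s <= t /\ y <= yA mu0 s t] t.
Proof.
by move=> yC; rewrite /= lexx (ltW t_gt0) yAE subrr -yCE.
Qed.

Let t0_lb y : lbound [set s | 0 <= s <= t /\ y <= yA mu0 s t] 0.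
Proof. by move=> s [/andP[]]. Qed.

Lemma t0_itv y : y <= yC mu0 t -> 0 <= t0 mu0 y t <= t.
Proof.
move=> yC; apply/andP; split.
  by apply: lb_le_inf; [exists t; exact: t0_mem|exact: t0_lb].
by apply: ge_inf; [exists 0; exact: t0_lb|exact: t0_mem].
Qed.

Lemma t0_nd y y' : y <= y' -> y' <= yC mu0 t -> t0 mu0 y t <= t0 mu0 y' t.
Proof.
move=> yy' y'C; apply: lb_le_inf; first by exists t; exact: t0_mem.
move=> s [s0t y's]; apply: ge_inf; first by exists 0; exact: t0_lb.
by split; [exact: s0t|exact: le_trans yy' y's].
Qed.

Lemma t0_weight y : 0 <= y <= yC mu0 t -> weight (t - t0 mu0 y t) 0 = 1 - y.
Proof. by move=> /t0_inv; rewrite yAE; lra. Qed.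

(** Inverting [yA] at a small level y > 0 gives a time at which the loss is exactly y. It differs
    from [t], because an empty interval causes no loss. *)
Lemma t0_inverse_no_atom e : 0 < e -> exists q, q < t /\
  1 - \int[mu0]_p survival q t p.1 <= e.
Proof.
move=> e0; have [yC0|yC0] := leP (yC mu0 t) 0.
  by exists 0; split => //; rewrite -weight0 -yCE (le_trans yC0)// ltW.
pose y := Num.min e (yC mu0 t).
have y0 : 0 < y by rewrite lt_min e0.
have yC' : y <= yC mu0 t by rewrite ge_min lexx orbT.
have y0C : 0 <= y <= yC mu0 t by rewrite ltW.
have ye : y <= e by rewrite ge_min lexx.
have w := t0_weight y0C.
exists (t - t0 mu0 y t); split; last by rewrite -weight0 w; lra.
have /andP[u0 _] := t0_itv yC'.
move: u0; rewrite le_eqVlt => /predU1P[u0|u0]; last by lra.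
by move: w; rewrite -u0 subr0 weight_id; lra.
Qed.

End t0_facts.

Hypothesis level_mass : forall z, 0 <= z <= 1 ->
  \int[mu0]_p (z <= val p.2)%R%:R = 1 - z.

Let level_integrable z : mu0.-integrable setT
  (EFin \o (fun p : borel T => (z <= val p.2)%R%:R : R)).
Proof.
apply: (integrable_bounded mu0_fin (C := 1)); first exact: measurable_indicator_level.
by move=> p; case: (z <= _); rewrite ?normr1 ?normr0.
Qed.

Lemma weight_lipschitz s z z' : 0 <= z -> z <= z' -> z' <= 1 ->
  weight s z - weight s z' <= z' - z.
Proof.
move=> z0 zz' z'1.
have -> : z' - z = (1 - z) - (1 - z') by ring.
rewrite -!level_mass ?z0 ?z'1 ?(le_trans z0) ?(le_trans zz')//.
rewrite /weight -!RintegralB//.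
apply: le_Rintegral => //; last move=> p _.
- exact: (@integrableB _ _ _ mu0 setT measurableT _ _
    (weight_integrable s z) (weight_integrable s z')).
- exact: (@integrableB _ _ _ mu0 setT measurableT _ _
    (level_integrable z) (level_integrable z')).
rewrite -mulrBl ler_piMr ?survival_le1// subr_ge0 ler_nat.
by case: (boolP (z' <= _)) => // /(le_trans zz') ->.
Qed.

(** Survival is positive without a uniform lower bound, so it is replaced by [c n], which tends to 1
    everywhere. If the weights were equal, the integrals of [D * c n] would all vanish, although
    they tend to [z' - z]. *)
Lemma weight_lt s z z' : 0 <= z -> z < z' -> z' <= 1 -> weight s z' < weight s z.
Proof.
move=> z0 zz' z'1; rewrite lt_neqAle weight_mono ?andbT ?(ltW zz')//.
apply/eqP => E.
pose D (p : T) : R := (z <= val p.2)%R%:R - (z' <= val p.2)%R%:R.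
pose c n (p : T) : R := Num.min 1 (n%:R * survival s t p.1).
have D0 p : 0 <= D p.
  rewrite subr_ge0 ler_nat.
  by case: (boolP (z' <= _)) => // /(le_trans (ltW zz')) ->.
have D1 p : D p <= 1.
  by rewrite lerBlDr (@le_trans _ _ 1)// ?lerDl// lern1; case: (_ <= _).
have c0 n p : 0 <= c n p by rewrite le_min ler01 mulr_ge0// survival_ge0.
have c1 n p : c n p <= 1 by rewrite ge_min lexx.
have mD : measurable_fun setT (D : borel T -> R).
  by apply: measurable_funB; exact: measurable_indicator_level.
have mc n : measurable_fun setT (c n : borel T -> R).
  apply: measurable_minr => //; apply: measurable_funM => //.
  exact: measurable_survival_fst.
have iD : \int[mu0]_p D p = z' - z.
  rewrite RintegralB// !level_mass; first by ring.
    by apply/andP; split; lra.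
  by apply/andP; split; lra.
have lim_ : \int[mu0]_p (D p * c n p) @[n --> \oo] --> \int[mu0]_p D p.
  apply: (Rintegral_bounded_cvg mu0_fin (C := 1)) => //.
  - by move=> n; exact: measurable_funM.
  - by move=> n p; rewrite ger0_norm ?mulr_ge0 ?mulr_ile1.
  - apply: aeW => p; rewrite -[X in _ --> X]mulr1.
    apply: cvgM; first exact: cvg_cst.
    apply: cvg_near_cst; near=> n; apply/eqP; rewrite eq_le c1/= le_min lexx/=.
    rewrite -ler_pdivrMr ?survival_gt0// div1r.
    by near: n; exact: nbhs_infty_ger.
have I0 n : \int[mu0]_p (D p * c n p) = 0.
  apply/eqP; rewrite eq_le Rintegral_ge0 ?andbT => [|p _]; last by rewrite mulr_ge0.
  apply: (@le_trans _ _ (\int[mu0]_p (n%:R * (D p * survival s t p.1)))).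
    apply: (Rintegral_le_bounded mu0_fin (C := 1) (D := n%:R)).
    - exact: measurable_funM.
    - apply: measurable_funM => //; apply: measurable_funM => //.
      exact: measurable_survival_fst.
    - by move=> p; rewrite ger0_norm ?mulr_ge0 ?mulr_ile1.
    - move=> p; rewrite ger0_norm; last by rewrite !mulr_ge0 ?survival_ge0.
      by rewrite ler_piMr// mulr_ile1 ?survival_ge0 ?survival_le1.
    - by move=> p; rewrite mulrCA ler_wpM2l// ge_min lexx orbT.
  rewrite (_ : \int[mu0]_p _ = n%:R * (weight s z - weight s z')).
    by rewrite E subrr mulr0.
  rewrite /weight -RintegralB// -RintegralZl//.
    by apply: eq_Rintegral => p _; rewrite /D mulrBl.
  exact: (@integrableB _ _ _ mu0 setT measurableT _ _
    (weight_integrable s z) (weight_integrable s z')).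
have h0 : \int[mu0]_p (D p * c n p) @[n --> \oo] --> (0 : R).
  by rewrite (funext I0); exact: cvg_cst.
have E0 : 0 = z' - z by rewrite -iD; exact: cvg_unique h0 lim_.
by move: zz'; rewrite -subr_gt0 -E0 ltxx.
Unshelve. all: by end_near. Qed.

Implicit Types y z : R.

Lemma yB0 : yB mu0 0 t = yC mu0 t.
Proof. by rewrite yBE yCE. Qed.

Lemma yB_lt z z' : 0 <= z -> z < z' -> z' <= 1 -> yB mu0 z t < yB mu0 z' t.
Proof.
by move=> z0 zz' z'1; rewrite !yBE ltrD2l ltrN2 weight_lt.
Qed.

(** This shows that [y] itself belongs to the set whose infimum is [yhat], which is thus
    nonempty. *)
Lemma yB_ge z : 0 <= z <= 1 -> z <= yB mu0 z t.
Proof.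
move=> /andP[z0 z1]; have := @weight_lipschitz 0 z 1 z0 z1 (lexx _).
have := weight_ge0 0 1.
suff -> : weight 0 1 = 0 by rewrite yBE; lra.
transitivity (\int[mu0]_(p in setT) (0 : R)).
  apply: eq_Rintegral => p _; have /andP[_ v1] := val_I01 p.2.
  by rewrite leNgt v1 mul0r.
by have := Rintegral_cst mu0 measurableT 0; rewrite mul0r.
Qed.

Lemma yB_lipschitz z z' : 0 <= z -> z <= z' -> z' <= 1 ->
  yB mu0 z' t - yB mu0 z t <= z' - z.
Proof.
by move=> z0 zz' z'1; have := @weight_lipschitz 0 z z' z0 zz' z'1; rewrite !yBE; lra.
Qed.

Let yhat_set y := [set z : R | 0 <= z < 1 /\ y <= yB mu0 z t].

Let yhat_mem y : yC mu0 t <= y < 1 -> yhat_set y y.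
Proof.
move=> /andP[yc y1]; have y0 := le_trans yC_ge0 yc.
by rewrite /yhat_set/= y0 y1 yB_ge// y0 ltW.
Qed.

Let yhat_lb y : lbound (yhat_set y) 0.
Proof. by move=> z [/andP[]]. Qed.

Lemma yhat_itv y : yC mu0 t <= y < 1 -> 0 <= yhat mu0 y t < 1.
Proof.
move=> yi; have /andP[_ y1] := yi; apply/andP; split.
  by apply: lb_le_inf; [exists y; exact: yhat_mem|exact: yhat_lb].
by apply: le_lt_trans y1; apply: ge_inf; [exists 0; exact: yhat_lb|exact: yhat_mem].
Qed.

Lemma yhat_nd y y' : y <= y' -> yC mu0 t <= y' < 1 -> yhat mu0 y t <= yhat mu0 y' t.
Proof.
move=> yy' y'i; apply: lb_le_inf; first by exists y'; exact: yhat_mem.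
move=> z [z01 y'z]; apply: ge_inf; first by exists 0; exact: yhat_lb.
by split => //; exact: le_trans y'z.
Qed.

(** Lipschitz continuity carries both inequalities to the infimum. If it is 0, there are no points
    on its left, and [yB0] with [yC <= y] replaces them. *)
Lemma yB_yhat y : yC mu0 t <= y < 1 -> yB mu0 (yhat mu0 y t) t = y.
Proof.
move=> yi; have /andP[z0 z1] := yhat_itv yi; set z := yhat mu0 y t in z0 z1 *.
have hinf : has_inf (yhat_set y).
  by split; [exists y; exact: yhat_mem|exists 0; exact: yhat_lb].
apply/eqP; rewrite eq_le; apply/andP; split.
  apply/ler_addgt0Pl => e e0.
  move: z0; rewrite le_eqVlt => /predU1P[z0|z0].
    by rewrite -z0 yB0; move: yi => /andP[]; lra.
  pose z' := Num.max 0 (z - e).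
  have z'z : z' < z by rewrite gt_max z0/=; lra.
  have z'0 : 0 <= z' by rewrite le_max lexx.
  have : yB mu0 z' t < y.
    rewrite ltNge; apply/negP => h.
    have : z <= z'.
      apply: ge_inf; first by exists 0; exact: yhat_lb.
      by split => //; rewrite z'0 (lt_trans z'z).
    by rewrite leNgt z'z.
  have := @yB_lipschitz z' z z'0 (ltW z'z) (ltW z1).
  have : z - e <= z' by rewrite le_max lexx orbT.
  lra.
apply/ler_addgt0Pl => e e0.
have [z' [/andP[z'0 z'1] yz'] z'e] := inf_adherent e0 hinf.
have zz' : z <= z'.
  apply: ge_inf; first by exists 0; exact: yhat_lb.
  by split => //; rewrite z'0.
have := @yB_lipschitz z z' z0 zz' (ltW z'1).
have : z' < z + e by [].
lra.
Qed.

Lemma yhat_yB z : 0 <= z < 1 -> yhat mu0 (yB mu0 z t) t = z.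
Proof.
move=> z01; have /andP[z0 z1] := z01.
apply/eqP; rewrite eq_le; apply/andP; split.
  by apply: ge_inf; [exists 0; exact: yhat_lb|split].
apply: lb_le_inf; first by exists z.
move=> z' [/andP[z'0 z'1] zz']; rewrite leNgt; apply/negP => z'z.
by have := yB_lt z'0 z'z (ltW z1); rewrite ltNge zz'.
Qed.

Lemma yhat_inverse_holds : yhat_inverse mu0 t.
Proof. by split; [exact: yB_yhat|exact: yhat_yB]. Qed.

Lemma yhat_yC : yhat mu0 (yC mu0 t) t = 0.
Proof. by rewrite -yB0 yhat_yB// lexx ltr01. Qed.

Hypothesis t0_inv : t0_inverse mu0 t.

(* The items ranked at least [y] at time [t] are, up to a vanishing proportion,
   those with no jump in [(last_time y, t]] that started at or after [start y]. *)
Definition last_time y : R := if y <= yC mu0 t then t - t0 mu0 y t else 0.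

Definition start y : R := if y <= yC mu0 t then 0 else yhat mu0 y t.

Lemma last_time_or_start y : last_time y = 0 \/ start y = 0.
Proof. by rewrite /last_time /start; case: ifP; [right|left]. Qed.

Lemma last_time_itv y : 0 <= last_time y <= t.
Proof.
rewrite /last_time; case: ifPn => [/t0_itv /andP[? ?]|_]; last by rewrite lexx ltW.
by apply/andP; split; lra.
Qed.

Lemma start_itv y : y < 1 -> 0 <= start y < 1.
Proof.
rewrite /start => y1; case: ifPn => [_|]; first by rewrite lexx ltr01.
by rewrite -ltNge => /ltW yc; apply: yhat_itv; rewrite yc.
Qed.

Lemma last_time_ni y y' : y <= y' -> last_time y' <= last_time y.
Proof.
move=> yy'; rewrite /last_time; case: ifPn => [y'c|_].
  rewrite (le_trans yy' y'c).
  by have := t0_nd yy' y'c; lra.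
by have := last_time_itv y; rewrite /last_time => /andP[].
Qed.

Lemma start_nd y y' : y <= y' -> y' < 1 -> start y <= start y'.
Proof.
move=> yy' y'1; rewrite /start; case: ifPn => [_|yc].
  by have := start_itv y'1; rewrite /start => /andP[].
rewrite -ltNge in yc.
rewrite (lt_geF (lt_le_trans yc yy')).
by apply: yhat_nd => //; rewrite y'1 (le_trans (ltW yc)).
Qed.

(** The cut-offs are chosen for this identity: in terms of shares it is the inverse property of [t0]
    below [yC] and of [yhat] above. *)
Lemma weight_mass y : 0 <= y < 1 -> weight (last_time y) (start y) = 1 - y.
Proof.
move=> /andP[y0 y1]; rewrite /last_time /start; case: ifPn => [yc|].
  by apply: t0_weight => //; rewrite y0.
rewrite -ltNge => /ltW yc; have := @yB_yhat y; rewrite yc y1 => /(_ isT).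
by rewrite yBE; lra.
Qed.

End limit_curves.

(** * Construction of the limit law *)

Lemma uniform_prob_le (R : realType) (e : R) : 0 <= e <= 1 ->
  (uniform_prob (@ltr01 R) [set u | (u <= e)%R] = e%:E)%E.
Proof.
move=> /andP[e0 e1].
have E : [set u | u <= e] = `]-oo, e]%classic :> set R.
  by apply/seteqP; split => u /=; rewrite in_itv.
have mE : measurable [set u | u <= e] by rewrite E.
rewrite -[X in uniform_prob _ X]setIT -integral_indic// integral_uniform//.
  rewrite subr0 invr1 mul1e integral_indic//.
  rewrite E (_ : _ `&` _ = `[0, e]%classic).
    etransitivity; first exact: (@lebesgue_measure_itv R `[0, e]).
    rewrite /= lte_fin; case: ltP => [_|e0']; first by rewrite oppr0 adde0.
    by congr EFin; apply/eqP; rewrite eq_le e0.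
  apply/seteqP; split => u /=; rewrite !in_itv/=; first by case=> -> /andP[->].
  by move=> /andP[u0 ue]; rewrite u0 ue (le_trans ue).
by apply/measurable_EFinP; exact: measurable_indic.
Qed.

Section borel_product.
Context (R : realType) (S : ptopologicalType).
Local Notation T := (S * I01 R)%type.

(* The Borel sigma-algebra of the product is that of the product
   sigma-algebra because the second factor is second countable. *)
Lemma borel_pair_measurable d (W : measurableType d) (f : W -> S) (g : W -> I01 R) :
  measurable_fun setT (f : W -> borel S) ->
  measurable_fun setT (fun w => val (g w)) ->
  measurable_fun setT ((fun w => (f w, g w)) : W -> borel T).
Proof.
move=> mf mg.
apply: (@measurability _ _ W (borel T) setT (fun w => (f w, g w)) (@open T) erefl).
move=> _ [Op oO <-]; rewrite setTI.
pose Iab (a b : rat) : set (I01 R) := [set z | ratr a < val z < ratr b].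
pose A a b : set S := \bigcup_(V in [set V | open V /\ V `*` Iab a b `<=` Op]) V.
have oA a b : open (A a b) by apply: bigcup_open => V [].
have -> : (fun w => (f w, g w)) @^-1` Op =
    \bigcup_a \bigcup_b ((f @^-1` A a b) `&` (fun w => val (g w)) @^-1` `]ratr a, ratr b[).
  apply/seteqP; split => w /=; last first.
    move=> [a _ [b _ [[V [oV VO] Vf]]]]; rewrite /= in_itv/= => Ig.
    exact: (VO (f w, g w)).
  move=> Ow; have [[B C] /= [Bf Cg] BC] : nbhs (f w, g w) Op by exact: open_nbhs_nbhs.
  move: Bf; rewrite nbhsE => -[B' [oB' B'f] B'B].
  move: Cg; rewrite nbhsE => -[_ [[V oV <-] Vg] VC].
  have /nbhs_ballP[e e0 eV] := open_nbhs_nbhs (conj oV Vg).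
  have /rat_in_itvoo[a] : val (g w) - e < val (g w) by rewrite gtrBl.
  have /rat_in_itvoo[b] : val (g w) < val (g w) + e by rewrite ltrDl.
  rewrite !in_itv/= => /andP[b1 b2] /andP[a1 a2].
  exists a => //; exists b => //; split => /=; last by rewrite in_itv/= a2.
  exists B' => //; split => // -[r z] /= [B'r /andP[az zb]].
  apply: (BC (r, z)); split => /=; first exact: B'B.
  by apply: VC; apply: eV; rewrite /ball/= ltr_distlC (lt_trans a1 az) (lt_trans zb b2).
apply: bigcupT_measurable_rat => a; apply: bigcupT_measurable_rat => b.
apply: measurableI.
  rewrite -[X in measurable X]setTI; apply: mf => //.
  by apply: sub_sigma_algebra; exact: oA.
by rewrite -[X in measurable X]setTI; apply: mg.
Qed.

End borel_product.

(** * A position with prescribed tail events *)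

Section quantile.
Context d (W : measurableType d) (R : realType) (Q : probability W R).
Variable E : R -> set W.
Hypothesis mE : forall y, measurable (E y).
Hypothesis E_ni : forall y y', 0 <= y -> y <= y' -> y' < 1 -> E y' `<=` E y.
Hypothesis QE : forall y, 0 <= y < 1 -> Q (E y) = (1 - y)%:E.

(** Rational levels make the supremum measurable and, [E] being decreasing, lose nothing. The level
    0 keeps the set nonempty and its supremum nonnegative. *)
Let levels (w : W) : set R :=
  [set q | q = 0 \/ exists a : rat, q = ratr a /\ 0 <= q < 1 /\ E q w].

Let level_sup (w : W) : R := sup (levels w).

Let has_sup_levels w : has_sup (levels w).
Proof.
split; first by exists 0; left.
by exists 1 => q [->//|[a [_ [/andP[_ /ltW]]]]].
Qed.

Let level_sup_ge0 w : 0 <= level_sup w.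
Proof. by apply: ub_le_sup; [exact: (has_sup_levels w).2|left]. Qed.

Let level_sup_gt w q : 0 <= q -> q < level_sup w ->
  exists a : rat, [/\ q < ratr a, ratr a < 1 :> R & E (ratr a) w].
Proof.
move=> q0 qs; have [_ [->|[a [-> [/andP[a0 a1] Ea]]]]] := sup_gt (has_sup_levels w).1 qs.
  by rewrite ltNge q0.
by move=> qa; exists a.
Qed.

Let level_sup_E w q : 0 <= q -> q < level_sup w -> E q w.
Proof.
move=> q0 /(level_sup_gt q0)[a [qa a1 Ea]].
by apply: (E_ni q0 (ltW qa) a1).
Qed.

Let E_level_sup w y : 0 <= y < 1 -> E y w -> y <= level_sup w.
Proof.
move=> /andP[y0 y1] Ey; rewrite leNgt; apply/negP => /rat_in_itvoo[a].
rewrite in_itv/= => /andP[sa ay].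
have a0 : 0 <= ratr a :> R by rewrite (le_trans _ (ltW sa))// level_sup_ge0.
have := sa; apply/negP; rewrite -leNgt; apply: ub_le_sup.
  exact: (has_sup_levels w).2.
right; exists a; split => //; rewrite a0 (lt_trans ay y1); split => //.
exact: (E_ni a0 (ltW ay) y1).
Qed.

Let measurable_level_sup : measurable_fun setT level_sup.
Proof.
apply: (measurability _ (RGenOInfty.measurableE R)) => _ [_ [a ->] <-]; rewrite setTI.
have [a0|a0] := ltP a 0.
  rewrite (_ : _ @^-1` _ = setT)//; apply/seteqP; split => // w _ /=.
  by rewrite in_itv/= andbT (lt_le_trans a0).
rewrite (_ : _ @^-1` _ = \bigcup_(q : rat)
    (if (a < ratr q) && (ratr q < 1 :> R) then E (ratr q) else set0)).
  by apply: bigcupT_measurable_rat => q; case: ifP.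
apply/seteqP; split => w /=.
  rewrite in_itv/= andbT => /(level_sup_gt a0)[q [aq q1 Eq]].
  by exists q => //; rewrite aq q1.
move=> [q _]; case: ifP => // /andP[aq q1] Eq.
rewrite in_itv/= andbT (lt_le_trans aq)// E_level_sup// q1 andbT.
by rewrite (le_trans a0)// ltW.
Qed.

(** The supremum can be 1, which is not a position; the default 0 is then taken, on a null event. *)
Definition quantile (w : W) : I01 R := insubd (I01_0 R) (level_sup w).

Let val_quantile w : val (quantile w) = if level_sup w < 1 then level_sup w else 0.
Proof.
have E1 : (level_sup w \in (`[0, 1[%classic : set R)) = (level_sup w < 1).
  by rewrite mem_setE in_itv/= level_sup_ge0.
by rewrite /quantile val_insubd E1.
Qed.

Lemma measurable_quantile : measurable_fun setT (fun w => val (quantile w)).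
Proof.
rewrite (_ : (fun w => _) = (fun w => if level_sup w < 1 then level_sup w else 0)).
  by apply: measurable_fun_ifT => //; exact: measurable_fun_ltr.
by apply/funext => w; exact: val_quantile.
Qed.

Let measurable_quantile_ge y : measurable [set w | y <= val (quantile w)].
Proof.
rewrite (_ : mkset _ = (fun w => val (quantile w)) @^-1` `[y, +oo[); last first.
  by apply/seteqP; split => w /=; rewrite in_itv/= andbT.
by rewrite -[X in measurable X]setTI; exact: measurable_quantile.
Qed.

Let small_null (A : set W) y (y0 : 0 <= y <= 1) : measurable A ->
  (forall q, 0 <= q -> q < y -> (Q A <= (y - q)%:E)%E) -> 0 < y -> Q A = 0%E.
Proof.
move=> mA h y_gt0; apply/eqP; rewrite eq_le measure_ge0 andbT.
apply/lee_addgt0Pr => e e0; rewrite add0e.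
pose q := Num.max 0 (y - e).
apply: le_trans (h q _ _) _; first by rewrite le_max lexx.
  by rewrite gt_max y_gt0/=; lra.
by rewrite lee_fin; have : y - e <= q by [rewrite le_max lexx orbT]; lra.
Qed.

Let Q_sub y q A : 0 <= q -> q < y -> y < 1 -> measurable A -> A `<=` E q `\` E y ->
  (Q A <= (y - q)%:E)%E.
Proof.
move=> q0 qy y1 mA AE.
apply: (@le_trans _ _ (Q (E q `\` E y))).
  by apply: le_measure; rewrite ?inE//; exact: measurableD.
have y0 : 0 <= y by rewrite (le_trans q0)// ltW.
apply: (@le_trans _ _ (Q (E q) - Q (E y))%E); last first.
  by rewrite !QE ?y0 ?y1 ?q0 ?(lt_trans qy)// -EFinB lee_fin; lra.
rewrite measureD//; last by rewrite -ge0_fin_numE// fin_num_measure.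
by rewrite setIidr//; exact: E_ni (ltW qy) y1.
Qed.

(** A point outside [E y] whose quantile is at least [y] lies in [E q] for every q < y, and these
    differences have probability y - q, hence arbitrarily small. *)
Lemma quantile_ae y : 0 <= y < 1 ->
  {ae Q, forall w, (y <= val (quantile w)) = `[< E y w >]}.
Proof.
move=> y01; have /andP[y0 y1] := y01.
pose A1 := [set w | y <= val (quantile w)] `\` E y.
pose A2 := E y `\` [set w | y <= val (quantile w)].
have mA1 : measurable A1 by exact: measurableD.
have mA2 : measurable A2 by exact: measurableD.
have QA1 : Q A1 = 0%E.
  (* At level 0 there is no lower level to compare with, but [E 0] has probability 1. *)
  have [yE0|y_gt0] : y = 0 \/ 0 < y.
    by move: y0; rewrite le_eqVlt => /predU1P[]; [left|right].
    apply/eqP; rewrite eq_le measure_ge0 andbT.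
    apply: (@le_trans _ _ (Q (~` E y))).
      by apply: le_measure; rewrite ?inE//; [exact: measurableC|move=> w []].
    by rewrite probability_setC// QE// yE0 subr0 subee.
  apply: (@small_null A1 y) => //; first by rewrite y0 ltW.
  move=> q q0 qy; apply: Q_sub => // w [/= yw Ew]; split => //.
  apply: level_sup_E => //; apply: (lt_le_trans qy); apply: (le_trans yw).
  by rewrite val_quantile; case: ifP.
(* Unless the supremum reaches 1, [E y] forces the quantile to be at least [y]; the exceptional
   points lie in every [E q], of probability 1 - q. *)
have QA2 : Q A2 = 0%E.
  apply: (@small_null A2 1) => //; first by rewrite ler01 lexx.
  move=> q q0 q1; rewrite -QE ?q0//; apply: le_measure; rewrite ?inE//.
  move=> w [/= Ew /negP yw]; apply: level_sup_E => //.
  move: yw; rewrite val_quantile; case: ltP => [s1|s1 _]; last exact: lt_le_trans s1.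
  by rewrite E_level_sup.
exists (A1 `|` A2); split; first exact: measurableU.
  apply/eqP; rewrite eq_le measure_ge0 andbT.
  apply: (@le_trans _ _ (Q A1 + Q A2)%E); first exact: measureU2.
  by rewrite QA1 QA2 adde0.
move=> w /= h; apply: contrapT => /not_orP[h1 h2]; apply: h.
case: (boolP (y <= _)) => yw; apply/esym.
  by apply/asboolP; apply: contrapT => Ew; apply: h1.
by apply/negbTE/asboolP => Ew; apply: h2; split => //; exact/negP.
Qed.

End quantile.

Section limit_law.
Context (R : realType).
Local Notation T := (radon R * I01 R)%type.
Variables (mu0 : probability (borel T) R) (t : R).
Hypothesis t_gt0 : 0 < t.
Hypothesis level_mass : forall z, 0 <= z <= 1 ->
  \int[mu0]_p (z <= val p.2)%R%:R = 1 - z.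
Hypothesis t0_inv : t0_inverse mu0 t.

Local Notation last_time := (last_time mu0 t).
Local Notation start := (start mu0 t).
Local Notation weight := (weight mu0 t).

Let mu0_fin : (mu0 setT < +oo)%E.
Proof. by rewrite probability_setT ltry. Qed.

Let W := (borel T * measurableTypeR R)%type.

Let Q : probability W R := (mu0 \x uniform_prob (@ltr01 R))%E.

(** Given the initial data, the second condition has probability [survival (last_time y) t]. One
    uniform variable serves all levels, which makes the events decreasing in [y]. *)
Let E (y : R) : set W :=
  [set w | start y <= val (w.1 : T).2 /\ w.2 <= survival (last_time y) t (w.1 : T).1].

Let msurv s : measurable_fun setT ((fun p : T => survival s t p.1) : borel T -> R).
Proof. exact: measurable_survival_fst. Qed.

Let mE y : measurable (E y).
Proof.
have -> : E y = (fst @^-1` [set p : T | start y <= val p.2]) `&`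
    [set w : W | w.2 <= survival (last_time y) t (w.1 : T).1] by [].
apply: measurableI.
  rewrite -[X in measurable X]setTI; apply: measurable_fst => //.
  exact: measurable_level.
rewrite -[X in measurable X]setTI.
have m1 : measurable_fun setT (fun w : W => w.2 : R) by exact: measurable_snd.
have m2 : measurable_fun setT (fun w : W => survival (last_time y) t (w.1 : T).1).
  exact: (measurableT_comp (@msurv (last_time y)) measurable_fst).
have := measurable_fun_ler m1 m2.
move=> /(_ measurableT [set true] I).
by congr measurable; apply/seteqP; split => w /=.
Qed.

Let E_ni y y' : 0 <= y -> y <= y' -> y' < 1 -> E y' `<=` E y.
Proof.
move=> y0 yy' y'1 w [h1 h2]; split.
  by apply: le_trans h1; exact: start_nd.
apply: le_trans h2 _; apply: survival_nd; exact: last_time_ni.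
Qed.

Let integral_E y (h : T -> R) : measurable_fun setT (h : borel T -> R) ->
  (forall p, 0 <= h p) ->
  (\int[Q]_w (h w.1 * \1_(E y) w)%:E = \int[mu0]_p
     (h p * ((start y <= val p.2)%R%:R * survival (last_time y) t p.1))%:E)%E.
Proof.
move=> mh h0.
have mf : measurable_fun setT (fun w : W => (h w.1 * \1_(E y) w)%:E).
  apply/measurable_EFinP; apply: measurable_funM; last exact: measurable_indic.
  exact: (measurableT_comp mh measurable_fst).
rewrite /Q fubini_tonelli1//; last by move=> w; rewrite lee_fin mulr_ge0.
apply: eq_integral => p _; rewrite /fubini_F.
pose s := survival (last_time y) t (p : T).1.
have ms : measurable [set v : R | v <= s].
  have -> : [set v : R | v <= s] = `]-oo, s]%classic by [].
  exact: measurable_itv.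
have m1 : measurable_fun setT (fun u : measurableTypeR R => (\1_([set v : R | v <= s]) u : R)%:E).
  by apply/measurable_EFinP; apply: measurable_indic.
transitivity (\int[uniform_prob (@ltr01 R)]_u
   ((h p * (start y <= val (p : T).2)%R%:R)%:E * (\1_([set v : R | (v <= s)%R]) u : R)%:E))%E.
  apply: eq_integral => u _; rewrite -EFinM; congr EFin; rewrite -mulrA; congr (_ * _).
  rewrite !indicE; case: (boolP (start y <= _)) => h1.
    rewrite mul1r; congr ((nat_of_bool _)%:R); apply/idP/idP; rewrite !inE /E /=; first by case.
    by [].
  rewrite mul0r memNset//= => -[h2]; by rewrite h2 in h1.
rewrite ge0_integralZl//; last by rewrite lee_fin mulr_ge0.
have I1 : (\int[uniform_prob (@ltr01 R)]_u
    (\1_([set v : R | (v <= s)%R]) u : R)%:E = s%:E)%E.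
  rewrite integral_indic// setIT; apply: uniform_prob_le.
  by rewrite survival_ge0 survival_le1.
by rewrite I1 -EFinM mulrA.
Qed.

Let weight_EFin y :
  (\int[mu0]_p ((start y <= val p.2)%R%:R * survival (last_time y) t p.1)%:E =
   (weight (last_time y) (start y))%:E)%E.
Proof.
rewrite /weight /Rintegral fineK//.
apply: integrable_fin_num => //.
apply: (integrable_bounded mu0_fin (C := 1)); first exact: measurable_weight.
move=> p; rewrite ger0_norm ?mulr_ge0 ?survival_ge0// mulr_ile1 ?survival_ge0 ?survival_le1//.
by rewrite lern1; case: (_ <= _).
Qed.

Let QE y : 0 <= y < 1 -> Q (E y) = (1 - y)%:E.
Proof.
move=> y01.
rewrite -[X in Q X]setIT -integral_indic//.
transitivity (\int[Q]_w ((cst 1 : T -> R) w.1 * \1_(E y) w)%:E)%E.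
  by apply: eq_integral => w _; rewrite /cst mul1r.
rewrite integral_E//.
rewrite -(weight_mass t_gt0 level_mass t0_inv y01) -weight_EFin.
by apply: eq_integral => p _; rewrite /cst mul1r.
Qed.

Let position : W -> I01 R := quantile E.

Let pair (w : W) : T := ((w.1 : T).1, position w).

Let measurable_pair : measurable_fun setT (pair : W -> borel T).
Proof.
apply: borel_pair_measurable.
  exact: (measurableT_comp (@borel_fst_measurable R) measurable_fst).
exact: (@measurable_quantile _ W R E mE E_ni).
Qed.

Let pair_mfun : {mfun W >-> borel T} :=
  HB.pack (pair : W -> borel T) (isMeasurableFun.Build _ _ _ _ _ measurable_pair).

(** The law of the pair formed by the initial measure and the quantile of the events [E];
    integrating out the uniform variable produces the survival factor. *)
Lemma limit_law_exists : exists mu_t : probability (borel T) R,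
  forall (y : R) (g : radon R -> R), 0 <= y < 1 ->
    measurable_fun setT (g : borel (radon R) -> R) -> (forall r, 0 <= g r) ->
    (\int[mu_t]_p ((y <= val p.2)%R%:R * g p.1)%:E =
     \int[mu0]_p ((start y <= val p.2)%R%:R * (g p.1 * survival (last_time y) t p.1))%:E)%E.
Proof.
exists (distribution Q pair_mfun) => y g y01 mg g0.
have mgf : measurable_fun setT ((fun p : T => g p.1) : borel T -> R).
  exact: (measurableT_comp mg (@borel_fst_measurable R)).
rewrite ge0_integral_pushforward//; last 2 first.
- apply/measurable_EFinP; apply: measurable_funM => //.
  exact: measurable_indicator_level.
- by move=> p _; rewrite lee_fin mulr_ge0.
rewrite preimage_setT.
transitivity (\int[Q]_w (g (w.1 : T).1 * \1_(E y) w)%:E)%E.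
  apply: ae_eq_integral => //.
  - apply: measurableT_comp => //; apply/measurable_EFinP; apply: measurable_funM => //.
    exact: measurable_indicator_level.
  - apply/measurable_EFinP; apply: measurable_funM; last exact: measurable_indic.
    exact: (measurableT_comp mgf measurable_fst).
  - apply: filterS (quantile_ae mE E_ni QE y01) => w hw _ /=.
    congr EFin; rewrite mulrC; congr (_ * _); rewrite -/(position w) in hw *.
    by rewrite hw indicE; congr ((nat_of_bool _)%:R); apply/asboolP/idP; rewrite inE.
rewrite (@integral_E y (fun p : T => g p.1))//.
by apply: eq_integral => p _; rewrite mulrCA.
Qed.

End limit_law.

Lemma sum_le_eq (R : realFieldType) (a a' b b' : R) :
  a <= a' -> b <= b' -> a' + b' = a + b -> a' = a.
Proof. by move=> *; lra. Qed.

(** * The two expressions of the tails of the limit law *)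

Section limit_law_levels.
Context (R : realType).
Local Notation T := (radon R * I01 R)%type.
Variables (mu0 mu_t : probability (borel T) R) (t : R).
Hypothesis t_gt0 : 0 < t.
Hypothesis level_mass : forall z, 0 <= z <= 1 ->
  \int[mu0]_p (z <= val p.2)%R%:R = 1 - z.
Hypothesis t0_inv : t0_inverse mu0 t.
Local Notation last_time := (last_time mu0 t).
Local Notation start := (start mu0 t).
Local Notation weight := (weight mu0 t).

Let mu0_fin : (mu0 setT < +oo)%E.
Proof. by rewrite probability_setT ltry. Qed.

Hypothesis mu_tE : forall (y : R) (g : radon R -> R), 0 <= y < 1 ->
    measurable_fun setT (g : borel (radon R) -> R) -> (forall r, 0 <= g r) ->
    (\int[mu_t]_p ((y <= val p.2)%R%:R * g p.1)%:E =
     \int[mu0]_p ((start y <= val p.2)%R%:R * (g p.1 * survival (last_time y) t p.1))%:E)%E.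

Let U_indic (mu : {measure set (borel T) -> \bar R}) z A s : measurable A ->
  (\int[U mu z]_(r in A) (survival s t r)%:E =
   \int[mu]_p ((z <= val p.2)%R%:R *
     ((\1_A : borel (radon R) -> R) p.1 * survival s t p.1))%:E)%E.
Proof.
move=> mA; rewrite integral_U//; [|apply/measurable_EFinP; exact: measurable_survival|by move=> r; rewrite lee_fin survival_ge0].
rewrite [LHS]integral_mkcond; apply: (congr1 (fun g : borel T -> \bar R => integral mu setT g)).
apply/funext => p; rewrite /patch indicE.
case: ifPn => [|/negP]; rewrite inE/= => h.
  by case: h => Ap ->; rewrite mem_set// !mul1r.
case: (boolP (z <= _)) => zp; last by rewrite mul0r.
by rewrite memNset ?mul0r ?mulr0// => Ap; apply: h.
Qed.

Lemma U_limit_law y A : 0 <= y < 1 -> measurable A ->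
  U mu_t y A = (\int[U mu0 (start y)]_(r in A) (survival (last_time y) t r)%:E)%E.
Proof.
move=> y01 mA; rewrite U_indic//.
have mi : measurable_fun setT (\1_A : borel (radon R) -> R).
  exact: measurable_indic.
rewrite -(mu_tE y01 mi)//.
transitivity (\int[mu_t]_p
    ((\1_(A `*` [set z : I01 R | y <= val z]) : borel T -> R) p)%:E)%E.
  rewrite integral_indic ?setIT//.
  by apply: borel_setX => //; exact: measurable_I01_ge.
apply: eq_integral => p _; congr EFin.
rewrite !indicE -natrM mulnb; congr ((nat_of_bool _)%:R).
by apply/idP/andP; rewrite !inE /= => -[].
Qed.

Lemma integral_Lambda_U (A : set (borel (radon R))) (f : borel (radon R) -> \bar R) :
  (\int[Lambda mu0]_(r in A) f r = \int[U mu0 0]_(r in A) f r)%E.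
Proof.
apply: eq_measure_integral => B mB _.
apply: (congr1 (mu0 : set (borel T) -> \bar R)).
apply/seteqP; split => -[r z] /= [Br zB]; split => //.
by have /andP[] := val_I01 z.
Qed.

Lemma yC_lt1 : yC mu0 t < 1.
Proof.
rewrite yCE ltrBlDr ltrDl.
exact: le_lt_trans (weight_ge0 mu0 t 0 1) (weight_lt t level_mass 0 (lexx 0) ltr01 (lexx 1)).
Qed.

Let G s (A : set (borel (radon R))) : R :=
  \int[mu0]_p ((\1_A : borel (radon R) -> R) p.1 * survival s t p.1).

Let mG s A : measurable A -> measurable_fun setT
  ((fun p : T => (\1_A : borel (radon R) -> R) p.1 * survival s t p.1) : borel T -> R).
Proof.
move=> mA; apply: measurable_funM; last exact: measurable_survival_fst.
have mi : measurable_fun setT (\1_A : borel (radon R) -> R).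
  exact: measurable_indic.
exact: (measurableT_comp mi (@borel_fst_measurable R)).
Qed.

Let nG s A (p : T) : `|(\1_A : borel (radon R) -> R) p.1 * survival s t p.1| <= 1.
Proof.
by rewrite normrM mulr_ile1// ger0_norm ?survival_ge0 ?survival_le1//.
Qed.

Let G_add s A : measurable A -> G s A + G s (~` A) = weight s 0.
Proof.
move=> mA.
have i1 := integrable_bounded mu0_fin (mG s mA) (nG s A).
have i2 := integrable_bounded mu0_fin (mG s (measurableC mA)) (nG s (~` A)).
rewrite weight0 /G -(RintegralD measurableT i1 i2).
apply: eq_Rintegral => p _; rewrite -mulrDl -[RHS]mul1r; congr (_ * _).
by rewrite !indicE in_setC; case: (p.1 \in A); rewrite ?addr0 ?add0r.
Qed.

Let G_le s s' A : measurable A -> s <= s' -> G s A <= G s' A.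
Proof.
move=> mA ss'.
apply: (Rintegral_le_bounded mu0_fin (mG s mA) (mG s' mA) (nG s A) (nG s' A)).
by move=> p; rewrite ler_wpM2l// survival_nd.
Qed.

Let U0_G s A : measurable A ->
  (\int[U mu0 0]_(r in A) (survival s t r)%:E = (G s A)%:E)%E.
Proof.
move=> mA; rewrite U_indic// /G /Rintegral fineK.
  apply: eq_integral => p _; have /andP[-> _] := val_I01 (p : T).2.
  by rewrite mul1r.
apply: integrable_fin_num => //.
exact: (integrable_bounded mu0_fin (mG s mA) (nG s A)).
Qed.

Lemma U_limit_law_low y A : measurable A -> 0 <= y <= yC mu0 t ->
  U mu_t y A = (\int[Lambda mu0]_(r in A) (survival (t - t0 mu0 y t) t r)%:E)%E.
Proof.
move=> mA /andP[y0 yc]; rewrite U_limit_law//; last first.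
  by rewrite y0 (le_lt_trans yc)// yC_lt1.
by rewrite integral_Lambda_U /last_time /start yc.
Qed.

Lemma U_limit_law_high y A : measurable A -> yC mu0 t <= y < 1 ->
  U mu_t y A = (\int[U mu0 (yhat mu0 y t)]_(r in A) (survival 0 t r)%:E)%E.
Proof.
move=> mA /andP[yc y1]; have y0 := le_trans (yC_ge0 mu0 t_gt0) yc.
rewrite U_limit_law ?y0//.
(* At [y = yC] the two formulas are ordered on [A] and on its complement, and
   have the same total mass, hence they agree. *)
move: yc; rewrite le_eqVlt => /predU1P[yE|yc]; last first.
  by rewrite /last_time /start leNgt yc.
have lE : last_time (yC mu0 t) = t - t0 mu0 (yC mu0 t) t.
  by rewrite /last_time lexx.
have sE : start (yC mu0 t) = 0 by rewrite /start lexx.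
have yh : yhat mu0 (yC mu0 t) t = 0 by exact: yhat_yC.
rewrite -yE yh lE sE (U0_G _ mA) (U0_G _ mA); apply: (congr1 EFin).
set s := t - _.
have s0 : 0 <= s.
  by rewrite subr_ge0; have /andP[] := t0_itv t_gt0 (lexx (yC mu0 t)).
have w : weight s 0 = weight 0 0.
  by rewrite /s t0_weight// ?lexx ?yC_ge0// yCE; ring.
apply: (sum_le_eq (G_le mA s0) (G_le (measurableC mA) s0)).
exact: etrans (G_add s mA) (etrans w (esym (G_add 0 mA))).
Qed.

End limit_law_levels.

(** * Almost sure convergence *)

Section random_averages.
Context (R : realType) (d : measure_display) (Omega : measurableType d)
  (P : probability Omega R).
Local Notation T := (radon R * I01 R)%type.
Variables (rho : forall N : nat, 'I_N -> radon R)
  (nu : forall N : nat, 'I_N -> Omega -> {measure set R -> \bar R})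
  (x : forall N : nat, {perm 'I_N}).
Arguments rho : clear implicits.
Arguments nu : clear implicits.
Arguments x : clear implicits.
Hypothesis nu_poisson : forall N (i : 'I_N),
  poisson_random_measure P (rho N i) (nu N i).
Hypothesis nu_independent : forall N,
  independent P (fun i : 'I_N => sigma_rm (nu N i)).
Variable t : R.

Definition no_jump N (i : 'I_N) (s : R) : set Omega :=
  [set w | nu N i w `]s, t]%classic = 0%E].

Lemma measurable_no_jump N (i : 'I_N) s : measurable (no_jump i s).
Proof.
have := prm_measurable (nu_poisson i) (measurable_itv `]s, t]).
move=> /(_ measurableT _ (emeasurable_set1 0%E)).
by rewrite setTI.
Qed.

Lemma prob_no_jump N (i : 'I_N) s : fine (P (no_jump i s)) = survival s t (rho N i).
Proof.
have := prm_poisson (nu_poisson i) (measurable_itv `]s, t]) (radon_itv_lt _ _ _) 0.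
rewrite /no_jump => ->/=.
by rewrite expr0 fact0 divr1 mul1r.
Qed.

Lemma independent_no_jump N s :
  independent_events P (fun i : 'I_N => no_jump i s).
Proof.
move=> E hE; apply: (nu_independent (N := N)) => i.
case: (hE i) => ->.
  apply: sub_sigma_algebra; exists `]s, t]%classic; first exact: measurable_itv.
  exists [set 0%E]; first exact: emeasurable_set1.
  by rewrite setTI.
rewrite -(setC0 : _ = [set: Omega]) -setTD.
apply: sigma_algebraCD; exact: sigma_algebra0.
Qed.

Lemma jumps_finite N (i : 'I_N) :
  {ae P, forall w, (nu N i w `]0%R, t]%classic < +oo)%E}.
Proof.
have mi : measurable (`]0, t]%classic : set R) by [].
have ifin : P.-integrable setT (fun w => nu N i w `]0, t]%classic).
  apply/integrableP; split; first exact: (prm_measurable (nu_poisson i)).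
  under eq_integral do rewrite gee0_abs//.
  by rewrite (prm_intensity (nu_poisson i))// radon_itv_lt.
have := integrable_ae measurableT ifin.
apply: filterS => w /(_ I); rewrite fin_numElt => /andP[_]; exact.
Qed.

Local Notation config N := (configuration (rho N) (fun i => (x N i).+1)).
Let z0 N (i : 'I_N) : T := (rho N i, scaled R N (x N i).+1).

Variable mu0 : probability (borel T) R.
Hypothesis mu0_cvg : weak_cvg (fun N => config N) mu0.
Hypothesis lambda_cvg : forall s : R, 0 <= s <= t -> weak_cvg
  (fun N => lambda (Lambda (config N)) s t) (lambda (Lambda mu0) s t).
Hypothesis t_gt0 : 0 < t.
Hypothesis t0_inv : t0_inverse mu0 t.

Let no_atom := t0_inverse_no_atom t_gt0 t0_inv.

(** The strong law removes the fluctuations of the no-jump indicators around their probabilities,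
    which are survival values; the remaining means converge by [level_average_cvg]. *)
Lemma tail_average_cvg s z (h : T -> R) (C : R) : 0 <= s <= t -> 0 <= z <= 1 ->
  continuous h -> (forall p, 0 <= h p <= C) ->
  {ae P, forall w, N%:R^-1 * \sum_(i < N)
      ((z <= val (z0 i).2)%R%:R * h (z0 i) * \1_(no_jump i s) w) @[N --> \oo] -->
    \int[mu0]_p ((z <= val p.2)%R%:R * (h p * survival s t p.1))}.
Proof.
move=> st z01 ch hC.
pose c N (i : 'I_N) : R := (z <= val (z0 i).2)%R%:R * h (z0 i).
have cC N (i : 'I_N) : `|c N i| <= C.
  have /andP[h0 h1] := hC (z0 i).
  rewrite ger0_norm ?mulr_ge0// /c; case: (z <= _); rewrite ?mul1r ?mul0r//.
  exact: le_trans h1.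
have := bernoulli_strong_law (fun N (i : 'I_N) => measurable_no_jump i s)
  (fun N => @independent_no_jump N s) cC.
apply: filterS => w hw.
have hd := level_average_cvg mu0_cvg lambda_cvg no_atom st z01 ch hC.
rewrite -[X in _ --> X]add0r.
suff E N : N%:R^-1 * \sum_(i < N)
      ((z <= val (z0 i).2)%R%:R * h (z0 i) * \1_(no_jump i s) w) =
    N%:R^-1 * \sum_(i < N) c N i * (\1_(no_jump i s) w - fine (P (no_jump i s))) +
    average rho x N (fun p => (z <= val p.2)%R%:R * (h p * survival s t p.1)).
  by rewrite (funext E); exact: cvgD hw hd.
rewrite /average -mulrDr -big_split/=; congr (_ * _); apply: eq_bigr => i _.
by rewrite prob_no_jump /c /=; ring.
Qed.

End random_averages.

(** A nonincreasing boolean sequence has at most one nonzero difference, at its last true index, so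
    the sum selects a single value of [u]. *)
Lemma staircase_sum (R : pzRingType) (n : nat) (u : nat -> R) (th : nat -> bool) :
  (forall k, th k.+1 -> th k) -> ~~ th n ->
  let s := \sum_(k < n) u k * ((th k)%:R - (th k.+1)%:R) in
  if th 0%N then exists j, [/\ (j < n)%N, th j, ~~ th j.+1 & s = u j] else s = 0.
Proof.
elim: n u th => [|n ih] u th thS thn /=.
  by rewrite (negbTE thn) big_ord0.
rewrite big_ord_recl/=.
have := ih (u \o S) (th \o S) (fun k => thS k.+1) thn; rewrite /=.
have -> : \sum_(i < n) u (bump 0 i) * ((th (bump 0 i))%:R - (th (bump 0 i).+1)%:R) =
   \sum_(k < n) u k.+1 * ((th k.+1)%:R - (th k.+2)%:R) by [].
set s := \sum_(_ < _) _.
case: ifPn => [th1 [j [jn thj thj1 ->]]|th1 ->].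
  rewrite (thS _ th1); exists j.+1; split => //.
  by rewrite subrr mulr0 add0r.
case: ifPn => [th0|th0]; last by rewrite (negbTE th0) subrr mulr0 addr0.
by exists 0%N; split => //; rewrite th0 subr0 mulr1 addr0.
Qed.

Lemma dist_le_add (R : realFieldType) (a b c e : R) :
  b - e <= a -> a <= b + c + e -> 0 <= c -> `|a - b| <= c + e.
Proof. by move=> *; rewrite ler_norml; apply/andP; split; lra. Qed.

Lemma dist_lt4 (R : realFieldType) (a b c d e : R) : `|a - b| <= e / 4 ->
  `|b - c| < e / 4 -> `|d - c| <= e / 4 + e / 4 -> `|a - d| < e.
Proof.
rewrite !ltr_norml !ler_norml => /andP[? ?] /andP[? ?] /andP[? ?].
by apply/andP; split; lra.
Qed.

Lemma mean_affine (R : numFieldType) N (a c : R) (u : 'I_N -> R) : (0 < N)%N ->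
  N%:R^-1 * \sum_(i < N) (a + c * (1 - u i)) =
  a + c * (1 - N%:R^-1 * \sum_(i < N) u i).
Proof.
move=> N0; have NR : N%:R != 0 :> R by rewrite pnatr_eq0 -lt0n.
rewrite big_split/= mulrDr; congr (_ + _).
  by rewrite sumr_const card_ord -[a *+ _]mulr_natl mulrA mulVf// mul1r.
rewrite -mulr_sumr sumrB sumr_const card_ord mulrCA; congr (_ * _).
by rewrite mulrBr mulVf.
Qed.

Lemma cvg_sum_ord (R : realType) n (u : nat -> nat -> R) (l : nat -> R) :
  (forall k, (k < n)%N -> u k N @[N --> \oo] --> l k) ->
  \sum_(k < n) u k N @[N --> \oo] --> \sum_(k < n) l k.
Proof.
elim: n => [_|n ih h].
  by under eq_fun do rewrite big_ord0; rewrite big_ord0; exact: cvg_cst.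
under eq_fun do rewrite big_ord_recr/=.
rewrite big_ord_recr/=; apply: cvgD; last exact: h.
by apply: ih => k kn; apply: h; exact: ltnW.
Qed.

(** * From tail sets to weak convergence *)

Section tails.
Context (R : realType).
Local Notation T := (radon R * I01 R)%type.

Definition point_at (v : R) : I01 R := insubd (I01_0 R) v.

Lemma val_point_at v : 0 <= v < 1 -> val (point_at v) = v.
Proof. by move=> v01; rewrite /point_at insubdK// inE/= in_itv. Qed.

Lemma grid_itv n k : (k < n)%N -> 0 <= (k%:R / n%:R : R) < 1.
Proof.
move=> kn; have n0 : 0 < n%:R :> R by rewrite ltr0n (leq_ltn_trans _ kn).
by rewrite divr_ge0//= ltr_pdivrMr// mul1r ltr_nat.
Qed.

Variables (f : T -> R) (C L : R).
Hypothesis f_bound : forall p, 0 <= f p <= C.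
Hypothesis L_ge0 : 0 <= L.
Hypothesis f_lipschitz : forall r (y z : I01 R),
  `|f (r, y) - f (r, z)| <= L * `|val y - val z|.

(** When [th k] means that the position is at least k/n, this is [f] with the position rounded down
    to the grid. Written with differences of tail indicators, its averages reduce to averages over
    tail sets. *)
Definition stair n (th : nat -> bool) (r : radon R) : R :=
  \sum_(k < n) f (r, point_at (k%:R / n%:R)) * ((th k)%:R - (th k.+1)%:R).

(** Here [e] is the error with which [th] locates the position, and the term in [C] covers the case
    where [th] is false at 0 and the stair vanishes. *)
Lemma stair_approx n (th : nat -> bool) r (v : I01 R) (e : R) :
  (0 < n)%N -> 0 <= e -> (forall k, th k.+1 -> th k) -> ~~ th n ->
  (forall k, (k < n)%N -> th k -> k%:R / n%:R - e <= val v) ->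
  (forall k, (k < n)%N -> ~~ th k -> val v <= k%:R / n%:R + e) ->
  `|f (r, v) - stair n th r| <= L * (n%:R^-1 + e) + C * (1 - (th 0%N)%:R).
Proof.
move=> n0 e0 thS thn th1 th2.
have C0 : 0 <= C by have /andP[a b] := f_bound (r, v); exact: le_trans b.
have nR : 0 < n%:R^-1 :> R by rewrite invr_gt0 ltr0n.
have := staircase_sum (fun k => f (r, point_at (k%:R / n%:R))) thS thn.
rewrite /= -/(stair n th r).
case: ifPn => [_ [j [jn thj thj1 ->]]|_ ->]; last first.
  rewrite subr0 subr0 mulr1 ger0_norm; last by have /andP[] := f_bound (r, v).
  have /andP[_ fC] := f_bound (r, v).
  by rewrite (le_trans fC)// lerDr mulr_ge0// addr_ge0// ltW.
rewrite subrr mulr0 addr0; apply: le_trans (f_lipschitz _ _ _) _.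
rewrite ler_wpM2l// val_point_at ?grid_itv//.
have h1 := th1 _ jn thj.
have h2 : val v <= j%:R / n%:R + n%:R^-1 + e.
  have -> : j%:R / n%:R + n%:R^-1 = j.+1%:R / n%:R :> R.
    by rewrite -natr1 mulrDl mul1r.
  have [jn1|] := ltnP j.+1 n; first exact: th2.
  (* Past the last grid point no tail indicator bounds the position; the right end 1 of the interval
     does. *)
  move=> nj; have -> : j.+1 = n by apply/eqP; rewrite eqn_leq jn.
  rewrite divff ?pnatr_eq0 -?lt0n//.
  have /andP[_ /ltW v1] := val_I01 v.
  by rewrite (le_trans v1)// lerDl.
exact: dist_le_add h1 h2 (ltW nR).
Qed.

End tails.

Section weak_convergence_of_tails.
Context (R : realType).
Local Notation T := (radon R * I01 R)%type.
Variables (rho : forall N : nat, 'I_N -> radon R) (X : forall N : nat, 'I_N -> nat)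
  (th : forall N : nat, 'I_N -> R -> bool) (mu : probability (borel T) R).
Arguments rho : clear implicits.
Arguments X : clear implicits.
Arguments th : clear implicits.
Hypothesis X_itv : forall N i, (0 < X N i <= N)%N.
Hypothesis X_tail : forall N i y, 0 <= y < 1 ->
  (N - \sum_(j < N) th N j y < X N i)%N = th N i y.
Hypothesis th_ni : forall N i y y', 0 <= y -> y <= y' -> y' < 1 ->
  th N i y' -> th N i y.
Hypothesis tail_mass : forall n k, (k < n)%N ->
  N%:R^-1 * \sum_(i < N) (th N i (k%:R / n%:R))%:R @[N --> \oo] -->
  (1 - k%:R / n%:R : R).
Hypothesis tail_cvg : forall l n k j, (k < n)%N -> (j < n)%N ->
  N%:R^-1 * \sum_(i < N) ((th N i (j%:R / n%:R))%:R *
      class_fun l (rho N i, point_at (k%:R / n%:R : R))) @[N --> \oo] -->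
  \int[mu]_p ((j%:R / n%:R <= val p.2)%R%:R *
      class_fun l (p.1, point_at (k%:R / n%:R : R))).

Let mu_fin : (mu setT < +oo)%E.
Proof. by rewrite probability_setT ltry. Qed.

Let p_ N (i : 'I_N) : T := (rho N i, scaled R N (X N i)).

(** The unit subtracted in the scaled position turns the strict inequality between integers into a
    large one. *)
Let rank_tail N (i : 'I_N) y : 0 <= y < 1 -> th N i y =
  (1 - N%:R^-1 * \sum_(j < N) (th N j y)%:R <= val (scaled R N (X N i))).
Proof.
move=> y01; have /andP[X0 XN] := X_itv i.
have N0 : 0 < N%:R :> R by rewrite ltr0n (leq_trans X0).
rewrite scaledE ?X0// -X_tail// -natr_sum.
set S := (\sum_(j < N) _)%N.
have SN : (S <= N)%N.
  rewrite -[leqRHS]card_ord -sum1_card; apply: leq_sum => j _; exact: leq_b1.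
rewrite ler_pdivlMr// mulrBl mul1r mulrAC mulVf ?gt_eqF// mul1r -natrB//.
by rewrite lerBrDr natr1 ler_nat.
Qed.

Section one_function.
Variables (l : seq hat_index) (C L : R).
Local Notation f := (@class_fun R l).
Hypothesis f_bound : forall p, 0 <= f p <= C.
Hypothesis L_ge0 : 0 <= L.
Hypothesis f_lipschitz : forall r (y z : I01 R),
  `|f (r, y) - f (r, z)| <= L * `|val y - val z|.

Let grid N (i : 'I_N) n k : bool := if (k < n)%N then th N i (k%:R / n%:R) else false.

Let level n k (p : T) : bool := if (k < n)%N then k%:R / n%:R <= val p.2 else false.

Let grid_le n k : (k.+1 < n)%N -> k%:R / n%:R <= (k.+1%:R / n%:R : R).
Proof.
by move=> kn; rewrite ler_wpM2r ?invr_ge0// ler_nat.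
Qed.

Let rank_approx N n : (0 < n)%N -> (0 < N)%N ->
  (forall k, (k < n)%N -> `|(1 - k%:R / n%:R : R) - N%:R^-1 * \sum_(i < N) (th N i (k%:R / n%:R))%:R|
     <= n%:R^-1) ->
  `|N%:R^-1 * \sum_(i < N) f (p_ i) -
    N%:R^-1 * \sum_(i < N) stair f n (grid i n) (rho N i)| <=
  L * (n%:R^-1 + n%:R^-1) +
  C * (1 - N%:R^-1 * \sum_(i < N) (th N i (0%:R / n%:R))%:R).
Proof.
move=> n0 N0 hk; have NR : 0 < N%:R^-1 :> R by rewrite invr_gt0 ltr0n.
rewrite -mulrBr -sumrB normrM (gtr0_norm NR).
apply: (@le_trans _ _ (N%:R^-1 * \sum_(i < N)
    (L * (n%:R^-1 + n%:R^-1) + C * (1 - (th N i (0%:R / n%:R))%:R)))); last first.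
  by rewrite mean_affine.
rewrite ler_wpM2l ?(ltW NR)//; apply: le_trans (ler_norm_sum _ _ _) _.
apply: ler_sum => i _.
have -> : th N i (0%:R / n%:R) = grid i n 0%N by rewrite /grid n0.
apply: (stair_approx f_bound L_ge0 f_lipschitz) => //.
- move=> k; rewrite /grid; case: ifP => // kn; rewrite (ltnW kn).
  have /andP[k0 _] := grid_itv R (ltnW kn); have /andP[_ k1] := grid_itv R kn.
  exact: th_ni k0 (grid_le kn) k1.
- by rewrite /grid ltnn.
- move=> k kn; rewrite /grid kn rank_tail ?grid_itv//; apply: le_trans.
  have := hk k kn; rewrite ler_norml => /andP[h _]; rewrite /= in h *; lra.
- move=> k kn; rewrite /grid kn rank_tail ?grid_itv// -ltNge => /ltW/le_trans; apply.
  have := hk k kn; rewrite ler_norml => /andP[_ h]; rewrite /= in h *; lra.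
Qed.

Let fpt n k (r : radon R) : R := f (r, point_at (k%:R / n%:R)).

Let fpt_measurable n k : measurable_fun setT ((fun p : T => fpt n k p.1) : borel T -> R).
Proof.
apply: (@continuous_measurable_borel R T) => p.
apply: (@continuous_comp T T R (fun p : T => (p.1, point_at (k%:R / n%:R))) f).
  apply: (@cvg_pair _ _ _ (nbhs p) (nbhs p.1) (nbhs (point_at (k%:R / n%:R)))
    _ _ _ fst (fun=> point_at (k%:R / n%:R))); last exact: cvg_cst.
  exact: fst_continuous.
exact: class_fun_continuous.
Qed.

Let level_measurable n k : measurable_fun setT ((fun p : T => (level n k p)%:R) : borel T -> R).
Proof.
rewrite /level; case: (k < n)%N; last exact: measurable_cst.
exact: measurable_indicator_level.
Qed.

Let term n k j (p : T) : R := (level n j p)%:R * fpt n k p.1.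

Let term_integrable n k j : mu.-integrable setT (EFin \o (term n k j : borel T -> R)).
Proof.
apply: (integrable_bounded mu_fin (C := C)).
  by apply: measurable_funM; [exact: level_measurable|exact: fpt_measurable].
move=> p; have /andP[f0 fC] := f_bound (p.1, point_at (k%:R / n%:R : R)).
rewrite /term; case: (level n j p); rewrite ?mul1r ?mul0r ?normr0 ?ger0_norm//.
exact: le_trans fC.
Qed.

Let stairE n (p : T) : stair f n (level n ^~ p) p.1 =
  \sum_(k < n) (term n k k p - term n k k.+1 p).
Proof. by apply: eq_bigr => k _; rewrite /term -mulrBl mulrC. Qed.

Let term_diff_integrable n k : mu.-integrable setT
  (EFin \o (fun p : borel T => term n k k p - term n k k.+1 p)).
Proof.
exact: (@integrableB _ _ _ mu setT measurableT _ _
  (term_integrable n k k) (term_integrable n k k.+1)).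
Qed.

Let stair_integrable n : mu.-integrable setT
  (EFin \o (fun p : borel T => stair f n (level n ^~ p) p.1)).
Proof.
rewrite (_ : EFin \o _ = (fun p : borel T =>
    \sum_(k < n) (term n k k p - term n k k.+1 p)%R%:E)%E); last first.
  by apply/funext => p /=; rewrite stairE sumEFin.
by apply: integrable_sum => // k _; exact: term_diff_integrable.
Qed.

Let stair_integral n : \int[mu]_p stair f n (level n ^~ p) p.1 =
  \sum_(k < n) (\int[mu]_p term n k k p - \int[mu]_p term n k k.+1 p).
Proof.
rewrite /Rintegral.
under eq_integral do rewrite stairE -sumEFin.
rewrite integral_sum//; last by move=> k; exact: term_diff_integrable.
rewrite -sum_fine; last first.
  by move=> k _; apply: integrable_fin_num => //; exact: term_diff_integrable.
by apply: eq_bigr => k _; rewrite -RintegralB.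
Qed.

Let mu_approx n : (0 < n)%N ->
  `|\int[mu]_p f p - \int[mu]_p stair f n (level n ^~ p) p.1| <= L * n%:R^-1.
Proof.
move=> n0.
have if_ : mu.-integrable setT (EFin \o (f : borel T -> R)).
  apply: (integrable_bounded mu_fin (C := C)).
    by apply: (@continuous_measurable_borel R T); exact: class_fun_continuous.
  by move=> p; have /andP[f0 fC] := f_bound p; rewrite ger0_norm.
have ifs := @integrableB _ _ _ mu setT measurableT _ _ if_ (stair_integrable n).
rewrite -(RintegralB measurableT if_ (stair_integrable n)).
apply: le_trans (le_normr_Rintegral measurableT ifs) _.
apply: (@le_trans _ _ (\int[mu]_(p in setT) (L * n%:R^-1))); last first.
  have := Rintegral_cst mu measurableT (L * n%:R^-1) => ->.
  have -> : fine (mu setT) = 1 by exact: (congr1 fine (@probability_setT _ _ _ mu)).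
  by rewrite mulr1.
apply: le_Rintegral => //.
- exact: integrable_abse ifs.
- apply: (integrable_bounded mu_fin (C := `|L * n%:R^-1|)) => //.
- case=> r v _.
  have := @stair_approx R f C L f_bound L_ge0 f_lipschitz n (level n ^~ (r, v)) r v 0 n0 (lexx 0).
  have -> : level n 0%N (r, v).
    by rewrite /level n0 mul0r; have /andP[] := val_I01 v.
  rewrite subrr mulr0 !addr0; apply.
  + move=> k; rewrite /level; case: ifP => // kn; rewrite (ltnW kn) /=.
    exact/le_trans/grid_le.
  + by rewrite /level ltnn.
  + by move=> k kn; rewrite /level kn subr0.
  + by move=> k kn; rewrite /level kn addr0 -ltNge => /ltW.
Qed.

Let stair_cvg n : (0 < n)%N ->
  N%:R^-1 * \sum_(i < N) stair f n (grid i n) (rho N i) @[N --> \oo] -->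
  \int[mu]_p stair f n (level n ^~ p) p.1.
Proof.
move=> n0; rewrite stair_integral.
pose A N k j := N%:R^-1 * \sum_(i < N) ((grid i n j)%:R * fpt n k (rho N i)).
have EA N : N%:R^-1 * \sum_(i < N) stair f n (grid i n) (rho N i) =
    \sum_(k < n) (A N k k - A N k k.+1).
  rewrite /stair exchange_big/= mulr_sumr; apply: eq_bigr => k _.
  rewrite /A -mulrBr -sumrB; congr (_ * _); apply: eq_bigr => i _.
  by rewrite -mulrBl mulrC.
rewrite (funext EA).
have cA k j : (k < n)%N -> A N k j @[N --> \oo] --> \int[mu]_p term n k j p.
  move=> kn; rewrite /A /grid /term /level; case: (boolP (j < n)%N) => jn.
    exact: tail_cvg.
  have -> : \int[mu]_p (false%:R * fpt n k p.1) = 0.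
    transitivity (\int[mu]_(p in setT) (0 : R)).
      by apply: eq_Rintegral => p _; rewrite mul0r.
    by have := Rintegral_cst mu measurableT 0; rewrite mul0r.
  have -> : (fun N => N%:R^-1 * \sum_(i < N) (false%:R * fpt n k (rho N i))) = cst 0.
    by apply/funext => N; rewrite big1 ?mulr0// => i _; rewrite mul0r.
  exact: cvg_cst.
apply: (@cvg_sum_ord _ n (fun k N => A N k k - A N k k.+1)
  (fun k => \int[mu]_p term n k k p - \int[mu]_p term n k k.+1 p)) => k kn.
by apply: cvgB; exact: cA.
Qed.

Lemma rank_average_cvg : N%:R^-1 * \sum_(i < N) f (p_ i) @[N --> \oo] -->
  \int[mu]_p f p.
Proof.
have C0 : 0 <= C by have /andP[a b] := f_bound point; exact: le_trans b.
have C1 : 0 < C + 1 by rewrite ltr_wpDl.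
apply/cvgrPdist_lt => e e0.
have e4 : 0 < e / 4 by rewrite divr_gt0.
have e5 : 0 < e / 4 / (C + 1) by rewrite divr_gt0.
(* Two errors of size 1/n, from rounding to the grid and from the position of the empirical tails,
   must together cost at most [e / 4]. *)
pose n := (Num.truncn (L * 2 / (e / 4))).+1.
have n0 : (0 < n)%N by [].
have nR : 0 < n%:R :> R by rewrite ltr0n.
have Ln : L * (n%:R^-1 + n%:R^-1) <= e / 4.
  have -> : n%:R^-1 + n%:R^-1 = 2 / n%:R :> R by rewrite [RHS]mulr_natl mulr2n.
  rewrite mulrA ler_pdivrMr// [leRHS]mulrC -ler_pdivrMr//.
  by apply/ltW; exact: truncnS_gt.
have Ln1 : L * n%:R^-1 <= e / 4.
  by apply: le_trans Ln; rewrite ler_wpM2l// lerDl invr_ge0.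
have nV : 0 < n%:R^-1 :> R by rewrite invr_gt0.
near=> N.
have a1 := mu_approx n0.
have a2 : `|\int[mu]_p stair f n (level n ^~ p) p.1 -
   N%:R^-1 * \sum_(i < N) stair f n (grid i n) (rho N i)| < e / 4.
  by near: N; exact: (cvg_seq_near (stair_cvg n0) e4).
have N0 : (0 < N)%N by near: N; exact: nbhs_infty_gt.
have hk k : (k < n)%N -> `|(1 - k%:R / n%:R : R) -
    N%:R^-1 * \sum_(i < N) (th N i (k%:R / n%:R))%:R| <= n%:R^-1.
  move=> kn; suff : forall k : 'I_n, `|(1 - k%:R / n%:R : R) -
      N%:R^-1 * \sum_(i < N) (th N i (k%:R / n%:R))%:R| <= n%:R^-1.
    by move=> /(_ (Ordinal kn)).
  near: N; apply: filter_forall => j.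
  by apply: filterS (cvg_seq_near (tail_mass (ltn_ord j)) nV) => N /ltW.
have a3 := rank_approx n0 N0 hk.
(* At level 0 the mass condition says that the share of items outside the tail set tends to 0. *)
have a4 : C * (1 - N%:R^-1 * \sum_(i < N) (th N i (0%:R / n%:R))%:R) <= e / 4.
  have h : `|(1 - 0%:R / n%:R : R) - N%:R^-1 * \sum_(i < N) (th N i (0%:R / n%:R))%:R|
      < e / 4 / (C + 1).
    by near: N; exact: (cvg_seq_near (tail_mass n0) e5).
  rewrite mul0r subr0 in h; have {}h := ltW (le_lt_trans (ler_norm _) h).
  apply: (@le_trans _ _ (C * (e / 4 / (C + 1)))).
    by rewrite mul0r ler_wpM2l.
  by rewrite mulrA ler_pdivrMr// mulrC ler_wpM2l ?ltW// ltrDl.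
have {}a3 : `|N%:R^-1 * \sum_(i < N) f (p_ i) -
    N%:R^-1 * \sum_(i < N) stair f n (grid i n) (rho N i)| <= e / 4 + e / 4.
  exact: le_trans a3 (lerD Ln a4).
exact: dist_lt4 (le_trans a1 Ln1) a2 a3.
Unshelve. all: by end_near. Qed.

End one_function.

Lemma weak_cvg_of_tails : weak_cvg (fun N => configuration (rho N) (X N)) mu.
Proof.
have m1 : measurable_fun setT (cst 1 : borel T -> R) by exact: measurable_cst.
apply: weak_cvg_class => //.
- by move=> N; exact: empirical_setT_lty.
- have -> : \int[mu]_x (1 : R) = 1.
    have := Rintegral_cst mu measurableT 1; rewrite mul1r => ->.
    exact: (congr1 fine (@probability_setT _ _ _ mu)).
  (* The empirical measure of no points is zero, so the mass is 1 only from [N = 1] on. *)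
  apply: cvg_near_cst; exists 1%N => // N /= N0.
  rewrite (@Rintegral_empirical _ _ _ _ (cst 1) 1)//; last by move=> p; rewrite normr1.
  by rewrite sumr_const card_ord mulVf// pnatr_eq0 -lt0n.
- move=> l; have [C hC] := class_fun_bounded R l.
  have [L hL] := class_fun_lipschitz R l.
  have f01 p : 0 <= class_fun l p <= C by rewrite class_fun_ge0 hC.
  have hL' r (y z : I01 R) :
      `|class_fun l (r, y) - class_fun l (r, z)| <= `|L| * `|val y - val z|.
    by apply: le_trans (hL r y z) _; rewrite ler_wpM2r// ler_norm.
  have := rank_average_cvg f01 (normr_ge0 L) hL'.
  have nf p : `|class_fun l p| <= C by have /andP[f0 fC] := f01 p; rewrite ger0_norm.
  have mf : measurable_fun setT (class_fun l : borel T -> R).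
    by apply: (@continuous_measurable_borel R T); exact: class_fun_continuous.
  by under eq_fun do rewrite -(Rintegral_empirical _ mf nf).
Qed.

End weak_convergence_of_tails.

Lemma ae_forall_countable d (Om : measurableType d) (R : realType)
    (P : {measure set Om -> \bar R}) (I : countType) (Q : I -> Om -> Prop) :
  (forall c, {ae P, forall w, Q c w}) -> {ae P, forall w, forall c, Q c w}.
Proof.
move=> h.
have : {ae P, forall w, forall n, if unpickle n is Some c then Q c w else True}.
  apply: ae_foralln => n; case: (unpickle n) => [c|]; first exact: h.
  exact: aeW.
by apply: filterS => w hw c; have := hw (pickle c); rewrite pickleK.
Qed.

(** Turns the real cut-off [z * N] into the integer cut-off of [behind]; a trivial cut-off must
    remain trivial, hence the clause at 0. *)
Lemma nat_threshold (R : realType) (a : R) :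
  exists m : nat, (a = 0 -> m = 0%N) /\ forall k, (m <= k)%N = (a <= k%:R).
Proof.
have ex : exists k : nat, a <= k%:R.
  exists (Num.truncn `|a|).+1.
  by rewrite (le_trans (ler_norm _))// ltW// truncnS_gt.
exists (ex_minn ex); case: ex_minnP => m am mmin; split.
  by move=> a0; apply/eqP; rewrite -leqn0; apply: mmin; rewrite a0.
move=> k; apply/idP/idP => [mk|/mmin//].
by rewrite (le_trans am)// ler_nat.
Qed.

Section rank_tail.
Context (R : realType) (N : nat) (x : {perm 'I_N})
  (nu : 'I_N -> {measure set R -> \bar R}) (tau : 'I_N -> nat -> R)
  (X : 'I_N -> R -> nat) (t : R).
Hypothesis jt : jump_times nu tau.
Hypothesis rp : ranking_path (fun i => (x i).+1) tau X.
Hypothesis nu_fin : forall i, (nu i `]0%R, t]%classic < +oo)%E.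
Hypothesis t_ge0 : 0 <= t.

Definition in_tail (s z : R) (i : 'I_N) : bool :=
  (z <= val (scaled R N (x i).+1)) && `[< nu i `]s, t]%classic = 0%E >].

Lemma rank_gt_tail s z i : 0 <= s -> s = 0 \/ z = 0 ->
  (N - \sum_(j < N) in_tail s z j < X i t)%N = in_tail s z i.
Proof.
move=> s0 sz; have N0 : (0 < N)%N by rewrite (leq_ltn_trans _ (ltn_ord i)).
have NR : 0 < N%:R :> R by rewrite ltr0n.
have [m [m0 hm]] := nat_threshold (z * N%:R).
have E j : (j \in behind x nu t s m) = in_tail s z j.
  rewrite inE /in_tail andbC hm scaledE ?ltn_ord//.
  by rewrite -addn1 natrD addrK ler_pdivlMr.
have sm : s = 0 \/ m = 0%N by case: sz => [->|z0]; [left|right; apply: m0; rewrite z0 mul0r].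
have -> : (\sum_(j < N) in_tail s z j)%N = #|behind x nu t s m|.
  rewrite -sum1_card [RHS]big_mkcond/=; apply: eq_bigr => j _; rewrite E.
  by case: (in_tail s z j).
by rewrite (rank_gt_behind jt rp nu_fin t_ge0 i s0 sm) E.
Qed.

(** Both bounds come from extreme tail sets: [behind] with cut-offs [t] and 0 contains every item,
    with cut-offs 0 and [N] none. *)
Lemma rank_itv i : (0 < X i t <= N)%N.
Proof.
apply/andP; split.
  have := rank_gt_behind jt rp nu_fin t_ge0 i t_ge0 (or_intror erefl).
  suff -> : i \in behind x nu t t 0.
    by move=> /(leq_ltn_trans (leq0n _)).
  by rewrite inE andbT; apply/asboolP; rewrite set_itvoc0 ?measure0.
have := rank_gt_behind jt rp nu_fin t_ge0 i (lexx 0) (or_introl erefl) (m := N).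
have -> : behind x nu t 0 N = finset.set0.
  by apply/setP => j; rewrite !inE leqNgt ltn_ord andbF.
by rewrite cards0 subn0 inE => /negbT; rewrite -leqNgt.
Qed.

End rank_tail.

Lemma in_tail_ni (R : realType) N (x : {perm 'I_N})
    (nu : 'I_N -> {measure set R -> \bar R}) (t s s' z z' : R) i :
  s <= s' -> z' <= z -> in_tail x nu t s z i -> in_tail x nu t s' z' i.
Proof.
move=> ss' zz' /andP[zi /asboolP h]; apply/andP; split; first exact: le_trans zi.
apply/asboolP/eqP; rewrite eq_le measure_ge0 andbT -h; apply: le_measure; rewrite ?inE//.
by apply: subset_itvr; rewrite bnd_simp.
Qed.

Theorem theorem1p3 (R : realType) (d : measure_display)
  (Omega : measurableType d) (P : probability Omega R)
  (rho : forall N : nat, 'I_N -> radon R)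
  (nu : forall N : nat, 'I_N -> Omega -> {measure set R -> \bar R})
  (tau : forall N : nat, 'I_N -> nat -> Omega -> R)
  (x : forall N : nat, {perm 'I_N})
  (X : forall N : nat, 'I_N -> R -> Omega -> nat)
  (mu0 : probability (borel (radon R * I01 R)%type) R)
  (rho_continuous : forall N (i : 'I_N) (t : R), 0 <= t ->
     rho N i [set t] = 0%E)
  (nu_poisson : forall N (i : 'I_N),
     poisson_random_measure P (rho N i) (nu N i))
  (nu_independent : forall N,
     independent P (fun i : 'I_N => sigma_rm (nu N i)))
  (nu_points : forall N, {ae P, forall w,
     jump_times (fun i => nu N i w) (fun i j => tau N i j w)})
  (X_ranking : forall N, {ae P, forall w,
     ranking_path (fun i => (x N i).+1) (fun i j => tau N i j w)
       (fun i t => X N i t w)})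
  (mu0_cvg : weak_cvg
     (fun N => configuration (rho N) (fun i => (x N i).+1)) mu0)
  (lambda_cvg : forall s t : R, 0 <= s <= t -> weak_cvg
     (fun N =>
        lambda (Lambda (configuration (rho N) (fun i => (x N i).+1))) s t)
     (lambda (Lambda mu0) s t))
  (t : R) (t_gt0 : 0 < t) (t0_inv : t0_inverse mu0 t) :
  exists mu_t : probability (borel (radon R * I01 R)%type) R,
    [/\ {ae P, forall w, weak_cvg
           (fun N => configuration (rho N) (fun i => X N i t w)) mu_t},
        forall (y : R) (A : set (borel (radon R))), measurable A ->
          0 <= y <= yC mu0 t ->
          U mu_t y A = (\int[Lambda mu0]_(r in A)
            (expR (- incr (t - t0 mu0 y t) t r))%:E)%E,
        forall (y : R) (A : set (borel (radon R))), measurable A ->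
          yC mu0 t <= y < 1 ->
          U mu_t y A = (\int[U mu0 (yhat mu0 y t)]_(r in A)
            (expR (- incr 0 t r))%:E)%E
      & yhat_inverse mu0 t].

Proof.
have no_atom := t0_inverse_no_atom t_gt0 t0_inv.
have lcvg (s : R) : 0 <= s <= t -> weak_cvg
    (fun N => lambda (Lambda (configuration (rho N) (fun i => (x N i).+1))) s t)
    (lambda (Lambda mu0) s t) by exact: lambda_cvg.
have lmass := level_mass mu0_cvg lcvg no_atom t_gt0.
have [mu_t mu_tE] := limit_law_exists t_gt0 lmass t0_inv.
exists mu_t; split; last 3 first.
- by move=> y A mA yi; exact: (U_limit_law_low lmass mu_tE mA yi).
- by move=> y A mA yi; exact: (U_limit_law_high t_gt0 lmass t0_inv mu_tE mA yi).
- exact: yhat_inverse_holds.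
pose lt_ := last_time mu0 t; pose st_ := start mu0 t.
have lt_itv y : 0 <= lt_ y <= t by exact: last_time_itv.
have st_itv y : y < 1 -> 0 <= st_ y <= 1.
  by move=> y1; have /andP[a /ltW b] := start_itv t_gt0 lmass y1; apply/andP.
(* The null set depends on [h] and [y]; below this is used for countably many pairs only. *)
have tails (h : radon R * I01 R -> R) (C y : R) : continuous h ->
    (forall p, 0 <= h p <= C) -> y < 1 ->
    {ae P, forall w, N%:R^-1 * \sum_(i < N)
      ((in_tail (x N) (fun i => nu N i w) t (lt_ y) (st_ y) i)%:R *
       h (rho N i, scaled R N (x N i).+1)) @[N --> \oo] -->
    \int[mu0]_p ((st_ y <= val p.2)%R%:R * (h p * survival (lt_ y) t p.1))}.
  move=> ch hC y1.
  have := tail_average_cvg nu_poisson nu_independent mu0_cvg lcvg t_gt0 t0_inv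
    (lt_itv y) (st_itv y y1) ch hC.
  apply: filterS => w.
  have E N : N%:R^-1 * \sum_(i < N)
      ((in_tail (x N) (fun i => nu N i w) t (lt_ y) (st_ y) i)%:R *
       h (rho N i, scaled R N (x N i).+1)) =
    N%:R^-1 * \sum_(i < N) ((st_ y <= val (scaled R N (x N i).+1))%R%:R *
       h (rho N i, scaled R N (x N i).+1) * \1_(no_jump nu t i (lt_ y)) w).
    congr (_ * _); apply: eq_bigr => i _; rewrite mulrAC; congr (_ * _).
    rewrite indicE -natrM mulnb; congr ((nat_of_bool _)%:R); congr (_ && _).
  by rewrite (funext E).
(* The constant function yields the relative sizes of the tail sets. *)
pose one_fun : radon R * I01 R -> R := cst 1.
have h1 p : 0 <= one_fun p <= 1 by rewrite /one_fun/= ler01 lexx.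
have mass : {ae P, forall w, forall c : nat * nat, (c.2 < c.1)%N ->
    N%:R^-1 * \sum_(i < N) (in_tail (x N) (fun i => nu N i w) t
       (lt_ (c.2%:R / c.1%:R)) (st_ (c.2%:R / c.1%:R)) i)%:R @[N --> \oo] -->
    (1 - c.2%:R / c.1%:R : R)}.
  apply: ae_forall_countable => -[n k] /=; case: (ltnP k n) => kn; last exact: aeW.
  have /andP[y0 y1] := grid_itv R kn.
  have := tails one_fun 1 _ (@cst_continuous _ _ _) h1 y1.
  apply: filterS => w + _.
  have -> : \int[mu0]_p ((st_ (k%:R / n%:R) <= val p.2)%R%:R *
      (one_fun p * survival (lt_ (k%:R / n%:R)) t p.1)) = 1 - k%:R / n%:R.
    rewrite -(weight_mass t_gt0 lmass t0_inv (grid_itv R kn)).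
    by apply: eq_Rintegral => p _; rewrite /one_fun/= mul1r.
  have E N : N%:R^-1 * \sum_(i < N) (in_tail (x N) (fun i => nu N i w) t
       (lt_ (k%:R / n%:R)) (st_ (k%:R / n%:R)) i)%:R =
    N%:R^-1 * \sum_(i < N) ((in_tail (x N) (fun i => nu N i w) t
       (lt_ (k%:R / n%:R)) (st_ (k%:R / n%:R)) i)%:R *
       one_fun (rho N i, scaled R N (x N i).+1)).
    by congr (_ * _); apply: eq_bigr => i _; rewrite /one_fun/= mulr1.
  by rewrite (funext E).
have class : {ae P, forall w, forall c : seq hat_index * nat * nat * nat,
    let: (l, n, k, j) := c in (k < n)%N -> (j < n)%N ->
    N%:R^-1 * \sum_(i < N) ((in_tail (x N) (fun i => nu N i w) t
       (lt_ (j%:R / n%:R)) (st_ (j%:R / n%:R)) i)%:R *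
       class_fun l (rho N i, point_at (k%:R / n%:R : R))) @[N --> \oo] -->
    \int[mu_t]_p ((j%:R / n%:R <= val p.2)%R%:R *
      class_fun l (p.1, point_at (k%:R / n%:R : R)))}.
  apply: ae_forall_countable => -[[[l n] k] j].
  case: (ltnP k n) => kn; last exact: aeW.
  case: (ltnP j n) => jn; last exact: aeW.
  have /andP[y0 y1] := grid_itv R jn.
  have [C hC] := class_fun_bounded R l.
  (* With the position frozen at a grid point [h] depends on the measure alone, so the defining
     property [mu_tE] of the limit law identifies the limit. *)
  pose h (p : radon R * I01 R) : R := class_fun l (p.1, point_at (k%:R / n%:R : R)).
  have ch : continuous h.
    move=> p.
    apply: (@continuous_comp _ (radon R * I01 R)%type R
      (fun p : radon R * I01 R => (p.1, point_at (k%:R / n%:R))) (class_fun l)).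
      apply: (@cvg_pair _ _ _ (nbhs p) (nbhs p.1) (nbhs (point_at (k%:R / n%:R)))
        _ _ _ fst (fun=> point_at (k%:R / n%:R))); last exact: cvg_cst.
      exact: fst_continuous.
    exact: class_fun_continuous.
  have h01 p : 0 <= h p <= C by rewrite class_fun_ge0 hC.
  have := tails h C _ ch h01 y1.
  apply: filterS => w + _ _.
  suff -> : \int[mu_t]_p ((j%:R / n%:R <= val p.2)%R%:R * h p) =
      \int[mu0]_p ((st_ (j%:R / n%:R) <= val p.2)%R%:R *
        (h p * survival (lt_ (j%:R / n%:R)) t p.1)) by [].
  rewrite /Rintegral; congr fine.
  apply: (mu_tE _ (fun r => class_fun l (r, point_at (k%:R / n%:R : R)))); last 1 first.
  - by move=> r; exact: class_fun_ge0.
  - exact: grid_itv.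
  apply: (@continuous_measurable_borel R (radon R)) => r.
  apply: (@continuous_comp _ (radon R * I01 R)%type R
    (fun r : radon R => (r, point_at (k%:R / n%:R))) (class_fun l)).
    apply: (@cvg_pair _ _ _ (nbhs r) (nbhs r) (nbhs (point_at (k%:R / n%:R)))
      _ _ _ id (fun=> point_at (k%:R / n%:R))); last exact: cvg_cst.
    exact: cvg_id.
  exact: class_fun_continuous.
have finite : {ae P, forall w, forall N (i : 'I_N), (nu N i w `]0%R, t]%classic < +oo)%E}.
  have : {ae P, forall w, forall c : {N : nat & 'I_N},
      (nu (tag c) (tagged c) w `]0%R, t]%classic < +oo)%E}.
    by apply: ae_forall_countable => -[N i]; exact: (jumps_finite nu_poisson t i).
  by apply: filterS => v hv N i; exact: (hv (existT _ N i)).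
have points := ae_foralln nu_points.
have ranking := ae_foralln X_ranking.
(* Outside one null set, the tail averages converge at all grid levels and the paths have their
   explicit form for all [N]; the rest is deterministic. *)
apply: filterS (filterI mass (filterI class (filterI finite (filterI points ranking)))).
move=> w [w_mass [w_class [w_fin [w_jt w_rp]]]].
apply: (@weak_cvg_of_tails R rho (fun N i => X N i t w)
  (fun N i y => in_tail (x N) (fun i => nu N i w) t (lt_ y) (st_ y) i) mu_t).
- by move=> N i; exact: (rank_itv (w_jt N) (w_rp N) (@w_fin N) (ltW t_gt0)).
- move=> N i y y01.
  have /andP[l0 _] := lt_itv y.
  exact: (rank_gt_tail (w_jt N) (w_rp N) (@w_fin N) (ltW t_gt0) i l0
    (last_time_or_start mu0 t y)).
- move=> N i y y' y0 yy' y'1; apply: in_tail_ni.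
    exact: last_time_ni.
  exact: start_nd.
- by move=> n k kn; exact: (w_mass (n, k)).
- by move=> l n k j kn jn; exact: (w_class (l, n, k, j)).
Qed.
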